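(* Let $(A,\mathfrak m)$ be a complete local complete intersection with algebraically closed residue field $k=A/\mathfrak m$, and let $I$ be a proper ideal of $A$. Let $M$ be a finitely generated $A$-module. Then $$V(M)\subseteq\bigcup_i V(H_i(I,M)).$$ In particular, $$\operatorname{cx}_A M\le\max\{\operatorname{cx}_A H_j(I,M)\mid j=0,\dots,\mu(I)-\operatorname{grade}(I,M)\}.$$
   Context: $\mu(I)$ is the minimal number of generators of $I$. $H_j(I,M)=H_j(\mathbf u,M)$ is Koszul homology with coefficients in $M$ of a minimal generating set $\mathbf u$ of $I$ (independent, up to isomorphism, of the choice). $\operatorname{grade}(I,M)=\inf\{n:\operatorname{Ext}^n_A(A/I,M)\ne0\}$; the maximum over the empty set (which occurs for $M=0$) is $0$. Support variety: fix a presentation $A=Q/(f_1,\dots,f_r)$ with $(Q,\mathfrak n)$ a complete regular local ring and $f_1,\dots,f_r\in\mathfrak n^2$ a $Q$-regular sequence. For a finitely generated $A$-module $N$ with free resolution $(\mathbb F,\partial)$, lift $(\mathbb F,\partial)$ to a sequence of free $Q$-modules and maps $(\widetilde{\mathbb F},\widetilde\partial)$; then $\widetilde\partial^2=\sum_i f_i\widetilde t_i$ and the Eisenbud operators are $t_i=\widetilde t_i\otimes_Q A$, chain maps of degree $-2$ on $\mathbb F$. They make $\operatorname{Ext}^*_A(N,k)=\bigoplus_{n\ge0}\operatorname{Ext}^n_A(N,k)$ a finitely generated graded module over $S=k[t_1,\dots,t_r]$ with $\deg t_i=2$. $V(N)\subseteq\mathbb P^{r-1}(k)$ is the projective variety (zero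 set) defined by the annihilator in $S$ of $\operatorname{Ext}^*_A(N,k)$; $V(0)=\emptyset$. Complexity: $\operatorname{cx}_A N$ is the least integer $b\ge0$ such that $\dim_k\operatorname{Ext}^n_A(N,k)\le a\,n^{b-1}$ for some constant $a$ and all $n\gg0$; so $\operatorname{cx}_AN=0$ iff $\operatorname{projdim}_A N<\infty$, and $\operatorname{cx}_A 0=0$. *)

(* Defs.v *)
From HB Require Import structures.
From mathcomp Require Import all_boot all_order all_algebra.
From mathcomp Require Import boolp classical_sets.
From mathcomp Require Import mpoly.

Set Implicit Arguments.
Unset Strict Implicit.
Unset Printing Implicit Defensive.

Import GRing.Theory.
Local Open Scope classical_set_scope.
Local Open Scope ring_scope.

(* The least element of P. It is 0 when P is empty, which happens for none of
   the uses below over the rings considered. *)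
Definition least (P : set nat) : nat :=
  xget 0%N [set n | P n /\ forall m, P m -> (n <= m)%N].

Section Generators.
Variables (R : nzRingType) (V : lmodType R).

Definition lin_span (J : finType) (P : pred J) (g : J -> V) : set V :=
  [set x | exists c : J -> R, x = \sum_(i | P i) c i *: g i].

Definition generates (S : set V) n (g : 'I_n -> V) : Prop :=
  S = lin_span predT g.

Definition fin_gen (S : set V) : Prop :=
  exists n, exists g : 'I_n -> V, generates S g.

Definition mu (S : set V) : nat :=
  least [set n | exists g : 'I_n -> V, generates S g].

End Generators.

(* Ideals of R are the elements of submodClosed R^o. *)
Section LocalRings.
Variable R : comUnitRingType.

Definition noetherian : Prop :=
  forall J : submodClosed R^o, fin_gen [set` J].

Definition max_ideal : set R^o := [set x | (x : R) \isn't a GRing.unit].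

Definition local_ring : Prop :=
  noetherian /\
  forall x y : R, max_ideal x -> max_ideal y -> max_ideal (x + y).

Definition max_ideal_pow (n : nat) : set R :=
  [set x | exists N (c : 'I_N -> R) (y : 'I_N -> 'I_n -> R),
     (forall l j, max_ideal (y l j)) /\
     x = \sum_(l < N) c l * \prod_(j < n) y l j].

(* R -> lim R / m^n is bijective. *)
Definition complete : Prop :=
  forall x : nat -> R, (forall n, max_ideal_pow n (x n.+1 - x n)) ->
  exists! l : R, forall n, max_ideal_pow n (l - x n).

Definition prime_chain (d : nat) : Prop :=
  exists P : nat -> prime_idealr R, forall i, (i < d)%N ->
    {subset P i <= P i.+1} /\ ~ {subset P i.+1 <= P i}.

Definition krull_dim (d : nat) : Prop :=
  prime_chain d /\ forall e, prime_chain e -> (e <= d)%N.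

Definition regular_local : Prop :=
  local_ring /\ krull_dim (mu max_ideal).

Definition regular_sequence r (f : 'I_r -> R) : Prop :=
  (forall (i : 'I_r) (a : R),
     @lin_span R R^o _ [pred j : 'I_r | (j < i)%N] f (f i * a) ->
     @lin_span R R^o _ [pred j : 'I_r | (j < i)%N] f a) /\
  ~ @lin_span R R^o _ predT f 1.

End LocalRings.

(* A = Q / (f_1, ..., f_r), the projection being pi. *)
Record ci_presentation (Q A : comUnitRingType) r (f : 'I_r -> Q)
    (pi : {rmorphism Q -> A}) : Prop := CIPresentation {
  ci_regular : regular_local Q;
  ci_complete : complete Q;
  ci_max2 : forall i, max_ideal_pow 2 (f i);
  ci_regseq : regular_sequence f;
  ci_surj : forall a, exists q, pi q = a;
  ci_ker : forall q, pi q = 0 <-> @lin_span Q Q^o _ predT f q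
}.

(* k = A / m, the projection being rho. *)
Definition residue_map (A : comUnitRingType) (k : fieldType)
    (rho : {rmorphism A -> k}) : Prop :=
  (forall c, exists a, rho a = c) /\ (forall a, rho a = 0 <-> max_ideal a).

Section QuotientModule.
Variables (R : nzRingType) (V : lmodType R) (W : submodClosed V).

Definition zmod_of_submod : {pred V} := fun x => x \in W.

Fact zmod_of_submod_closed : zmod_closed zmod_of_submod.
Proof. exact: GRing.submod_closedB (submodClosedP W). Qed.

HB.instance Definition _ :=
  GRing.isZmodClosed.Build V zmod_of_submod zmod_of_submod_closed.

Definition quot_mod : Type := Quotient.quot zmod_of_submod.

HB.instance Definition _ := GRing.Zmodule.on quot_mod.

Local Notation cl := (\pi_(Quotient.quot zmod_of_submod))%qT.

Definition quot_scale (a : R) (x : quot_mod) : quot_mod := cl (a *: repr x).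

Fact quot_scaleE a (x : V) : quot_scale a (cl x) = cl (a *: x).
Proof.
apply/eqP; rewrite -Quotient.idealrBE -scalerBr.
have: repr (cl x) - x \in zmod_of_submod by rewrite Quotient.idealrBE reprK.
exact: (@rpredZ _ _ W).
Qed.

Fact quot_scaleA a b x : quot_scale a (quot_scale b x) = quot_scale (a * b) x.
Proof.
elim/quotW: x => x.
by rewrite (quot_scaleE b x) (quot_scaleE a) (quot_scaleE (a * b)) scalerA.
Qed.

Fact quot_scale1 : left_id 1 quot_scale.
Proof. by elim/quotW=> x; rewrite quot_scaleE scale1r. Qed.

Fact quot_scaleDr : right_distributive quot_scale +%R.
Proof.
move=> a; elim/quotW=> x; elim/quotW=> y.
rewrite (quot_scaleE a x) (quot_scaleE a y).
have -> : cl x + cl y = cl (x + y) by rewrite raddfD.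
by rewrite (quot_scaleE a) scalerDr raddfD.
Qed.

Fact quot_scaleDl x : {morph quot_scale^~ x : a b / a + b}.
Proof. by elim/quotW: x => x a b; rewrite (quot_scaleE (a + b)) (quot_scaleE a)
  (quot_scaleE b) scalerDl raddfD. Qed.

HB.instance Definition _ := GRing.Zmodule_isLmodule.Build R quot_mod
  quot_scaleA quot_scale1 quot_scaleDr quot_scaleDl.

End QuotientModule.

(* Z / (B :&: Z) *)
Section Subquotient.
Variables (R : nzRingType) (V : lmodType R) (Z B : submodClosed V).

Definition submod : Type := {x : V | x \in Z}.

HB.instance Definition _ := SubType.on submod.
HB.instance Definition _ := Choice.on submod.
HB.instance Definition _ := [SubChoice_isSubLmodule of submod by <:].

Definition submod_pred : {pred submod} := fun z => val z \in B.

Fact submod_pred_closed : submod_closed submod_pred.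
Proof.
have [B0 BD] := submodClosedP B.
split; rewrite ?unfold_in ?raddf0 // => a x y Bx By.
by rewrite unfold_in linearP BD.
Qed.

HB.instance Definition _ :=
  GRing.isSubmodClosed.Build R submod submod_pred submod_pred_closed.

Definition subquot : lmodType R := quot_mod submod_pred.

End Subquotient.

Section Koszul.
Variables (A : comUnitRingType) (m : nat) (u : 'I_m -> A) (M : lmodType A).

(* The Koszul complex K(u, M) with all degrees put together: x represents
   \sum_S e_S (x) (x S), where e_S is the wedge of the e_i, i in S, taken in
   increasing order. *)
Definition koszul : Type := {ffun {set 'I_m} -> M}.

HB.instance Definition _ := GRing.Lmodule.on koszul.

Definition koszul_deg (j : nat) (x : koszul) : Prop :=
  forall S : {set 'I_m}, #|S| != j -> x S = 0.

(* i is at position #|{l in T | l < i}| in i |: T. *)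
Definition koszul_diff (x : koszul) : koszul :=
  [ffun T : {set 'I_m} => \sum_(i | i \notin T)
     ((-1) ^+ #|[set l in T | (l < i)%N]| * u i) *: x (i |: T)].

Fact koszul_diff_is_linear : linear koszul_diff.
Proof.
move=> a x y; apply/ffunP=> T; rewrite !ffunE scaler_sumr -big_split /=.
apply: eq_bigr => i _.
by rewrite !ffunE scalerDr !scalerA [a * _]mulrC.
Qed.

Definition koszul_cycle (j : nat) : {pred koszul} :=
  fun x => `[< koszul_deg j x /\ koszul_diff x = 0 >].

Definition koszul_boundary (j : nat) : {pred koszul} :=
  fun x => `[< exists2 y, koszul_deg j.+1 y & x = koszul_diff y >].

Let koszul_diff0 : koszul_diff 0 = 0.
Proof.
by have := koszul_diff_is_linear (-1) 0 0; rewrite !scaleN1r !addNr.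
Qed.

Fact koszul_cycle_closed j : submod_closed (koszul_cycle j).
Proof.
split=> [|a x y /asboolP[xj dx] /asboolP[yj dy]]; apply/asboolP; split.
- by move=> S _; rewrite ffunE.
- exact: koszul_diff0.
- by move=> S Sj; rewrite !ffunE xj // yj // scaler0 addr0.
- by rewrite koszul_diff_is_linear dx dy scaler0 addr0.
Qed.

Fact koszul_boundary_closed j : submod_closed (koszul_boundary j).
Proof.
split=> [|a x y /asboolP[x' xj ->] /asboolP[y' yj ->]]; apply/asboolP.
  by exists 0; rewrite ?koszul_diff0 // => S _; rewrite ffunE.
exists (a *: x' + y'); last by rewrite koszul_diff_is_linear.
by move=> S Sj; rewrite !ffunE xj // yj // scaler0 addr0.
Qed.

HB.instance Definition _ j := GRing.isSubmodClosed.Build A koszul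
  (koszul_cycle j) (koszul_cycle_closed j).
HB.instance Definition _ j := GRing.isSubmodClosed.Build A koszul
  (koszul_boundary j) (koszul_boundary_closed j).

Definition koszul_homology (j : nat) : lmodType A :=
  subquot (koszul_cycle j) (koszul_boundary j).

End Koszul.

(* A resolution by finitely generated free modules F_n = 'rV_(rk n); the
   differential F_(n+1) -> F_n is right multiplication by dif n. *)
Record free_resolution (A : comUnitRingType) (N : lmodType A) := FreeResolution {
  rk : nat -> nat;
  dif : forall n, 'M[A]_(rk n.+1, rk n);
  aug : {linear 'rV[A]_(rk 0) -> N};
  aug_surj : forall x, exists y, aug y = x;
  aug_exact : forall x, aug x = 0 <-> exists y, x = y *m dif 0;
  dif_exact : forall n (x : 'rV_(rk n.+1)), x *m dif n = 0 <-> exists y, x = y *m dif n.+1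
}.

(* Ext^n_A(N, M) is the cohomology of Hom_A(F, M), where Hom_A(F_n, M) is
   'I_(rk n) -> M, and grade(I, M) is computed from a resolution of A/I. *)
Section Grade.
Variables (A : comUnitRingType) (N M : lmodType A) (F : free_resolution N).

Definition hom_diff n (x : 'I_(rk F n) -> M) : 'I_(rk F n.+1) -> M :=
  fun i => \sum_j dif F n i j *: x j.

Definition hom_boundary n : set ('I_(rk F n) -> M) :=
  match n with
  | 0 => [set x | forall i, x i = 0]
  | n'.+1 => [set x | exists y, forall i, x i = @hom_diff n' y i]
  end.

Definition ext_neq0 (n : nat) : Prop :=
  exists x : 'I_(rk F n) -> M,
    (forall i, hom_diff x i = 0) /\ ~ hom_boundary x.

(* inf {n | Ext^n_A(N, M) != 0}, with None for the infimum of the empty set *)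
Definition ext_inf : option nat :=
  if `[< exists n, ext_neq0 n >] then Some (least ext_neq0) else None.

End Grade.

Definition grade (A : comUnitRingType) (I : submodClosed A^o) (M : lmodType A)
    (F : free_resolution (quot_mod I)) : option nat := ext_inf M F.

(* Ext^n_A(N, k) is the cohomology of Hom_A(F, k), where Hom_A(F_n, k) is
   'cV[k]_(rk n): a column c represents x |-> rho(x) *m c. *)
Section ExtResidueField.
Variables (A : comUnitRingType) (k : fieldType) (rho : {rmorphism A -> k}).
Variables (N : lmodType A) (F : free_resolution N).

Definition ext_cocycles n : {vspace 'cV[k]_(rk F n)} :=
  lker (linfun (mulmx (map_mx rho (dif F n)))).

Definition ext_coboundaries n : {vspace 'cV[k]_(rk F n)} :=
  match n with
  | 0 => 0%VS
  | n'.+1 => limg (linfun (mulmx (map_mx rho (dif F n'))))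
  end.

Definition ext_dim n : nat := (\dim (ext_cocycles n) - \dim (ext_coboundaries n))%N.

Definition cx : nat :=
  least [set b | exists (a : rat) (n0 : nat), forall n, (n0 <= n)%N ->
    ((ext_dim n)%:R <= a * n%:R ^ (b%:Z - 1))%R].

End ExtResidueField.

(* A lift of F to a sequence of free Q-modules and maps, with the maps
   \tilde t_i : F~_(n+2) -> F~_n such that d~ d~ = \sum_i f_i t~_i. *)
Record eisenbud_lift (Q A : comUnitRingType) r (f : 'I_r -> Q)
    (pi : {rmorphism Q -> A}) (N : lmodType A) (F : free_resolution N) :=
  EisenbudLift {
  ldif : forall n, 'M[Q]_(rk F n.+1, rk F n);
  ldifE : forall n, map_mx pi (ldif n) = dif F n;
  lop : 'I_r -> forall n, 'M[Q]_(rk F n.+2, rk F n);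
  lopE : forall n, ldif n.+1 *m ldif n = \sum_i f i *: lop i n
}.

(* The points of P^(r-1)(k) are the lines of k^r. *)
Definition proj_point (k : fieldType) (r : nat) : Type :=
  {L : {vspace 'rV[k]_r} | \dim L == 1%N}.

Definition proj_zeros (k : fieldType) (r : nat) (J : set {mpoly k[r]}) :
    set (proj_point k r) :=
  [set L : proj_point k r | forall s, J s ->
     forall v : 'rV[k]_r, v \in val L -> v != 0 -> s.@[v 0] = 0].

Section SupportVariety.
Variables (Q A : comUnitRingType) (r : nat) (f : 'I_r -> Q).
Variables (pi : {rmorphism Q -> A}) (k : fieldType) (rho : {rmorphism A -> k}).
Variables (N : lmodType A) (F : free_resolution N) (E : eisenbud_lift f pi F).

Definition eisenbud_op (i : 'I_r) n : 'M[A]_(rk F n.+2, rk F n) :=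
  map_mx pi (lop E i n).

(* Elements of \bigoplus_n Hom_A(F_n, k), when finitely supported *)
Definition ext_cochain := forall n, 'cV[k]_(rk F n).

Definition op_act (i : 'I_r) (x : ext_cochain) : ext_cochain := fun n =>
  match n with
  | n'.+2 => map_mx rho (eisenbud_op i n') *m x n'
  | _ => 0
  end.

(* The operators commute up to homotopy, hence the order of composition is
   irrelevant on Ext. *)
Definition monomial_act (t : 'X_{1..r}) (x : ext_cochain) : ext_cochain :=
  foldr (fun i => iter (t i) (op_act i)) x (enum 'I_r).

Definition poly_act (s : {mpoly k[r]}) (x : ext_cochain) : ext_cochain :=
  fun n => \sum_(t <- msupp s) s@_t *: monomial_act t x n.

Definition ext_annihilator : set {mpoly k[r]} :=
  [set s | forall x : ext_cochain,
     (exists n0, forall n, (n0 <= n)%N -> x n = 0) ->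
     (forall n, x n \in ext_cocycles rho F n) ->
     forall n, poly_act s x n \in ext_coboundaries rho F n].

Definition support_variety : set (proj_point k r) := proj_zeros ext_annihilator.

End SupportVariety.

(* Main.v *)
Require Import Defs.
From HB Require Import structures.
From mathcomp Require Import all_boot all_order all_algebra.
From mathcomp Require Import boolp classical_sets.
From mathcomp Require Import mpoly.
From mathcomp Require Import ring.

Set Implicit Arguments.
Unset Strict Implicit.
Unset Printing Implicit Defensive.

Import GRing.Theory.
Local Open Scope classical_set_scope.
Local Open Scope ring_scope.

(* Over A, the complex K(u) (x) FM is a bounded below complex X of free modules
   with H_j(X) = H_j(I, M).  Killing H_m(X), ..., H_0(X) from the top, by cones of
   chain maps from shifted resolutions of H_j(I, M), leaves an exact complex, hence
   no cohomology of Hom(-, k).  The differential of K(u) vanishes in k, so Ext(M, k)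
   is cut out of H(Hom(X, k)), and the long exact sequences give
   dim Ext^n(M, k) <= sum_j dim Ext^(n-j)(H_j, k).  Lifting all complexes to Q, the
   Eisenbud operators of a cone are block triangular, hence commute with the maps
   of the long exact sequence: if s_j annihilates Ext(H_j, k) for all j, then
   s_0 ... s_m annihilates Ext(M, k).

   The complexities of the H_j are finite because the Betti numbers over A grow
   polynomially: going from Q / (f_1, ..., f_i) to Q / (f_1, ..., f_(i+1)), Betti
   numbers satisfy b_n <= b_(n-2) + b'_n, and over Q they vanish eventually, the
   maximal ideal being generated by a regular sequence.  This last fact rests on
   Krull's principal ideal theorem. *)

(** * Ideals as sets *)

(** The inclusion rests on the multiplicativity of evaluation: if a point lies in no V(H_j), each
    Ext(H_j, k) is annihilated by some s_j that is nonzero on one fixed vector of the line, and then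
    the product of the s_j is nonzero there too. Annihilators may be inhomogeneous, so nonvanishing
    at some vector of the line is first moved to the fixed one by rescaling the variables. The
    complexity bound does not go through varieties but through the dimension inequality. [cx] is a
    least element with default 0, so [cx] of H_j says something about Ext(H_j, k) only once some
    polynomial bound is known: this is where the growth of Betti numbers, hence the regularity of
    the ring Q, enters. The range j <= mu(I) - grade(I, M) comes from H_j(I, M) = 0 beyond it. Grade
    is given by Ext, and no regular sequence in I is chosen: M is embedded in M^m by z |-> (u_l
    z)_l, and the cokernel has vanishing Ext in one degree less. *)

Lemma leastP (P : set nat) : (exists n, P n) ->
  P (least P) /\ forall n, P n -> (least P <= n)%N.
Proof.
move=> exP; rewrite /least.
apply: (@xgetPex _ 0%N [set n | P n /\ forall m, P m -> (n <= m)%N]).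
have exP' : exists n, `[< P n >] by have [n Pn] := exP; exists n; apply/asboolP.
have [n /asboolP Pn n_min] := ex_minnP exP'.
by exists n; split=> // m Pm; apply: n_min; apply/asboolP.
Qed.

(** The type varies with n because the same principle builds ascending chains of ideals and
    comparison maps, whose matrix sizes depend on the degree. *)
Lemma dependent_choice (T : nat -> Type) (P : forall n, T n -> Prop)
    (R : forall n, T n -> T n.+1 -> Prop) :
  (exists x, P 0%N x) ->
  (forall n x, P n x -> exists2 y, P n.+1 y & R n x y) ->
  exists f : forall n, T n, forall n, P n (f n) /\ R n (f n) (f n.+1).
Proof.
move=> /cid[x0 Px0] step.
have step' n (x : {x | P n x}) : {y : {y | P n.+1 y} | R n (sval x) (sval y)}.
  case: x => x Px /=; have /cid2[y Py Rxy] := step n x Px.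
  by exists (exist _ y Py).
pose F := fix F n : {x : T n | P n x} :=
  if n is n'.+1 then sval (step' n' (F n')) else exist _ x0 Px0.
exists (fun n => sval (F n)) => n; split; first exact: svalP.
exact: (svalP (step' n (F n))).
Qed.

Section IdealSets.
Variable R : comUnitRingType.
Implicit Types (I J K P : set R) (x y z : R).

Definition ideal I : Prop :=
  [/\ I 0, forall x y, I x -> I y -> I (x + y) & forall a x, I x -> I (a * x)].

Definition prime_ideal P : Prop :=
  [/\ ideal P, ~ P 1 & forall x y, P (x * y) -> P x \/ P y].

Lemma idealN I x : ideal I -> I x -> I (- x).
Proof. by case=> _ _ IM Ix; rewrite -mulN1r; apply: IM. Qed.

Lemma idealB I x y : ideal I -> I x -> I y -> I (x - y).
Proof. by move=> hI Ix Iy; have [_ ID _] := hI; apply: ID => //; apply: idealN. Qed.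

Lemma ideal_mulr I a x : ideal I -> I x -> I (x * a).
Proof. by case=> _ _ IM Ix; rewrite mulrC; apply: IM. Qed.

Lemma idealBl I x y : ideal I -> I (x + y) -> I x -> I y.
Proof. by move=> hI Ixy Ix; rewrite -(addKr x y) addrC; apply: idealB. Qed.

Lemma ideal_sum I (J : finType) (p : pred J) (g : J -> R) :
  ideal I -> (forall j, p j -> I (g j)) -> I (\sum_(j | p j) g j).
Proof. by case=> I0 ID _ Ig; apply: (big_ind I) => //. Qed.

Lemma lin_span_ideal (J : finType) (p : pred J) (g : J -> R) :
  ideal (@lin_span R R^o J p g).
Proof.
split.
- by exists (fun=> 0); rewrite big1 // => i _; rewrite scale0r.
- move=> x y [c ->] [d ->]; exists (fun i => c i + d i).
  by rewrite -big_split; apply: eq_bigr => i _; rewrite scalerDl.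
- move=> a x [c ->]; exists (fun i => a * c i).
  by rewrite mulr_sumr; apply: eq_bigr => i _; rewrite -scalerA.
Qed.

Lemma lin_span_gen (J : finType) (p : pred J) (g : J -> R) j :
  p j -> @lin_span R R^o J p g (g j).
Proof.
move=> pj; exists (fun i => (i == j)%:R).
rewrite (bigD1 j) //= eqxx scale1r big1 ?addr0 // => i /andP[_ /negbTE->].
by rewrite scale0r.
Qed.

Lemma lin_span_min I (J : finType) (p : pred J) (g : J -> R) :
  ideal I -> (forall j, p j -> I (g j)) -> @lin_span R R^o J p g `<=` I.
Proof.
move=> hI Ig x [c ->]; apply: ideal_sum => // j pj.
by have [_ _ IM] := hI; apply/IM/Ig.
Qed.

Hypothesis R_noeth : noetherian R.

Lemma ideal_fin_gen I : ideal I ->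
  exists n (g : 'I_n -> R), I = @lin_span R R^o _ predT g.
Proof.
move=> [I0 ID IM].
have closedI : submod_closed (fun x : R^o => `[< I x >]).
  split; first exact/asboolP.
  by move=> a x y /asboolP Ix /asboolP Iy; apply/asboolP; apply: ID => //; apply: IM.
pose cI := GRing.isSubmodClosed.Build R R^o (fun x : R^o => `[< I x >]) closedI.
pose J : submodClosed R^o :=
  HB.pack (fun x : R^o => `[< I x >]) cI.
have [n [g gJ]] := R_noeth J; exists n, g.
rewrite -gJ; apply/seteqP; split=> x /=; first by move=> Ix; apply/asboolP.
by move/asboolP.
Qed.

(** Otherwise dependent choice gives a strictly increasing sequence in F; the finitely many
    generators of its union lie in one member, which stops the sequence. *)
Lemma ideal_max (F : set (set R)) I0 : F `<=` ideal -> F I0 ->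
  exists I, [/\ F I, I0 `<=` I & forall J, F J -> I `<=` J -> J `<=` I].
Proof.
move=> Fideal FI0; apply: contrapT => nomax.
have [] := @dependent_choice (fun=> set R) (fun _ I => F I /\ I0 `<=` I)
  (fun _ I J => I `<=` J /\ ~ J `<=` I).
- by exists I0; split=> // x.
- move=> _ I [FI I0I]; apply: contrapT => noJ; apply: nomax; exists I.
  split=> // J FJ IJ; apply: contrapT => JI; apply: noJ.
  by exists J => //; split=> //; apply: subset_trans IJ.
move=> f fP.
have mono n m : (n <= m)%N -> f n `<=` f m.
  move=> /subnK <-; elim: (m - n)%N => // l IHl.
  by apply: subset_trans IHl _; have [_ []] := fP (l + n)%N.
pose U : set R := [set x | exists n, f n x].
have hf n : ideal (f n) by have [[/Fideal]] := fP n.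
have hU : ideal U.
  split; first by exists 0%N; case: (hf 0%N).
  - move=> x y [n fx] [m fy]; exists (maxn n m); have [_ fD _] := hf (maxn n m).
    by apply: fD; [apply: mono fx; apply: leq_maxl | apply: mono fy; apply: leq_maxr].
  - by move=> a x [n fx]; exists n; have [_ _ fM] := hf n; apply: fM.
have [n [g gU]] := ideal_fin_gen hU.
have /choice[N fN] : forall i, exists N, f N (g i).
  by move=> i; have : U (g i) by rewrite gU; apply: lin_span_gen.
pose M := \max_i N i.
have UM : U `<=` f M.
  rewrite gU; apply: lin_span_min => // i _.
  by apply: mono (fN i); apply: (leq_bigmax i).
by have [_ [_]] := fP M; apply=> x fx; apply: UM; exists M.+1.
Qed.

End IdealSets.

(** * Krull's principal ideal theorem *)

Section PrincipalIdeal.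
Variables (R : comUnitRingType) (p0 p1 p2 : set R).
Hypotheses (prime_p0 : prime_ideal p0) (prime_p1 : prime_ideal p1).
Hypothesis prime_p2 : prime_ideal p2.
Hypotheses (p01 : p0 `<=` p1) (p12 : p1 `<=` p2).
Implicit Types (J K N B : set R) (s t w z : R).

Let p02 : p0 `<=` p2. Proof. exact: subset_trans p12. Qed.
Let ideal_p0 : ideal p0. Proof. by case: prime_p0. Qed.
Let ideal_p1 : ideal p1. Proof. by case: prime_p1. Qed.
Let ideal_p2 : ideal p2. Proof. by case: prime_p2. Qed.

Lemma notin_primeM (P : set R) s t : prime_ideal P -> ~ P s -> ~ P t -> ~ P (s * t).
Proof. by case=> _ _ hP Ps Pt /hP[]. Qed.

Lemma notin_prime1 (P : set R) : prime_ideal P -> ~ P 1. Proof. by case. Qed.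

Lemma prime_idealX (P : set R) x n : prime_ideal P -> P (x ^+ n) -> P x.
Proof.
move=> hP; elim: n => [|n IHn]; first by rewrite expr0 => /(notin_prime1 hP).
by rewrite exprS; have [_ _ PM] := hP => /PM[].
Qed.

(* These sets correspond to the ideals of the localization of R / p0 at p2. *)
Definition local_ideal J : Prop :=
  [/\ ideal J, p0 `<=` J & forall s t, ~ p2 s -> J (s * t) -> J t].

(* B + w N in the localization *)
Definition local_add w B N : set R :=
  [set t | exists s n, [/\ ~ p2 s, N n & B (s * t - w * n)]].

Lemma local_ideal_p0 : local_ideal p0.
Proof.
by split=> // s t p2s; have [_ _ pM] := prime_p0 => /pM[]// /p02.
Qed.

Lemma local_idealT : local_ideal setT. Proof. by []. Qed.

Lemma local_ideal_add w B N :
  local_ideal B -> local_ideal N -> local_ideal (local_add w B N).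
Proof.
move=> [hB p0B satB] [hN p0N satN].
have [[B0 BD BM] [N0 ND NM]] := (hB, hN).
have n1 := notin_prime1 prime_p2.
split; first split.
- by exists 1, 0; split; rewrite // !mulr0 subr0.
- move=> x y [s [n [p2s Nn Bx]]] [s' [n' [p2s' Nn' By]]].
  exists (s * s'), (s' * n + s * n'); split.
  + exact: notin_primeM.
  + by apply: ND; apply: NM.
  + have -> : s * s' * (x + y) - w * (s' * n + s * n') =
      s' * (s * x - w * n) + s * (s' * y - w * n') by ring.
    by apply: BD; apply: BM.
- move=> a x [s [n [p2s Nn Bx]]]; exists s, (a * n); split=> //.
    exact: NM.
  have -> : s * (a * x) - w * (a * n) = a * (s * x - w * n) by ring.
  exact: BM.
- move=> x p0x; exists 1, 0; split=> //.
  by rewrite mul1r mulr0 subr0; apply: p0B.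
- move=> s t p2s [s' [n [p2s' Nn Bx]]]; exists (s' * s), n; split=> //.
    exact: notin_primeM.
  by rewrite -mulrA.
Qed.

Lemma local_addl w B N : local_ideal B -> local_ideal N -> B `<=` local_add w B N.
Proof.
move=> [[_ _ BM] _ _] [[N0 _ _] _ _] t Bt; exists 1, 0; split=> //.
  exact: notin_prime1.
by rewrite mul1r mulr0 subr0.
Qed.

Lemma local_addr w B N n : local_ideal B -> N n -> local_add w B N (w * n).
Proof.
move=> [[B0 _ _] _ _] Nn; exists 1, n; split=> //; first exact: notin_prime1.
by rewrite mul1r subrr.
Qed.

Lemma local_add_min w B N J : local_ideal J -> B `<=` J ->
  (forall n, N n -> J (w * n)) -> local_add w B N `<=` J.
Proof.
move=> [hJ _ satJ] BJ NJ t [s [n [p2s Nn Bt]]]; apply: satJ p2s _.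
have [_ JD _] := hJ.
by rewrite -(subrK (w * n) (s * t)); apply: JD; [apply: BJ | apply: NJ].
Qed.

Lemma local_addS w B N N' : N `<=` N' -> local_add w B N `<=` local_add w B N'.
Proof. by move=> NN' t [s [n [? /NN' ? ?]]]; exists s, n. Qed.

(** Stands for the statement that J' / J has length at least n, so that no length function is
    needed; the last inclusion may be an equality. *)
Fixpoint chain n J J' : Prop :=
  if n is n'.+1 then
    exists K, [/\ local_ideal K, J `<=` K, ~ K `<=` J & chain n' K J']
  else J `<=` J'.

Lemma chain_leq m n J J' : (m <= n)%N -> chain n J J' -> chain m J J'.
Proof.
elim: n m J => [|n IHn] [|m] J //= le_mn [K [hK JK KJ cK]].
  by apply: (subset_trans JK); apply: (IHn 0%N).
by exists K; split=> //; apply: IHn.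
Qed.

Lemma chain_sub n J J' : chain n J J' -> J `<=` J'.
Proof.
by elim: n J => // n IHn J [K [_ JK _ /IHn]]; apply: subset_trans.
Qed.

Lemma chain_subl n J J0 J' : J0 `<=` J -> chain n J J' -> chain n J0 J'.
Proof.
case: n => [|n] JJ; first exact: subset_trans.
move=> [K [hK JK KJ cK]]; exists K; split=> //; first exact: subset_trans JK.
by move=> /subset_trans/(_ JJ).
Qed.

Lemma chain_subr n J J' J1 : J' `<=` J1 -> chain n J J' -> chain n J J1.
Proof.
move=> JJ; elim: n J => [|n IHn] J; first by move=> /subset_trans; apply.
by move=> [K [hK JK KJ /IHn cK]]; exists K.
Qed.

Lemma chain_cat a b J K J' : chain a J K -> chain b K J' -> chain (a + b) J J'.
Proof.
elim: a J => [|a IHa] J /=; first exact: chain_subl.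
by move=> [K' [hK' JK' K'J cK']] cK; exists K'; split=> //; apply: IHa.
Qed.

Lemma chain_image (g : set R -> set R) J J' n :
  (forall N, local_ideal N -> local_ideal (g N)) ->
  (forall N N', N `<=` N' -> g N `<=` g N') ->
  (forall N N', local_ideal N -> local_ideal N' -> J `<=` N -> N' `<=` J' ->
     g N' `<=` g N -> N' `<=` N) ->
  local_ideal J -> chain n J J' -> chain n (g J) (g J').
Proof.
move=> gL gS ginj; suff: forall K, local_ideal K -> J `<=` K -> chain n K J' ->
  chain n (g K) (g J') by move=> /(_ J) h hJ; apply: h.
elim: n => [|n IHn] K hK JK /=; first exact: gS.
move=> [K' [hK' KK' K'K cK']]; exists (g K'); split.
- exact: gL.
- exact: gS.
- by move=> /ginj h; apply: K'K; apply: h => //; apply: chain_sub cK'.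
- by apply: IHn => //; apply: subset_trans KK'.
Qed.

(** Multiplication by w sends R / J onto (B + w R) / (B + w J). The hypothesis on B says that its
    kernel modulo B lies in J, so strict steps stay strict. *)
Lemma chain_add w B J J' n : local_ideal B -> local_ideal J ->
  (forall r, B (w * r) -> J r) ->
  chain n J J' -> chain n (local_add w B J) (local_add w B J').
Proof.
move=> hB hJ BJ; apply: chain_image => //.
- by move=> N; apply: local_ideal_add.
- by move=> N N'; apply: local_addS.
move=> N N' [[_ ND _] p0N satN] _ JN _ gN t N't.
have [|s [m [p2s Nm Bt]]] := gN (w * t); first exact: local_addr.
apply: satN p2s _; rewrite -(subrK m (s * t)); apply: ND => //.
by apply/JN/BJ; rewrite mulrBr mulrCA.
Qed.

Definition colon J w : set R := [set t | J (w * t)].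

Lemma local_ideal_colon J w : local_ideal J -> local_ideal (colon J w).
Proof.
move=> [[J0 JD JM] p0J satJ]; split; first split; rewrite /colon /=.
- by rewrite mulr0.
- by move=> t t'; rewrite mulrDr; apply: JD.
- by move=> c t; rewrite mulrCA; apply: JM.
- by move=> t pt; apply: JM; apply: p0J.
- by move=> s t p2s; rewrite mulrCA; apply: satJ.
Qed.

Lemma local_idealI J K : local_ideal J -> local_ideal K -> local_ideal (J `&` K).
Proof.
move=> [[J0 JD JM] p0J satJ] [[K0 KD KM] p0K satK].
split; first split=> //.
- by move=> x y [? ?] [? ?]; split; [apply: JD | apply: KD].
- by move=> a x [? ?]; split; [apply: JM | apply: KM].
- by move=> x p0x; split; [apply: p0J | apply: p0K].
- by move=> s t p2s [? ?]; split; [apply: satJ p2s _ | apply: satK p2s _].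
Qed.

(* The modular law: a strict inclusion stays strict after intersecting with K
   or after adding K. *)
Lemma chain_modular n J K J' : local_ideal J -> local_ideal K ->
  local_ideal J' -> chain n J J' ->
  exists a b, [/\ (n <= a + b)%N, chain a (J `&` K) (J' `&` K) &
                  chain b (local_add 1 K J) (local_add 1 K J')].
Proof.
move=> + hK hJ'; elim: n J => [|n IHn] J hJ /=.
  move=> JJ'; exists 0%N, 0%N; split=> //; first exact: setSI.
  exact: local_addS.
move=> [J1 [hJ1 JJ1 J1J /(IHn _ hJ1)[a [b [le_n ca cb]]]]].
have sI : J `&` K `<=` J1 `&` K by apply: setSI.
have sD : local_add 1 K J `<=` local_add 1 K J1 by apply: local_addS.
have [J1I|J1I] := pselect (J1 `&` K `<=` J `&` K); last first.
  exists a.+1, b; split=> //; last exact: chain_subl cb.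
  by exists (J1 `&` K); split=> //; apply: local_idealI.
exists a, b.+1; split; rewrite ?addnS //; first exact: chain_subl ca.
exists (local_add 1 K J1); split=> //; first exact: local_ideal_add.
move=> J1D; apply: J1J => c J1c.
have [|s [j [p2s Jj]]] := J1D c.
  by rewrite -[c]mul1r; apply: local_addr.
rewrite mul1r => Kc; have [hJi _ satJ] := hJ.
apply: satJ (p2s) _; rewrite -(subrK j (s * c)); case: (hJi) => _ JD _.
apply: JD => //; have [] // : (J `&` K) (s * c - j); apply: J1I; split=> //.
have [[_ _ J1M] _ _] := hJ1; apply: idealB; first by case: hJ1.
  exact: J1M.
exact: JJ1.
Qed.

(** Subadditivity of length, the part of Jordan-Hölder that is needed, obtained by intersecting the
    chain with K and adding K to it. *)
Lemma chain_split n J K J' : local_ideal J -> local_ideal K ->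
  local_ideal J' -> J `<=` K -> K `<=` J' -> chain n J J' ->
  exists a b, [/\ (n <= a + b)%N, chain a J K & chain b K J'].
Proof.
move=> hJ hK hJ' JK KJ' /(chain_modular hJ hK hJ')[a [b [le_n ca cb]]].
exists a, b; split=> //.
  apply: chain_subl (chain_subr _ ca) => [x Jx|x []//].
  by split=> //; apply: JK.
apply: chain_subl (chain_subr _ cb); first exact: local_addl.
by apply: local_add_min => // n0; rewrite mul1r.
Qed.

(** The configuration that the principal ideal theorem excludes: p2 is minimal over p0 + x R,
    although p1 lies strictly between p0 and p2. *)
Variable x : R.
Hypotheses (p2x : p2 x) (p1x : ~ p1 x) (p1_neq0 : ~ p1 `<=` p0).
Hypothesis R_noeth : noetherian R.
Hypothesis x_minimal : forall p, prime_ideal p -> p0 `<=` p -> p `<=` p2 ->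
  p x -> p2 `<=` p.

Let p0x : ~ p0 x. Proof. by move/p01. Qed.

Local Notation span1 w := (local_add w p0 setT).

(** The localization of R / (p0 + x^k R) at p2 has finite length, p2 being its only prime. A largest
    J with J / J0 of bounded length is the whole ring, since otherwise a simple submodule of R / J
    would enlarge it. *)
Lemma chain_bounded k :
  exists l : nat, forall n, chain n (span1 (x ^+ k)) setT -> (n <= l)%N.
Proof.
set J0 := span1 (x ^+ k).
have hJ0 : local_ideal J0.
  by apply: local_ideal_add; [apply: local_ideal_p0 | apply: local_idealT].
pose F : set (set R) := [set J | [/\ local_ideal J, J0 `<=` J &
  exists l : nat, forall n, chain n J0 J -> (n <= l)%N]].
have [||J [[hJ J0J [l bJ]] _ Jmax]] := @ideal_max _ R_noeth F J0.
- by move=> J [[]].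
- split=> //; exists 0%N => -[|n] //= [K [_ _ KJ0 /chain_sub]] //.
have [J1|J1] := pselect (J 1).
  exists l => n cn; apply: bJ; apply: chain_subr cn => t _.
  by have [[_ _ JM] _ _] := hJ; rewrite -[t]mulr1; apply: JM.
have [[Jz JD JM] p0J satJ] := hJ.
(* The annihilator of z in R / J; a maximal one is an associated prime of R / J, and by [x_minimal]
   it must be p2. *)
pose col z : set R := [set t | J (t * z)].
have hcol z : ideal (col z).
  split; rewrite /col /=; first by rewrite mul0r.
  - by move=> a b; rewrite mulrDl; apply: JD.
  - by move=> a b; rewrite -mulrA; apply: JM.
pose F' : set (set R) := [set p | exists2 z, ~ J z & p = col z].
have [||p [[z Jnz ->] _ pmax]] := @ideal_max _ R_noeth F' (col 1).
- by move=> p [z _ ->].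
- by exists 1.
have prime_p : prime_ideal (col z).
  split=> //; first by rewrite /col /= mul1r.
  move=> a b Jab; have [Jb|Jb] := pselect (J (b * z)); [by right | left].
  apply: (pmax (col (b * z))); first by exists (b * z).
  - by move=> t; rewrite /col /= mulrCA; apply: JM.
  - by rewrite /col /= mulrA.
have p2J : p2 `<=` col z.
  apply: x_minimal => //.
  - by move=> t /p0J Jt; apply: ideal_mulr; case: hJ.
  - by move=> s ps; apply: contrapT => /satJ/(_ ps).
  - apply: (@prime_idealX _ _ k) => //; apply: ideal_mulr; first by case: hJ.
    apply: J0J; rewrite -[x ^+ k]mulr1; apply: local_addr => //.
    exact: local_ideal_p0.
pose K := local_add z J setT.
have hK : local_ideal K by apply: local_ideal_add; rewrite // local_idealT.
have JK : J `<=` K by apply: local_addl.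
case: Jnz; apply: (Jmax K) => //; last first.
  by rewrite -[z]mulr1; apply: local_addr.
split=> //; first exact: subset_trans JK.
exists l.+1 => n /(chain_split hJ0 hJ hK J0J JK)[a [b [le_n /bJ le_a cb]]].
(* K / J is generated by z and killed by p2, hence simple after localization: at most one strict
   step fits between J and K. *)
apply: leq_trans le_n _; rewrite -addn1 leq_add // leqNgt.
apply/negP; case: b cb => [|[|b]] //=.
move=> [K1 [hK1 JK1 K1J [K2 [_ K12 K2K1 /chain_sub K2K]]]] _.
apply: K2K1; apply: (subset_trans K2K).
have [y K1y Jy] : exists2 y, K1 y & ~ J y.
  by apply: contrapT => no; apply: K1J => t K1t; apply: contrapT => Jt;
     apply: no; exists t.
have [s [c [p2s _ Jsa]]] : K y by apply/K2K/K12.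
have [hK1i _ satK1] := hK1.
have K1za : K1 (z * c).
  rewrite -[z * c](subKr (s * y)).
  apply: idealB => //; last exact: JK1.
  by have [_ _ K1M] := hK1i; apply: K1M.
have p2c : ~ p2 c.
  move=> /p2J Jaz; apply: Jy; apply: satJ p2s _.
  by rewrite -(subrK (z * c) (s * y)); apply: JD; rewrite // mulrC.
apply: local_add_min => // d _; have [_ _ K1M] := hK1i.
by rewrite mulrC; apply: K1M; apply: satK1 p2c _; rewrite mulrC.
Qed.

Lemma mul_powers_in_prime k : p0 (x ^+ k) -> False.
Proof. by move/prime_idealX => /(_ prime_p0)/p0x. Qed.

(* Kaplansky: for u a large power of x and y in p1, comparing the lengths of
   (u, y) / (u^2) and (u^2, y) / (u^2) gives u in (u^2, y), so u in p1. *)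
Lemma no_minimal_prime : False.
Proof.
have [y p1y p0y] : exists2 y, p1 y & ~ p0 y.
  by apply: contrapT => no; apply: p1_neq0 => t p1t; apply: contrapT => p0t;
     apply: no; exists t.
have [Lp0 LT] := (local_ideal_p0, local_idealT).
have p1P := notin_prime1 prime_p2.
(* The colon ideal (y) : x^j in the localization of R / p0. The exponent k is one where it stops
   growing: if a u^2 is in (y), so is a u. *)
pose C j : set R :=
  [set t | exists s c, ~ p2 s /\ p0 (s * t * x ^+ j - c * y)].
have hC j : ideal (C j).
  have [p00 p0D p0M] := ideal_p0.
  split.
  - by exists 1, 0; rewrite mulr0 !mul0r subr0.
  - move=> a b [s [c [p2s pa]]] [s' [c' [p2s' pb]]].
    exists (s * s'), (s' * c + s * c'); split; first exact: notin_primeM.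
    have -> : s * s' * (a + b) * x ^+ j - (s' * c + s * c') * y =
      s' * (s * a * x ^+ j - c * y) + s * (s' * b * x ^+ j - c' * y) by ring.
    by apply: p0D; apply: p0M.
  - move=> a t [s [c [p2s pt]]]; exists s, (a * c); split=> //.
    have -> : s * (a * t) * x ^+ j - a * c * y = a * (s * t * x ^+ j - c * y).
      by ring.
    exact: p0M.
pose F : set (set R) := [set D | exists2 j, (0 < j)%N & D = C j].
have [||D [[k k_gt0 ->] _ Ck_max]] := @ideal_max _ R_noeth F (C 1%N).
- by move=> D [j _ ->].
- by exists 1%N.
have {Ck_max}C2k : C (k + k)%N `<=` C k.
  apply: Ck_max; first by exists (k + k)%N; rewrite // addn_gt0 k_gt0.
  move=> t [s [c [p2s pt]]]; exists s, (c * x ^+ k); split=> //.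
  rewrite exprD mulrA mulrAC -[c * _ * _]mulrAC -mulrBl.
  by rewrite mulrC; case: ideal_p0 => _ _; apply.
set u := x ^+ k in C2k *.
have p0u : ~ p0 u by apply: mul_powers_in_prime.
have p2u : p2 u by rewrite /u -(prednK k_gt0) exprS; apply: ideal_mulr.
have p1u : ~ p1 u by move/prime_idealX => /(_ prime_p1).
pose U := span1 u; pose U2 := span1 (u * u).
pose W := local_add (u * y) U2 setT.
pose S1 := local_add y U2 setT; pose S2 := local_add y U setT.
have LU : local_ideal U by apply: local_ideal_add.
have LU2 : local_ideal U2 by apply: local_ideal_add.
have LW : local_ideal W by apply: local_ideal_add.
have LS1 : local_ideal S1 by apply: local_ideal_add.
have LS2 : local_ideal S2 by apply: local_ideal_add.
have idT a : (setT : set R) a by [].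
have U2U : U2 `<=` U.
  apply: local_add_min => // [|n _]; first exact: local_addl.
  by rewrite -mulrA; apply: local_addr.
have US2 : U `<=` S2 by apply: local_addl.
have U2S1 : U2 `<=` S1 by apply: local_addl.
have Uu : U u by rewrite -[u]mulr1; apply: local_addr.
have S12 : S1 `<=` S2.
  apply: local_add_min => // [|n _]; first exact: subset_trans US2.
  exact: local_addr.
(* Multiplication by u identifies R / U with U / U2; the colon by u is the inverse on ideals. *)
have chain_U2U a : chain a U2 U -> chain a U setT.
  move=> /(@chain_image (colon^~ u)) h.
  suff : chain a (colon U2 u) (colon U u).
    move/(@chain_subr _ _ _ setT) => h'; apply: chain_subl (h' _) => //.
    apply: local_add_min; first exact: local_ideal_colon.
      by have [_] := local_ideal_colon u LU2.
    by move=> n _; rewrite /colon /= mulrA; apply: local_addr.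
  apply: h => //; [by move=> N; apply: local_ideal_colon|by move=> N N' NN' t; apply: NN'|].
  move=> N N' [[_ ND _] p0N satN] [hN' p0N' satN'] _ N'U gN t N't.
  have [s [c [p2s _ pt]]] := N'U t N't.
  apply: satN p2s _; rewrite -(subrK (u * c) (s * t)).
  apply: ND; [exact: p0N | apply: gN].
  rewrite /colon /= -[u * c](subKr (s * t)).
  apply: idealB => //; last exact: p0N'.
  by have [_ _ N'M] := hN'; apply: N'M.
(* Multiplication by u embeds S2 / U in W / U2. *)
have chain_US2 b : chain b U S2 -> chain b U2 W.
  have Uu0 r : p0 (u * r) -> U r.
    by have [_ _ pM] := prime_p0 => /pM[] //; apply: local_addl.
  move=> /(chain_add Lp0 LU Uu0)/chain_subl h.
  apply: (@chain_subr _ _ (local_add u p0 S2)); last first.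
    apply: h; apply: local_add_min => [||n _]; first exact: local_ideal_add.
      exact: local_addl.
    by rewrite -mulrA; apply: local_addr => //; apply: local_addr.
  have [_ p0W _] := LW.
  apply: local_add_min => //; suff : S2 `<=` colon W u by [].
  apply: local_add_min; first exact: local_ideal_colon.
    apply: local_add_min; first exact: local_ideal_colon.
      by have [_] := local_ideal_colon u LW.
    move=> n _; rewrite /colon /= mulrA; apply: local_addl => //.
    exact: local_addr.
  by move=> n _; rewrite /colon /= mulrA; apply: local_addr.
(* The choice of k is used here: it gives (W : y) inside U, so that S1 / W is at least as long as R
   / U. *)
have WU r : W (y * r) -> U r.
  move=> [s [b [p2s _ [s' [a [p2s' _ pa]]]]]].
  have [|s2 [c [p2s2 pc]]] := C2k a.
    exists 1, (s' * (s * r - u * b)); split=> //.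
    have -> : 1 * a * x ^+ (k + k) - s' * (s * r - u * b) * y =
      - (s' * (s * (y * r) - u * y * b) - u * u * a).
      by rewrite exprD -/u; ring.
    exact: idealN.
  exists (s2 * s' * s), (s2 * s' * b + c); split=> //.
    by apply: notin_primeM => //; apply: notin_primeM.
  have : p0 (y * (s2 * s' * s * r - u * (s2 * s' * b + c))).
    have -> : y * (s2 * s' * s * r - u * (s2 * s' * b + c)) =
       s2 * (s' * (s * (y * r) - u * y * b) - u * u * a) + u * (s2 * a * u - c * y).
      by ring.
    by have [_ pD pM] := ideal_p0; apply: pD; apply: pM.
  by have [_ _ pM] := prime_p0 => /pM[].
have chain_S1 a : chain a U setT -> chain a W S1.
  move=> /(chain_add LW LU WU)/chain_subl h.
  apply: (@chain_subr _ _ (local_add y W setT)); last first.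
    by apply: h; apply: local_addl.
  apply: local_add_min => [//||n _]; last exact: local_addr.
  apply: local_add_min => // n _; rewrite [u * y]mulrC -mulrA.
  exact: local_addr.
have [l bl] := chain_bounded (k + k).
rewrite exprD -/u -/U2 in bl.
have nS1u : ~ S1 u.
  move=> [s [a [p2s _ [s' [b [p2s' _ pb]]]]]].
  have : p1 ((s' * s - u * b) * u).
    have -> : (s' * s - u * b) * u = (s' * (s * u - y * a) - u * u * b) + s' * a * y.
      by ring.
    by have [_ pD pM] := ideal_p1; apply: pD; [apply: p01 | apply: pM].
  have [_ _ pM] := prime_p1 => /pM[] // /p12 p2ss.
  apply: (notin_primeM prime_p2 p2s' p2s).
  rewrite -(subrK (u * b) (s' * s)); have [_ pD _] := ideal_p2.
  by apply: pD => //; apply: ideal_mulr.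
have nS21 : ~ S2 `<=` S1 by move=> /(_ u) S2u; apply/nS1u/S2u/US2.
(* A chain from U2 to S2 is split at U, and its two pieces are moved into S1 / W and W / U2. So S1 /
   U2 is as long as S2 / U2, and the strict step from S1 to S2 adds one more. *)
have longer n : chain n U2 S2 -> chain n.+1 U2 S2.
  move=> /(chain_split LU2 LU LS2 U2U US2)[a [b [le_n ca cb]]].
  have c1 := chain_cat (chain_US2 _ cb) (chain_S1 _ (chain_U2U _ ca)).
  have : chain (b + a + 1) U2 S2 by apply: (chain_cat c1); exists S2; split.
  by apply: chain_leq; rewrite addn1 ltnS addnC.
have : forall n, chain n U2 S2 by elim=> [|n /longer//]; apply: subset_trans US2.
move=> /(_ l.+1) cl; suff: (l < l)%N by rewrite ltnn.
by apply: bl; apply: chain_subr cl.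
Qed.
End PrincipalIdeal.

(** * Regular local rings *)

Definition partial_span (R : comUnitRingType) d (g : 'I_d -> R) (i : nat) : set R :=
  @lin_span R R^o _ [pred j : 'I_d | (j < i)%N] g.

Section RegularLocal.
Variable R : comUnitRingType.
Hypothesis R_noeth : noetherian R.
Implicit Types (p : set R) (x y : R).

Definition strict_sub (I J : set R) : Prop := I `<=` J /\ ~ J `<=` I.

(** The principal ideal theorem as it is used: the middle prime can be replaced by one containing x,
    since otherwise p2 would be minimal over p0 + x R. *)
Lemma prime_through p0 p1 p2 x : prime_ideal p0 -> prime_ideal p1 ->
  prime_ideal p2 -> strict_sub p0 p1 -> strict_sub p1 p2 -> p2 x ->
  exists p, [/\ prime_ideal p, strict_sub p0 p, strict_sub p p2 & p x].
Proof.
move=> hp0 hp1 hp2 [p01 p10] [p12 p21] p2x.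
have [p1x|p1x] := pselect (p1 x); first by exists p1.
apply: contrapT => nop.
apply: (no_minimal_prime hp0 hp1 hp2 p01 p12 p2x p1x p10 R_noeth).
move=> p hp p0p pp2 px; apply: contrapT => p2p; apply: nop; exists p; split=> //.
by split=> // pp0; apply/p1x/p01/pp0.
Qed.

Definition set_chain e (c : nat -> set R) : Prop :=
  (forall i, (i <= e)%N -> prime_ideal (c i)) /\
  (forall i, (i < e)%N -> strict_sub (c i) (c i.+1)).

(** Applying [prime_through] from the top downwards brings x into the second member; deleting the
    first one costs one step. *)
Lemma set_chain_shift e c x : set_chain e.+1 c -> c e.+1 x ->
  exists c', [/\ set_chain e c', c' 0%N x, strict_sub (c 0%N) (c' 0%N) &
                 c' e = c e.+1].
Proof.
elim: e c => [|e IHe] c [cP cS] cx.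
  by exists (fun=> c 1%N); split=> //; [split=> // i _; apply: cP | apply: cS].
have [p [hp cp pc px]] := prime_through (cP e (ltnW (leqnSn _))) (cP e.+1 (leqnSn _))
  (cP e.+2 (leqnn _)) (cS e (leqnSn _)) (cS e.+1 (leqnn _)) cx.
pose b i := if (i <= e)%N then c i else p.
have [||c' [[c'P c'S] c'x cc' c'e]] := IHe b.
- split=> i; rewrite /b.
    by case: ifP => // /leqW/leqW le_i _; apply: cP.
  rewrite ltnS; case: ltngtP => // [lt_ie|->] _; last exact: cp.
  by apply: cS; rewrite !ltnS ltnW // ltnW.
- by rewrite /b ltnn.
exists (fun i => if (i <= e)%N then c' i else c e.+2); split=> //.
- split=> i; first by case: ifP => [/c'P//|_ _]; apply: cP.
  rewrite ltnS; case: ltngtP => // [lt_ie|->] _; first exact: c'S.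
  by rewrite c'e /b ltnn.
- by rewrite ltnn.
Qed.

Hypothesis R_local : forall x y : R, max_ideal x -> max_ideal y -> max_ideal (x + y).
Local Notation m := (@max_ideal R : set R).

Lemma max_ideal_prime : prime_ideal m.
Proof.
split; first split.
- by rewrite /max_ideal /= unitr0.
- exact: R_local.
- move=> a x mx; apply/negP; rewrite unitrM => /andP[_]; apply/negP; exact: mx.
- by rewrite /max_ideal /= unitr1.
- move=> x y; rewrite /max_ideal /= unitrM negb_and => /orP[]; by [left|right].
Qed.

Lemma prime_sub_max p : prime_ideal p -> p `<=` m.
Proof.
move=> [hp p1 _] x px; apply/negP => /mulVr ux.
by apply: p1; rewrite -ux; have [_ _ pM] := hp; apply: pM.
Qed.

Lemma unitB1_max x : m x -> 1 - x \is a GRing.unit.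
Proof.
move=> mx; apply/negPn/negP => /(R_local mx).
by rewrite addrC subrK /max_ideal /= unitr1.
Qed.

Lemma set_chain_top e c : set_chain e.+1 c ->
  exists2 c', set_chain e.+1 c' & c' e.+1 = m.
Proof.
move=> [cP cS]; exists (fun i => if (i <= e)%N then c i else m); last by rewrite ltnn.
split=> i; first by case: ifP => [/leqW/cP|_ _] //; apply: max_ideal_prime.
rewrite ltnS; case: ltngtP => // [lt_ie|->] _; first by apply: cS; rewrite ltnW.
have [cc cc'] := cS e (leqnn _).
split; first by apply: prime_sub_max; apply: cP.
by move=> mc; apply: cc' => x /(prime_sub_max (cP _ (leqnn _)))/mc.
Qed.

Variables (d : nat) (g : 'I_d -> R).
Hypothesis g_gen : @generates R R^o m _ g.

Local Notation partial := (partial_span g).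

Let g_max i : m (g i).
Proof. by rewrite g_gen; apply: (lin_span_gen (R := R)). Qed.

Let partial_d : partial d = m.
Proof.
rewrite g_gen; apply/seteqP; split.
  apply: lin_span_min; first exact: lin_span_ideal.
  by move=> j _; apply: (lin_span_gen (R := R)).
apply: lin_span_min; first exact: lin_span_ideal.
by move=> j _; apply: (lin_span_gen (R := R)); rewrite /= ltn_ord.
Qed.

Let partialS i (lt_id : (i < d)%N) (I : set R) : ideal I ->
  partial i `<=` I -> I (g (Ordinal lt_id)) -> partial i.+1 `<=` I.
Proof.
move=> hI sI gI; apply: lin_span_min => // j /=.
rewrite ltnS leq_eqVlt => /orP[/eqP eq_j|lt_j].
  by have -> : j = Ordinal lt_id by apply: val_inj.
by apply/sI/(lin_span_gen (R := R)).
Qed.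

(** Each shift absorbs one more generator and loses one step. When all d are absorbed, the bottom
    prime contains m and no strict step is left. *)
Lemma set_chain_bound e i c : (i <= d)%N -> set_chain e c -> c e = m ->
  partial i `<=` c 0%N -> (e + i <= d)%N.
Proof.
elim: e i c => // e IHe i c le_id hc ce sc.
have [lt_id|ge_id] := ltnP i d; last first.
  have eq_id : i = d by apply/eqP; rewrite eqn_leq le_id.
  have [cP cS] := hc; have [] := cS 0%N isT.
  move=> _ []; apply: subset_trans (prime_sub_max (cP 1%N isT)) _.
  by by rewrite eq_id partial_d in sc.
have [|c' [hc' c'x [cc' _] c'e]] := @set_chain_shift e c (g (Ordinal lt_id)) hc.
  by rewrite ce.
rewrite addSnnS; apply: (IHe _ c'); rewrite ?c'e //.
apply: partialS c'x; last exact: subset_trans cc'.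
by have [/(_ 0%N isT)[]] := hc'.
Qed.

Hypothesis g_dim : krull_dim R d.

Lemma set_chain_exists i : (i <= d)%N ->
  exists c, [/\ set_chain (d - i) c, c (d - i)%N = m & partial i `<=` c 0%N].
Proof.
elim: i => [_|i IHi lt_id].
  have sub0 (c : nat -> set R) : prime_ideal (c 0%N) -> partial 0 `<=` c 0%N.
    case=> hc _ _; exact: (@lin_span_min R (c 0%N) _ [pred j : 'I_d | (j < 0)%N] g hc).
  rewrite subn0; have [[P hP] _] := g_dim.
  have PP i : prime_ideal [set x | x \in P i].
    split; first split; rewrite /=.
    - exact: (@rpred0 _ (P i)).
    - by move=> x y; apply: (@rpredD _ (P i)).
    - by move=> a x; apply: (@idealMr _ (P i)).
    - by rewrite idealr1.
    - by move=> x y; rewrite prime_idealrM => /orP[]; [left | right].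
  pose c i := [set x | x \in P i].
  have hc : set_chain d c by split=> i lt_id; [apply: PP | have [] := hP i lt_id].
  have [d0|d_gt0] := posnP d.
    exists (fun=> m); split=> //; last exact/(sub0 (fun=> m))/max_ideal_prime.
    by split=> [i _|i]; [apply: max_ideal_prime | rewrite d0].
  rewrite -(prednK d_gt0) in hc; have [c' hc' c'm] := set_chain_top hc.
  rewrite (prednK d_gt0) in hc' c'm.
  by exists c'; split=> //; apply: sub0; case: hc' => /(_ 0%N isT).
have [c [hc cd sc]] := IHi (ltnW lt_id).
have eq_e : (d - i = (d - i.+1).+1)%N by rewrite subnSK.
rewrite eq_e in hc cd.
have [|c' [hc' c'x [cc' _] c'e]] := @set_chain_shift _ c (g (Ordinal lt_id)) hc.
  by rewrite cd.
exists c'; rewrite c'e; split=> //; apply: partialS c'x.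
  by have [/(_ 0%N isT)[]] := hc'.
exact: subset_trans cc'.
Qed.

(* A minimal member p0 of a longest chain above (g_1, ..., g_i) satisfies
   p0 = (g_1, ..., g_i) + g_(i+1) p0, since (g_1, ..., g_(i+1)) is prime; Nakayama. *)
Lemma partial_prime i : (i <= d)%N -> prime_ideal (partial i).
Proof.
move=> le_id; rewrite -(subKn le_id); have := leq_subr i d.
move: (d - i)%N => l; elim: l {i le_id} => [_|l IHl lt_ld].
  by rewrite subn0 partial_d; apply: max_ideal_prime.
have := IHl (ltnW lt_ld); have : (d - l = (d - l.+1).+1)%N by rewrite subnSK.
have lt_id : (d - l.+1 < d)%N by rewrite ltn_subrL /= (leq_trans _ lt_ld).
move: (d - l.+1)%N lt_id => i lt_id -> {l IHl lt_ld} hpS.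
have [c [hc cd sc]] := set_chain_exists (ltnW lt_id).
have eq_e : (d - i = (d - i.+1).+1)%N by rewrite subnSK.
rewrite eq_e in hc cd; set e := (d - i.+1)%N in eq_e hc cd.
set x := g (Ordinal lt_id).
have [|c' [hc' c'x [cc' _] c'e]] := @set_chain_shift _ c x hc.
  by rewrite cd; apply: g_max.
have hc0 : prime_ideal (c 0%N) by case: hc => /(_ 0%N isT).
have hc'0 : prime_ideal (c' 0%N) by case: hc' => /(_ 0%N isT).
have sc' : partial i.+1 `<=` c' 0%N.
  by apply: partialS c'x; [case: hc'0|apply: subset_trans cc'].
have too_long b : set_chain e.+1 b -> b e.+1 = m -> partial i.+1 `<=` b 0%N -> False.
  move=> hb be sb; have := set_chain_bound lt_id hb be sb.
  by rewrite addSn /e subnK // ltnn.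
(* Otherwise the prime [partial i.+1] could be put in front of c', giving a chain longer than
   [set_chain_bound] permits. *)
have c'p : c' 0%N `<=` partial i.+1.
  apply: contrapT => nc'p.
  apply: (@too_long (fun i' => if i' is j.+1 then c' j else partial i.+1)).
  - by have [c'P c'S] := hc'; split=> -[|j] //; [apply: c'P | apply: c'S].
  - by rewrite /= c'e.
  - by [].
have c0x : ~ c 0%N x.
  move=> cx; apply: (too_long c) => //; apply: partialS => //; by case: hc0.
suff <- : c 0%N = partial i by [].
apply/seteqP; split=> // y cy.
have [hpi [p0 pD pM]] : ideal (partial i) /\ ideal (partial i).
  by split; apply: lin_span_ideal.
have [hci [c00 cD cM]] : ideal (c 0%N) /\ ideal (c 0%N) by case: hc0.
have divx a : c 0%N a -> exists j b, [/\ partial i j, c 0%N b & a = j + x * b].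
  move=> ca; have : partial i.+1 a by apply/c'p/cc'.
  pose I : set R := [set t | exists j b, partial i j /\ t = j + x * b].
  have hI : ideal I.
    split.
    - by exists 0, 0; rewrite mulr0 addr0.
    - move=> t t' [j [b [pj ->]]] [j' [b' [pj' ->]]].
      exists (j + j'), (b + b'); split; [exact: pD | ring].
    - move=> u t [j [b [pj ->]]]; exists (u * j), (u * b); split; [exact: pM | ring].
  have /[apply] : partial i.+1 `<=` I.
    apply: (partialS (lt_id := lt_id)) => //.
      by move=> t pt; exists t, 0; rewrite mulr0 addr0.
    by exists 0, 1; rewrite mulr1 add0r.
  move=> [j [b [pj eq_a]]]; exists j, b; split=> //.
  have : c 0%N (x * b) by apply: (idealBl (x := j) hci); [rewrite -eq_a|apply: sc].
  by have [_ _ cprime] := hc0 => /cprime[].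
pose adj a : set R := [set t | exists j b, partial i j /\ t = j + b * a].
have hadj a : ideal (adj a).
  split.
  - by exists 0, 0; rewrite mul0r addr0.
  - move=> t t' [j [b [pj ->]]] [j' [b' [pj' ->]]].
    exists (j + j'), (b + b'); split; [exact: pD | ring].
  - move=> u t [j [b [pj ->]]]; exists (u * j), (u * b); split; [exact: pM | ring].
(* Nakayama by maximality: take a in [c 0] with [adj a] maximal and write a = j + x b. Then b lies
   in [adj a], so (1 - x t) a is in [partial i] for some t, and 1 - x t is a unit. *)
pose F : set (set R) := [set I | exists2 a, c 0%N a & I = adj a].
have [||I [[a ca ->] ya amax]] := @ideal_max _ R_noeth F (adj y).
- by move=> I [a _ ->].
- by exists y.
have pa : partial i a.
  have [j [b [pj cb eq_a]]] := divx a ca.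
  have [|||j' [t [pj' eq_b]]] := amax (adj b) _ _ b.
  - by exists b.
  - move=> _ [j' [t [pj' ->]]]; exists (j' + t * j), (t * x).
    by split; [apply: pD => //; apply: pM | rewrite eq_a; ring].
  - by exists 0, 1; rewrite add0r mul1r.
  have ux : 1 - x * t \is a GRing.unit.
    by apply: unitB1_max; apply: ideal_mulr; [case: max_ideal_prime|apply: g_max].
  rewrite -[a](mulKr ux); apply: (pM); rewrite mulrBl mul1r {1}eq_a eq_b.
  have -> : j + x * (j' + t * a) - x * t * a = j + x * j' by ring.
  by apply: pD => //; apply: pM.
have [|j [t [pj ->]]] := ya y; first by exists 0, 1; rewrite add0r mul1r.
by apply: pD => //; apply: pM.
Qed.

(** As [partial i] is prime, only membership of g_i in it could fail the claim; then a chain of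
    length d - i would lie above i + 1 generators, one step too long. *)
Lemma partial_regular (i : 'I_d) a : partial i (g i * a) -> partial i a.
Proof.
have [hpi _ prime_pi] := partial_prime (ltnW (ltn_ord i)).
move=> /prime_pi[] // pgi; exfalso.
have [c [hc cd sc]] := set_chain_exists (ltnW (ltn_ord i)).
have := @set_chain_bound (d - i)%N i.+1 c (ltn_ord i) hc cd.
rewrite addnS subnK ?ltnn; last exact: ltnW.
suff: partial i.+1 `<=` c 0%N by move=> sc' /(_ sc').
have hi : Ordinal (ltn_ord i) = i by apply: val_inj.
apply: (@partialS _ (ltn_ord i)) => //; first by case: hc => /(_ 0%N isT)[].
by rewrite hi; apply: sc.
Qed.
End RegularLocal.

Lemma regular_local_generators (R : comUnitRingType) : regular_local R ->
  exists d (g : 'I_d -> R), @generates R R^o (@max_ideal R) _ g /\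
  forall (i : 'I_d) a, partial_span g i (g i * a) -> partial_span g i a.
Proof.
move=> [[R_noeth R_local] R_dim].
have max_fg : exists n (g : 'I_n -> R^o), @generates R R^o (@max_ideal R) n g.
  by apply: ideal_fin_gen => //; case: (max_ideal_prime R_local).
have [[g g_gen] _] := leastP max_fg.
exists (mu (@max_ideal R)), g; split=> // i a.
exact: (partial_regular R_noeth R_local g_gen).
Qed.

(** * Complexes and their cohomology over a field *)

Section ExactDim.
Variables (k : fieldType) (V1 V2 V3 : vectType k).
Variables (Z1 B1 : {vspace V1}) (Z2 B2 : {vspace V2}) (Z3 B3 : {vspace V3}).
Variables (a : 'Hom(V1, V2)) (b : 'Hom(V2, V3)).

(** For H1 -> H2 -> H3 exact in the middle, dim H2 <= dim H1 + dim H3. Each H is a pair of subspaces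
    B inside Z, and complements replace quotient spaces. *)
Lemma dim_exact3 : (B1 <= Z1)%VS -> (B2 <= Z2)%VS -> (B3 <= Z3)%VS ->
  (a @: B1 <= B2)%VS -> (b @: Z2 <= Z3)%VS ->
  (forall x, x \in Z2 -> b x \in B3 -> exists2 y, y \in Z1 & x - a y \in B2) ->
  (\dim Z2 - \dim B2 <= (\dim Z1 - \dim B1) + (\dim Z3 - \dim B3))%N.
Proof.
move=> B1Z1 B2Z2 B3Z3 aB1 bZ2 ex.
pose K := (Z2 :&: (b @^-1: B3))%VS; pose C1 := (Z1 :\: B1)%VS.
pose C2 := (Z2 :\: K)%VS.
have dC1 : (\dim Z1 - \dim B1 = \dim C1)%N.
  by rewrite -(dimv_cap_compl Z1 B1) (capv_idPr B1Z1) addKn.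
have dC2 : (\dim Z2 = \dim K + \dim C2)%N.
  by rewrite -(dimv_cap_compl Z2 K) (capv_idPr _) // capvSl.
have leK : (\dim K <= \dim C1 + \dim B2)%N.
  have KS : (K <= a @: C1 + B2)%VS.
    apply/subvP => x; rewrite memv_cap -memv_preim => /andP[Zx bx].
    have [y Zy xy] := ex x Zx bx.
    have: y \in (C1 + B1)%VS.
      by rewrite /C1 -{2}(capv_idPr B1Z1) addv_diff_cap.
    move=> /memv_addP[c Cc [e Be y_eq]]; apply/memv_addP.
    exists (a c); first exact: memv_img.
    exists (a e + (x - a y)); last by rewrite y_eq linearD /= addrA addrCA subrr addr0.
    by rewrite rpredD // (subvP aB1) // memv_img.
  apply: leq_trans (dimvS KS) (leq_trans (dimv_add_leqif _ _) _).
  by rewrite leq_add2r -(limg_ker_dim a C1) leq_addl.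
have leC2 : (\dim C2 + \dim B3 <= \dim Z3)%N.
  have C2Z2 : (C2 <= Z2)%VS by apply: diffvSl.
  have C2b0 x : x \in C2 -> b x \in B3 -> x = 0.
    move=> xC bx; apply/eqP; rewrite -memv0 -(capv_diff Z2 K).
    by rewrite memv_cap xC memv_cap (subvP C2Z2) // -memv_preim.
  have <- : \dim (b @: C2) = \dim C2.
    apply: limg_dim_eq; apply/eqP; rewrite -subv0; apply/subvP => x.
    rewrite memv_cap memv_ker => /andP[xC /eqP bx].
    by rewrite memv0 (C2b0 x) // bx mem0v.
  rewrite -dimv_disjoint_sum; last first.
    apply/eqP; rewrite -subv0; apply/subvP => y; rewrite memv_cap.
    by move=> /andP[/memv_imgP[x xC ->] /(C2b0 x xC)->]; rewrite linear0 mem0v.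
  by apply: dimvS; rewrite subv_add B3Z3 (subv_trans _ bZ2) // limgS.
rewrite dC1 dC2; move: leK leC2; rewrite leq_subLR.
set c1 := \dim C1; set c2 := \dim C2; set k0 := \dim K.
move=> le1 le2; apply: (@leq_trans (c1 + \dim B2 + (\dim Z3 - \dim B3))).
  by apply: leq_add => //; rewrite leq_subRL ?(leq_trans _ le2) ?leq_addl // addnC.
by rewrite [(c1 + _)%N]addnC addnA.
Qed.
End ExactDim.

(** No condition d d = 0 is imposed, because a lift to Q only satisfies d d = sum f_i t_i. *)
Record precomplex (R : nzRingType) := Precomplex {
  crk : nat -> nat;
  cdiff : forall n, 'M[R]_(crk n.+1, crk n)
}.

Definition prev (rk : nat -> nat) n := if n is n'.+1 then rk n' else 0%N.

Section Precomplex.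
Variable R : nzRingType.
Implicit Types (C Y : precomplex R).

Definition pdiff C n : 'M[R]_(crk C n, prev (crk C) n) :=
  match n with 0 => 0 | n'.+1 => cdiff C n' end.

Definition shift C : precomplex R := @Precomplex R (prev (crk C)) (pdiff C).

(** On row vectors the differential is (y, c) |-> (y d + c phi, - c d), with y in Y_n and c in
    C_(n-1). *)
Definition cone C Y (phi : forall n, 'M[R]_(crk C n, crk Y n)) : precomplex R :=
  @Precomplex R (fun n => crk Y n + prev (crk C) n)%N
    (fun n => block_mx (cdiff Y n) 0 (phi n) (- pdiff C n)).

Definition exact_at C n := forall x : 'rV[R]_(crk C n),
  x *m pdiff C n = 0 -> exists y, x = y *m cdiff C n.

End Precomplex.

Definition pmap (R S : nzRingType) (g : R -> S) (C : precomplex R) : precomplex S :=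
  @Precomplex S (crk C) (fun n => map_mx g (cdiff C n)).

Lemma pdiff_map (R S : nzRingType) (g : {rmorphism R -> S}) (C : precomplex R) n :
  pdiff (pmap g C) n = map_mx g (pdiff C n).
Proof. by case: n => //=; rewrite map_mx0. Qed.

Section Cohomology.
Variable k : fieldType.
Implicit Type E : precomplex k.

Definition cocyc E n (x : 'cV[k]_(crk E n)) : Prop := cdiff E n *m x = 0.
Definition cobd E n (x : 'cV[k]_(crk E n)) : Prop := exists w, x = pdiff E n *m w.

Definition hdim E n : nat :=
  (\dim (lker (linfun (mulmx (cdiff E n) : 'cV_(crk E n) -> _)))
   - \dim (limg (linfun (mulmx (pdiff E n) : 'cV_(prev (crk E) n) -> _))))%N.

Lemma mem_cocyc m n (M : 'M[k]_(m, n)) (x : 'cV_n) :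
  reflect (M *m x = 0) (x \in lker (linfun (mulmx M))).
Proof. by rewrite memv_ker lfunE; apply: eqP. Qed.

Lemma mem_cobd m n (M : 'M[k]_(m, n)) (x : 'cV_m) :
  reflect (exists w : 'cV_n, x = M *m w) (x \in limg (linfun (mulmx M))).
Proof.
apply: (iffP memv_imgP) => [[w _ ->]|[w ->]]; exists w; rewrite ?lfunE ?memvf //.
Qed.

Definition diff2_eq0 E := forall n, cdiff E n *m pdiff E n = 0.

Lemma hdim_exact E1 n1 E2 n2 E3 n3
    (a : 'M[k]_(crk E2 n2, crk E1 n1)) (b : 'M[k]_(crk E3 n3, crk E2 n2)) :
  diff2_eq0 E1 -> diff2_eq0 E2 -> diff2_eq0 E3 ->
  (forall y, cobd (E := E1) y -> cobd (E := E2) (a *m y)) ->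
  (forall x, cocyc (E := E2) x -> cocyc (E := E3) (b *m x)) ->
  (forall x, cocyc (E := E2) x -> cobd (E := E3) (b *m x) ->
     exists2 y, cocyc (E := E1) y & cobd (E := E2) (x - a *m y)) ->
  (hdim E2 n2 <= hdim E1 n1 + hdim E3 n3)%N.
Proof.
move=> d1 d2 d3 ha hb hab.
have sub E n : diff2_eq0 E ->
    (limg (linfun (mulmx (pdiff E n) : 'cV_(prev (crk E) n) -> _)) <=
     lker (linfun (mulmx (cdiff E n) : 'cV_(crk E n) -> _)))%VS.
  move=> dE; apply/subvP => x /mem_cobd[w ->]; apply/mem_cocyc.
  by rewrite mulmxA dE mul0mx.
apply: (@dim_exact3 k _ _ _ _ _ _ _ _ _ (linfun (mulmx a)) (linfun (mulmx b))).
- exact: sub.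
- exact: sub.
- exact: sub.
- apply/subvP => _ /memv_imgP[y /mem_cobd yB ->]; rewrite lfunE.
  by apply/mem_cobd; apply: ha.
- apply/subvP => _ /memv_imgP[x /mem_cocyc xZ ->]; rewrite lfunE.
  by apply/mem_cocyc; apply: hb.
- move=> x /mem_cocyc xZ; rewrite lfunE => /mem_cobd/(hab _ xZ)[y yZ xy].
  by exists y; [apply/mem_cocyc | rewrite lfunE; apply/mem_cobd].
Qed.

Lemma hdim_eq0 E n : (forall x, cocyc (E := E) x -> cobd (E := E) (n := n) x) -> hdim E n = 0%N.
Proof.
move=> h; apply/eqP; rewrite subn_eq0; apply: dimvS.
by apply/subvP => x /mem_cocyc/h xB; apply/mem_cobd.
Qed.

End Cohomology.

(** * Eisenbud operators *)

Lemma sum_block_mx (R : nzRingType) (I : Type) (s : seq I) m1 m2 n1 n2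
    (a : I -> 'M[R]_(m1, n1)) (b : I -> 'M[R]_(m1, n2))
    (c : I -> 'M[R]_(m2, n1)) (d : I -> 'M[R]_(m2, n2)) :
  \sum_(i <- s) block_mx (a i) (b i) (c i) (d i) =
  block_mx (\sum_(i <- s) a i) (\sum_(i <- s) b i)
           (\sum_(i <- s) c i) (\sum_(i <- s) d i).
Proof.
elim: s => [|i s IHs]; first by rewrite !big_nil block_mx0.
by rewrite !big_cons IHs add_block_mx.
Qed.

Section LiftedComplexes.
Variables (Q A : comUnitRingType) (r : nat) (f : 'I_r -> Q).
Variables (pi : {rmorphism Q -> A}) (k : fieldType) (rho : {rmorphism A -> k}).
Hypothesis pi_ker : forall q, pi q = 0 <-> @lin_span Q Q^o _ predT f q.
(** The f_i form a basis of (f) / (f)^2 over A. Coefficients of the f_i in an identity over Q can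
    therefore be compared after reduction to A. *)
Hypothesis f_rel : forall a : 'I_r -> Q,
  \sum_i f i * a i = 0 -> forall i, pi (a i) = 0.

Local Notation sigma := (rho \o pi).

Lemma pi_f i : pi (f i) = 0.
Proof. by apply/pi_ker; apply: (lin_span_gen (R := Q)). Qed.

Lemma pi_ker_mx m n (M : 'M[Q]_(m, n)) : map_mx pi M = 0 ->
  exists N : 'I_r -> 'M[Q]_(m, n), M = \sum_i f i *: N i.
Proof.
move=> M0.
have /choice[c cP] : forall ij : 'I_m * 'I_n, exists c : 'I_r -> Q,
    M ij.1 ij.2 = \sum_l c l * f l.
  move=> ij; have /pi_ker[c ->] : pi (M ij.1 ij.2) = 0.
    by have /matrixP/(_ ij.1 ij.2) := M0; rewrite !mxE.
  by exists c.
exists (fun l => \matrix_(i, j) c (i, j) l); apply/matrixP => i j.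
rewrite summxE (cP (i, j)); apply: eq_bigr => l _.
by rewrite !mxE mulrC.
Qed.

Lemma f_rel_mx m n (M : 'I_r -> 'M[Q]_(m, n)) :
  \sum_i f i *: M i = 0 -> forall i, map_mx pi (M i) = 0.
Proof.
move=> M0 i; apply/matrixP => a b; rewrite !mxE.
apply: (f_rel (a := fun i => M i a b)).
have /matrixP/(_ a b) := M0; rewrite summxE [RHS]mxE => eq0; apply: etrans eq0.
by apply: eq_bigr => l _; rewrite mxE.
Qed.

Lemma sigma_mx m n (M : 'M[Q]_(m, n)) : map_mx sigma M = map_mx rho (map_mx pi M).
Proof. by apply/matrixP => i j; rewrite !mxE. Qed.

Lemma pi_f_sum m n (M : 'I_r -> 'M[Q]_(m, n)) : map_mx pi (\sum_i f i *: M i) = 0.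
Proof.
rewrite raddf_sum big1 //= => i _; apply/matrixP => a b.
by rewrite !mxE rmorphM /= pi_f mul0r.
Qed.

Record lifted := Lifted {
  lcx :> precomplex Q;
  lT : 'I_r -> forall n, 'M[Q]_(crk lcx n.+2, crk lcx n);
  lTE : forall n, cdiff lcx n.+1 *m cdiff lcx n = \sum_i f i *: lT i n
}.

Definition pT (C : lifted) i n : 'M[Q]_(crk C n.+1, prev (crk C) n) :=
  match n with 0 => 0 | n'.+1 => lT C i n' end.

Lemma pTE (C : lifted) n : cdiff C n *m pdiff C n = \sum_i f i *: pT C i n.
Proof.
case: n => [|n] /=; last exact: lTE.
by rewrite mulmx0 big1 // => i _; rewrite scaler0.
Qed.

Definition lshift (C : lifted) : lifted := @Lifted (shift C) (pT C) (pTE C).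

Local Notation Ek C := (pmap sigma (lcx C)).
Local Notation coch C := (forall n, 'cV[k]_(crk (lcx C) n)).

Lemma Ek_diff2 (C : lifted) : diff2_eq0 (Ek C).
Proof.
move=> n; rewrite pdiff_map /= -map_mxM pTE sigma_mx pi_f_sum.
by rewrite map_mx0.
Qed.

Definition op (C : lifted) (i : 'I_r) (x : coch C) : coch C := fun n =>
  match n with
  | n'.+2 => map_mx sigma (lT C i n') *m x n'
  | _ => 0
  end.

Definition cocycle (C : lifted) (x : coch C) : Prop := forall n, cocyc (E := Ek C) (x n).
Definition homologous (C : lifted) (x y : coch C) : Prop :=
  forall n, cobd (E := Ek C) (x n - y n).

(** Expanding d d d in two ways gives sum f_i (d t_i - t_i d) = 0, whose coefficients vanish over
    A. *)
Lemma lT_diff_pi (C : lifted) i n :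
  map_mx pi (cdiff C n.+2 *m lT C i n) = map_mx pi (lT C i n.+1 *m cdiff C n).
Proof.
apply/eqP; rewrite -subr_eq0 -map_mxB; apply/eqP.
apply: (f_rel_mx (M := fun i => cdiff C n.+2 *m lT C i n - lT C i n.+1 *m cdiff C n)).
under eq_bigr do rewrite scalerBr scalemxAr scalemxAl.
by rewrite sumrB -mulmx_sumr -mulmx_suml -!lTE mulmxA subrr.
Qed.

Lemma lT_diff (C : lifted) i n :
  map_mx sigma (cdiff C n.+2) *m map_mx sigma (lT C i n) =
  map_mx sigma (lT C i n.+1) *m map_mx sigma (cdiff C n).
Proof. by rewrite -!map_mxM !sigma_mx lT_diff_pi. Qed.

Lemma op_cocycle (C : lifted) i (x : coch C) : cocycle x -> cocycle (op i x).
Proof.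
move=> xZ [|[|n]]; rewrite /cocyc /= ?mulmx0 // mulmxA lT_diff -mulmxA.
by rewrite xZ mulmx0.
Qed.

Lemma op_cobd (C : lifted) i (x : coch C) :
  (forall n, cobd (E := Ek C) (x n)) -> forall n, cobd (E := Ek C) (op i x n).
Proof.
move=> xB [|[|n]] /=; try by exists 0; rewrite mulmx0.
have [w ->] := xB n; case: n w => [|n] w /=.
  by exists 0; rewrite /pdiff mul0mx !mulmx0.
by exists (map_mx sigma (lT C i n) *m w); rewrite /= !mulmxA lT_diff.
Qed.

Lemma op_comm (C : lifted) i j (x : coch C) :
  cocycle x -> homologous (op i (op j x)) (op j (op i x)).
Proof.
move=> xZ [|[|[|[|n]]]]; try by exists 0; rewrite /= ?mulmx0 ?subrr.
have HP n' : { H : 'I_r -> 'M[Q]_(crk C n'.+3, crk C n') |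
    cdiff C n'.+2 *m lT C j n' - lT C j n'.+1 *m cdiff C n' = \sum_l f l *: H l }.
  by apply/cid/pi_ker_mx; rewrite map_mxB lT_diff_pi subrr.
(* With d t_j - t_j d = sum f_l H_l, the commutator of t_j with d d = sum f_l t_l equals sum f_l (d
   H_l + H_l d). The coefficient of f_i makes H_i a homotopy from t_i t_j to t_j t_i over A. *)
pose M l := lT C l n.+2 *m lT C j n - lT C j n.+2 *m lT C l n
   - sval (HP n.+1) l *m cdiff C n - cdiff C n.+3 *m sval (HP n) l.
have M0 : \sum_l f l *: M l = 0.
  under eq_bigr do rewrite !scalerBr.
  rewrite !sumrB.
  under eq_bigr do rewrite scalemxAl.
  under [X in _ - X - _ - _]eq_bigr do rewrite scalemxAr.
  under [X in _ - X - _]eq_bigr do rewrite scalemxAl.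
  under [X in _ - X]eq_bigr do rewrite scalemxAr.
  rewrite -!mulmx_suml -!mulmx_sumr -(svalP (HP n)) -(svalP (HP n.+1)) -!lTE.
  rewrite mulmxBl mulmxBr !mulmxA.
  by rewrite opprB addrA subrK subrr.
have := f_rel_mx M0 i; rewrite /M !map_mxB !map_mxM => /(congr1 (map_mx rho)).
rewrite !map_mxB map_mx0 !map_mxM -!sigma_mx => /eqP.
rewrite subr_eq0 subr_eq => /eqP E.
exists (map_mx sigma (sval (HP n) i) *m x n).
rewrite /= !mulmxA -mulmxBl E mulmxDl -[X in _ + X]mulmxA.
have xZn : map_mx sigma (cdiff C n) *m x n = 0 := xZ n.
by rewrite xZn mulmx0 addr0.
Qed.

Section Naturality.
Variables (C Y : lifted) (phi : forall n, 'M[Q]_(crk C n, crk Y n)).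
Variable h : 'I_r -> forall n, 'M[Q]_(crk C n.+1, crk Y n).
Hypothesis hE : forall n,
  phi n.+1 *m cdiff Y n - cdiff C n *m phi n = \sum_i f i *: h i n.

(** The defect h of phi as a chain map over Q becomes the corner of the operators of the cone. Their
    triangular shape makes restriction to Y commute with them strictly. *)
Lemma cone_lTE n :
  cdiff (cone phi) n.+1 *m cdiff (cone phi) n =
  \sum_i f i *: block_mx (lT Y i n) 0 (h i n) (pT C i n).
Proof.
rewrite /= mulmx_block !mul0mx !mulmx0 !addr0 add0r mulNmx mulmxN.
rewrite mulNmx opprK hE lTE pTE.
under [RHS]eq_bigr do rewrite scale_block_mx scaler0.
by rewrite sum_block_mx [X in _ = block_mx _ X _ _]big1.
Qed.

Definition lcone : lifted := @Lifted (cone phi) _ cone_lTE.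

Definition res (x : coch lcone) : coch Y := fun n => usubmx (x n).

Lemma res_op i x : res (op i x) = op i (res x).
Proof.
apply: functional_extensionality_dep => -[|[|n]]; rewrite /res /=.
- by apply/matrixP => a b; rewrite !mxE.
- by apply/matrixP => a b; rewrite !mxE.
- by rewrite map_block_mx -[X in _ *m X]vsubmxK mul_block_col col_mxKu map_mx0 mul0mx addr0.
Qed.

Lemma cone_cocycleP n (x : 'cV[k]_(crk lcone n)) : cocyc (E := Ek lcone) x <->
  cocyc (E := Ek Y) (usubmx x) /\
  map_mx sigma (phi n) *m usubmx x = map_mx sigma (pdiff C n) *m dsubmx x.
Proof.
rewrite /cocyc /= map_block_mx -{1}[x]vsubmxK mul_block_col map_mx0 mul0mx addr0.
rewrite map_mxN mulNmx.
split=> [E|[-> ->]]; last by rewrite subrr col_mx0.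
move: E => /eqP; rewrite col_mx_eq0 => /andP[/eqP->].
by rewrite subr_eq0 => /eqP->.
Qed.

Lemma res_cobd n (x : 'cV_(crk lcone n)) : cobd (E := Ek lcone) x -> cobd (E := Ek Y) (usubmx x).
Proof.
move=> [w ->]; rewrite !pdiff_map; case: n w {x} => [|n] w.
  by exists 0; rewrite /= map_mx0 !mul0mx raddf0.
exists (usubmx w); rewrite pdiff_map /= map_block_mx.
by rewrite -[w in LHS]vsubmxK mul_block_col col_mxKu map_mx0 mul0mx addr0.
Qed.

Definition pull (x : coch Y) : coch C := fun n => map_mx sigma (phi n) *m x n.

Lemma phi_diff n : map_mx sigma (phi n.+1) *m map_mx sigma (cdiff Y n) =
  map_mx sigma (cdiff C n) *m map_mx sigma (phi n).
Proof.
apply/eqP; rewrite -subr_eq0 -!map_mxM -map_mxB hE sigma_mx pi_f_sum.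
by rewrite map_mx0.
Qed.

Lemma pull_cocycle x : cocycle x -> cocycle (pull x).
Proof.
move=> xZ n; have xZn : map_mx sigma (cdiff Y n) *m x n = 0 := xZ n.
by rewrite /cocyc /= mulmxA -phi_diff -mulmxA xZn mulmx0.
Qed.

(** The lower left block of the relation d t_i = t_i d on the cone exhibits h as a homotopy between
    phi t_i and t_i phi. *)
Lemma pull_op i x : cocycle x -> homologous (pull (op i x)) (op i (pull x)).
Proof.
move=> xZ [|[|n]]; try by exists 0; rewrite /pull /= !mulmx0 subrr.
have := lT_diff lcone i n; rewrite /= !map_block_mx !mulmx_block => E.
have {E}[_ _ E _] := eq_block_mx E.
exists (map_mx sigma (h i n) *m x n).
move: E; rewrite map_mxN mulNmx /= => /eqP; rewrite subr_eq => /eqP E.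
rewrite /pull /= !mulmxA -mulmxBl E mulmxBl 2!mulmxDl -2![in X in X - _]mulmxA.
have xZn : map_mx sigma (cdiff Y n) *m x n = 0 := xZ n.
by rewrite xZn mulmx0 add0r addrC addKr mulmxA.
Qed.

End Naturality.
End LiftedComplexes.

(** * Polynomials in operators that commute up to coboundaries *)

Section PolyAction.
Variables (k : fieldType) (r : nat).
Implicit Types (t : 'X_{1..r}) (s : {mpoly k[r]}).

Section Action.
Variables (rk : nat -> nat).
Local Notation coch := (forall n, 'cV[k]_(rk n)).
Variable op : 'I_r -> coch -> coch.

Definition mact t (x : coch) : coch :=
  foldr (fun i => iter (t i) (op i)) x (enum 'I_r).

Definition pact s (x : coch) : coch := fun n => \sum_(t <- msupp s) s@_t *: mact t x n.

Definition coch_sum (l : seq 'X_{1..r}) (c : 'X_{1..r} -> k) (F : 'X_{1..r} -> coch) : coch :=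
  fun n => \sum_(t <- l) c t *: F t n.

Lemma sum_msupp_widen (V : lmodType k) s (l : seq 'X_{1..r}) (G : 'X_{1..r} -> V) :
  uniq l -> {subset msupp s <= l} ->
  \sum_(t <- msupp s) s@_t *: G t = \sum_(t <- l) s@_t *: G t.
Proof.
move=> ul sl; rewrite (bigID (fun t => t \in msupp s) (r := l)) /=.
rewrite [X in _ = _ + X]big1 ?addr0; last first.
  by move=> t /memN_msupp_eq0->; rewrite scale0r.
rewrite -[RHS]big_filter; apply: perm_big; apply: uniq_perm.
- exact: msupp_uniq.
- exact: filter_uniq.
- by move=> t; rewrite mem_filter andb_idr // => /sl.
Qed.

Lemma pactD s1 s2 x n : pact (s1 + s2) x n = pact s1 x n + pact s2 x n.
Proof.
pose l := undup (msupp s1 ++ msupp s2 ++ msupp (s1 + s2)).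
have sl s' : s' \in [:: s1; s2; s1 + s2] -> {subset msupp s' <= l}.
  by rewrite !inE => /or3P[] /eqP-> t; rewrite mem_undup !mem_cat => ->; rewrite ?orbT.
rewrite /pact !(@sum_msupp_widen _ _ l) ?undup_uniq //; try by apply: sl; rewrite !inE eqxx ?orbT.
by rewrite -big_split; apply: eq_bigr => t _; rewrite mcoeffD scalerDl.
Qed.

Lemma pactZX c t x n : pact (c *: 'X_[t]) x n = c *: mact t x n.
Proof.
rewrite /pact (@sum_msupp_widen _ _ [:: t]) //; last first.
  by move=> t' /msuppZ_le; rewrite msuppX.
by rewrite big_seq1 mcoeffZ mcoeffX eqxx mulr1.
Qed.

Lemma pact0 x n : pact 0 x n = 0.
Proof. by rewrite /pact msupp0 big_nil. Qed.

Lemma pact_sumZX (T : Type) (l : seq T) (c : T -> k) (m : T -> 'X_{1..r}) x n :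
  pact (\sum_(t <- l) c t *: 'X_[m t]) x n = \sum_(t <- l) c t *: mact (m t) x n.
Proof.
elim: l => [|t l IHl]; first by rewrite !big_nil pact0.
by rewrite !big_cons pactD pactZX IHl.
Qed.
End Action.

Section Naturality.
Variables (rk rk' : nat -> nat).
Local Notation coch := (forall n, 'cV[k]_(rk n)).
Local Notation coch' := (forall n, 'cV[k]_(rk' n)).
Variables (op : 'I_r -> coch -> coch) (op' : 'I_r -> coch' -> coch').
Variables (Z : coch -> Prop) (B' : forall n, 'cV[k]_(rk' n) -> Prop).
Variable Phi : coch -> coch'.
Hypothesis B'0 : forall n, B' (0 : 'cV_(rk' n)).
Hypothesis B'P : forall n c (x y : 'cV_(rk' n)), B' x -> B' y -> B' (c *: x + y).

Let hom' (x y : coch') := forall n, B' (x n - y n).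

Hypothesis Z_op : forall i x, Z x -> Z (op i x).
Hypothesis hom'_op : forall i x y, hom' x y -> hom' (op' i x) (op' i y).
Hypothesis Phi_op : forall i x, Z x -> hom' (Phi (op i x)) (op' i (Phi x)).
Hypothesis Phi_sum : forall l c F n,
  Phi (coch_sum l c F) n = coch_sum l c (fun t => Phi (F t)) n.

Lemma subspaceD n (x y : 'cV_(rk' n)) : B' x -> B' y -> B' (x + y).
Proof. by move=> hx hy; rewrite -[x]scale1r; apply: B'P. Qed.

Let hom'_refl x : hom' x x. Proof. by move=> n; rewrite subrr. Qed.

Let hom'_trans x y z : hom' x y -> hom' y z -> hom' x z.
Proof. by move=> xy yz n; rewrite -(subrKA (y n)); apply: subspaceD. Qed.

(** Phi is abstract because it will be a restriction, a shift, a pullback along phi, and also a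
    single operator; the last case yields the commutation of monomials. *)
Lemma Phi_foldr t (l : seq 'I_r) x : Z x ->
  Z (foldr (fun i => iter (t i) (op i)) x l) /\
  hom' (Phi (foldr (fun i => iter (t i) (op i)) x l))
       (foldr (fun i => iter (t i) (op' i)) (Phi x) l).
Proof.
move=> Zx; elim: l => [|i l [IHZ IHh]] //=.
elim: (t i) => [|n [IZ Ih]] //=; split; first exact: Z_op.
by apply: hom'_trans (Phi_op _ IZ) _; apply: hom'_op.
Qed.

Lemma Phi_mact t x : Z x -> hom' (Phi (mact op t x)) (mact op' t (Phi x)).
Proof. by move=> /(Phi_foldr t (enum 'I_r))[]. Qed.

Lemma subspace_sum n (l : seq 'X_{1..r}) (F : 'X_{1..r} -> 'cV_(rk' n)) :
  (forall t, B' (F t)) -> B' (\sum_(t <- l) F t).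
Proof.
move=> hF; elim: l => [|t l IHl]; first by rewrite big_nil.
by rewrite big_cons; apply: subspaceD.
Qed.

Lemma Phi_pact s x : Z x -> hom' (Phi (pact op s x)) (pact op' s (Phi x)).
Proof.
move=> Zx n; have -> := Phi_sum (msupp s) (fun t => s@_t) (fun t => mact op t x) n.
rewrite /coch_sum /pact -sumrB; apply: subspace_sum => t.
by rewrite -scalerBr -[_ *: _]addr0; apply: B'P => //; apply: Phi_mact.
Qed.

End Naturality.

Section Composition.
Variables (rk : nat -> nat).
Local Notation coch := (forall n, 'cV[k]_(rk n)).
Variable op : 'I_r -> coch -> coch.
Variables (Z : coch -> Prop) (B : forall n, 'cV[k]_(rk n) -> Prop).
Hypothesis B0 : forall n, B (0 : 'cV_(rk n)).
Hypothesis BP : forall n c (x y : 'cV_(rk n)), B x -> B y -> B (c *: x + y).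
Let hom (x y : coch) := forall n, B (x n - y n).
Hypothesis Z_op : forall i x, Z x -> Z (op i x).
Hypothesis hom_op : forall i x y, hom x y -> hom (op i x) (op i y).
Hypothesis op_swap : forall i j x, Z x -> hom (op i (op j x)) (op j (op i x)).
Hypothesis op_sum : forall i l c F n,
  op i (coch_sum l c F) n = coch_sum l c (fun t => op i (F t)) n.

Let hom_refl x : hom x x. Proof. by move=> n; rewrite subrr. Qed.

Let hom_trans x y z : hom x y -> hom y z -> hom x z.
Proof. by move=> xy yz n; rewrite -(subrKA (y n)); apply: (subspaceD BP). Qed.

Let hom_iter i n x y : hom x y -> hom (iter n (op i) x) (iter n (op i) y).
Proof. by move=> xy; elim: n => //= n; apply: hom_op. Qed.

Let Z_foldr t l x : Z x -> Z (foldr (fun i => iter (t i) (op i)) x l).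
Proof.
by move=> Zx; elim: l => //= i l IHl; elim: (t i) => //= n; apply: Z_op.
Qed.

Lemma iter_foldr i n t l x : Z x ->
  hom (iter n (op i) (foldr (fun i => iter (t i) (op i)) x l))
      (foldr (fun i => iter (t i) (op i)) (iter n (op i) x) l).
Proof.
move=> Zx; elim: n => //= n IHn.
apply: hom_trans (hom_op i IHn) _.
have Zn : Z (iter n (op i) x) by elim: (n) => //= n'; apply: Z_op.
have [] := @Phi_foldr rk rk op op Z B (op i) B0 BP Z_op hom_op _ t l _ Zn.
  by move=> j y Zy; apply: op_swap.
by [].
Qed.

Lemma mactD t t' x : Z x -> hom (mact op (t + t')%MM x) (mact op t (mact op t' x)).
Proof.
move=> Zx; rewrite /mact; elim: (enum _) => //= i l IHl.
rewrite mnmDE iterD; apply: hom_iter.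
apply: hom_trans (hom_iter _ _ IHl) _; apply: iter_foldr.
exact: Z_foldr.
Qed.

Lemma mact_hom t x y : hom x y -> hom (mact op t x) (mact op t y).
Proof. by rewrite /mact => xy; elim: (enum _) => //= i l IHl; apply: hom_iter. Qed.

Lemma pact_hom s x y : hom x y -> hom (pact op s x) (pact op s y).
Proof.
move=> xy n; rewrite /pact -sumrB; apply: (subspace_sum B0 BP) => t.
by rewrite -scalerBr -[_ *: _]addr0; apply: BP => //; apply: mact_hom.
Qed.

Lemma mact_sum t l c F n :
  mact op t (coch_sum l c F) n = coch_sum l c (fun t' => mact op t (F t')) n.
Proof.
move: n; rewrite /mact; elim: (enum _) => //= i l' IHl.
elim: (t i) => //= m IHm n; rewrite -op_sum; congr (op i _ n).
exact: functional_extensionality_dep.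
Qed.

(** [mact] applies the operators in a fixed order, so reordering a product of monomials costs a
    coboundary, and is possible on cocycles only. *)
Lemma pactM s s' x : Z x -> hom (pact op (s * s') x) (pact op s (pact op s' x)).
Proof.
move=> Zx n; rewrite mpolyME pact_sumZX big_allpairs /=.
have -> : pact op s (pact op s' x) n = \sum_(t <- msupp s) \sum_(t' <- msupp s')
    (s@_t * s'@_t') *: mact op t (mact op t' x) n.
  apply: eq_bigr => t _.
  rewrite (mact_sum t (msupp s') (fun t => s'@_t) (fun t' => mact op t' x)).
  by rewrite /coch_sum scaler_sumr; apply: eq_bigr => t' _; rewrite scalerA.
rewrite -sumrB; apply: (subspace_sum B0 BP) => t.
rewrite -sumrB; apply: (subspace_sum B0 BP) => t'.
by rewrite -scalerBr -[_ *: _]addr0; apply: BP => //; apply: mactD.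
Qed.

End Composition.
End PolyAction.

(** * Annihilators and dimensions along the exact sequence of a cone *)

Section Killing.
Variables (Q A : comUnitRingType) (r : nat) (f : 'I_r -> Q).
Variables (pi : {rmorphism Q -> A}) (k : fieldType) (rho : {rmorphism A -> k}).
Hypothesis pi_ker : forall q, pi q = 0 <-> @lin_span Q Q^o _ predT f q.
Hypothesis f_rel : forall a : 'I_r -> Q,
  \sum_i f i * a i = 0 -> forall i, pi (a i) = 0.

Local Notation sigma := (rho \o pi).
Local Notation lifted := (lifted f).
Local Notation Ek C := (pmap sigma (lcx C)).
Local Notation coch C := (forall n, 'cV[k]_(crk (lcx C) n)).
Local Notation op C := (@op Q A r f pi k rho C).
Local Notation cocycle_on C := (@cocycle Q A r f pi k rho C).
Local Notation cocycle := (cocycle pi rho).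
Implicit Types (C Y : lifted) (s : {mpoly k[r]}).

Lemma cobd0 C n : cobd (E := Ek C) (0 : 'cV_(crk C n)).
Proof. by exists 0; rewrite mulmx0. Qed.

Lemma cobdP C n c (x y : 'cV_(crk C n)) :
  cobd (E := Ek C) x -> cobd (E := Ek C) y -> cobd (E := Ek C) (c *: x + y).
Proof.
by move=> [v ->] [w ->]; exists (c *: v + w); rewrite mulmxDr -scalemxAr.
Qed.

Lemma coch_sum_op C i (l : seq 'X_{1..r}) (c : 'X_{1..r} -> k) (F : 'X_{1..r} -> coch C) n :
  op C i (coch_sum l c F) n = coch_sum l c (fun t => op C i (F t)) n.
Proof.
case: n => [|[|n]] /=; rewrite /coch_sum.
- by rewrite big1 // => t _; rewrite scaler0.
- by rewrite big1 // => t _; rewrite scaler0.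
- by rewrite mulmx_sumr; apply: eq_bigr => t _; rewrite scalemxAr.
Qed.

Lemma op_hom C i (x y : coch C) :
  homologous pi rho x y -> homologous pi rho (op C i x) (op C i y).
Proof.
move=> xy n; have := op_cobd f_rel i xy n.
congr (cobd _); case: n => [|[|n]] /=; by rewrite ?subrr ?mulmxBr.
Qed.

Definition kills C s : Prop := forall x : coch C, cocycle x ->
  forall n, cobd (E := Ek C) (pact (op C) s x n).

Definition pacts C (ss : seq {mpoly k[r]}) (x : coch C) : coch C :=
  foldr (pact (op C)) x ss.

(** Cones produce composites of actions, in a definite order. They are turned into the action of a
    product only once, by [kills_seqP]. *)
Definition kills_seq C (ss : seq {mpoly k[r]}) : Prop := forall x : coch C,
  cocycle x -> forall n, cobd (E := Ek C) (pacts ss x n).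

Lemma Phi_pact_strict C Y (Phi : coch C -> coch Y) :
  (forall i x, Phi (op C i x) = op Y i (Phi x)) ->
  (forall l c (F : 'X_{1..r} -> coch C) n,
     Phi (coch_sum l c F) n = coch_sum l c (fun t => Phi (F t)) n) ->
  forall s x, Phi (pact (op C) s x) = pact (op Y) s (Phi x).
Proof.
move=> Phi_op Phi_sum s x; apply: functional_extensionality_dep => n.
apply/eqP; rewrite -subr_eq0; apply/eqP.
apply: (@Phi_pact _ _ _ _ (op C) (op Y) (fun=> True) (fun n z => z = 0)) => //.
- by move=> n' c z w -> ->; rewrite scaler0 addr0.
- move=> i z w zw n'; suff -> : z = w by rewrite subrr.
  by apply: functional_extensionality_dep => m; apply/eqP; rewrite -subr_eq0 zw.
- by move=> i z _ n'; rewrite Phi_op subrr.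
Qed.

Lemma pact_cocycle C s (x : coch C) : cocycle x -> cocycle (pact (op C) s x).
Proof.
move=> xZ n; rewrite /cocyc /pact mulmx_sumr big1 // => t _; rewrite -scalemxAr.
suff -> : cdiff (Ek C) n *m mact (op C) t x n = 0 by rewrite scaler0.
suff : cocycle (mact (op C) t x) by apply.
rewrite /mact; elim: (enum _) => //= i l IHl.
by elim: (t i) => //= m; apply: (op_cocycle f_rel).
Qed.

Lemma kills_prod C (ss : seq {mpoly k[r]}) (x : coch C) : cocycle x ->
  homologous pi rho (pact (op C) (\prod_(s <- ss) s) x) (pacts ss x).
Proof.
move=> xZ; have BP n := @cobdP C n; have B0 n := @cobd0 C n.
elim: ss => [|s ss IHs] n.
  rewrite big_nil /pact msupp1 big_seq1 mcoeff1 eqxx scale1r /mact /=.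
  suff -> : foldr (fun i => iter (0%MM i) (op C i)) x (enum 'I_r) = x.
    by rewrite subrr; apply: cobd0.
  by elim: (enum _) => //= i l ->; rewrite mnm0E.
rewrite big_cons; set s' := \prod_(_ <- _) _ in IHs *.
rewrite -(subrKA (pact (op C) s (pact (op C) s' x) n)).
apply: (subspaceD BP).
  apply: (@pactM _ _ _ (op C) (cocycle_on C) _ B0 BP) => //.
  - by move=> i y; apply: (op_cocycle f_rel).
  - by move=> i y z; apply: op_hom.
  - by move=> i j y; apply: (op_comm pi_ker f_rel).
  - exact: coch_sum_op.
apply: (@pact_hom _ _ _ (op C) _ B0 BP) => //.
by move=> i y z; apply: op_hom.
Qed.

Lemma kills_seqP C (ss : seq {mpoly k[r]}) : kills_seq C ss ->
  kills C (\prod_(s <- ss) s).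
Proof.
move=> hss x xZ n; rewrite -(subrK (pacts ss x n) (pact _ _ _ _)).
by apply: (subspaceD (@cobdP C)); [apply: kills_prod | apply: hss].
Qed.

Section Cone.
Variables (C Y : lifted) (phi : forall n, 'M[Q]_(crk C n, crk Y n)).
Variable h : 'I_r -> forall n, 'M[Q]_(crk C n.+1, crk Y n).
Hypothesis hE : forall n,
  phi n.+1 *m cdiff Y n - cdiff C n *m phi n = \sum_i f i *: h i n.
Local Notation K := (lcone hE).

Lemma res_pact s (x : coch K) : res (pact (op K) s x) = pact (op Y) s (res x).
Proof.
apply: Phi_pact_strict => [i y|l c F n]; first exact: res_op.
by rewrite /res /coch_sum raddf_sum; apply: eq_bigr => t _; apply/matrixP => a b; rewrite !mxE.
Qed.

Lemma res_pacts (ss : seq {mpoly k[r]}) (x : coch K) :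
  res (pacts ss x) = pacts ss (res x).
Proof. by elim: ss => //= s ss IHs; rewrite res_pact IHs. Qed.

Lemma cone_extend (x : coch Y) : cocycle x ->
  (forall n, cobd (E := Ek C) (map_mx sigma (phi n) *m x n)) ->
  exists2 x' : coch K, cocycle x' & res x' = x.
Proof.
move=> xZ xB; have w n := cid (xB n).
exists (fun n => col_mx (x n) (sval (w n))); last first.
  by apply: functional_extensionality_dep => n; rewrite /res col_mxKu.
move=> n; apply/cone_cocycleP; rewrite col_mxKu col_mxKd; split; first exact: xZ.
by rewrite -pdiff_map; apply: (svalP (w n)).
Qed.

(** From the exactness of H(K) -> H(Y) -> H(C): the pullback of s x to C is a coboundary, so s x
    extends to a cocycle of K, which ss kills; then restrict to Y. *)
Lemma kills_cone (ss : seq {mpoly k[r]}) s :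
  kills_seq K ss -> kills C s -> kills_seq Y (rcons ss s).
Proof.
move=> Kss Cs x xZ n; rewrite /pacts foldr_rcons.
have [|x' x'Z <-] := cone_extend (pact_cocycle s xZ).
  move=> m; have := Cs _ (pull_cocycle pi_ker hE xZ) m.
  rewrite -[X in _ -> cobd X](subrK (pact (op C) s (pull pi rho phi x) m)) => Bm.
  apply: (subspaceD (@cobdP C)) => //.
  apply: (@Phi_pact _ _ _ _ (op Y) (op C) (cocycle_on Y) _ (pull pi rho phi)) => //.
  - by move=> n'; apply: cobd0.
  - exact: cobdP.
  - by move=> i y; apply: (op_cocycle f_rel).
  - by move=> i y z; apply: op_hom.
  - by move=> i y; apply: (pull_op f_rel hE).
  - move=> l c F n'; rewrite /pull /coch_sum mulmx_sumr.
    by apply: eq_bigr => t _; rewrite scalemxAr.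
have := res_cobd (Kss _ x'Z n).
by rewrite -[usubmx _]/(res (pacts ss x') n) res_pacts.
Qed.

Lemma hdim_cone n : (hdim (Ek Y) n <= hdim (Ek K) n + hdim (Ek C) n)%N.
Proof.
apply: (@hdim_exact k (Ek K) n (Ek Y) n (Ek C) n (row_mx 1%:M 0) (map_mx sigma (phi n))).
- exact: (Ek_diff2 rho pi_ker).
- exact: (Ek_diff2 rho pi_ker).
- exact: (Ek_diff2 rho pi_ker).
- move=> y /res_cobd; congr (cobd _).
  by rewrite -[y in RHS]vsubmxK mul_row_col mul1mx mul0mx addr0.
- move=> x xZ; have := phi_diff rho pi_ker hE n => E.
  have xZn : map_mx sigma (cdiff Y n) *m x = 0 := xZ.
  by rewrite /cocyc /= mulmxA -E -mulmxA xZn mulmx0.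
- move=> x xZ [w wE]; exists (col_mx x w).
    apply/cone_cocycleP; rewrite col_mxKu col_mxKd; split=> //.
    by rewrite wE pdiff_map.
  by rewrite mul_row_col mul1mx mul0mx addr0 subrr; apply: cobd0.
Qed.

(** If phi vanishes in k, every cocycle of Y extends to the cone, so no extra factor is spent. This
    serves for multiplication by the u_l. *)
Lemma kills_cone_sigma0 ss : (forall n, map_mx sigma (phi n) = 0) ->
  kills_seq K ss -> kills_seq Y ss.
Proof.
move=> phi0 Kss x xZ n; have [|x' x'Z <-] := @cone_extend x xZ.
  by move=> m; rewrite phi0 mul0mx; apply: cobd0.
have := res_cobd (Kss _ x'Z n).
by rewrite -[usubmx _]/(res (pacts ss x') n) res_pacts.
Qed.

Lemma hdim_cone_sigma0 n : (forall m, map_mx sigma (phi m) = 0) ->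
  (hdim (Ek Y) n <= hdim (Ek K) n)%N.
Proof.
(* With the zero complex as first term, [hdim_exact] says that the injection x |-> (x, 0) on
   cohomology does not lower dimensions. *)
move=> phi0; pose E0 : precomplex k := @Precomplex k (fun=> 0%N) (fun=> 0).
have h0 : hdim E0 0 = 0%N.
  by apply: hdim_eq0 => x _; exists 0; apply/matrixP => -[].
rewrite -[X in (_ <= X)%N]add0n -h0.
apply: (@hdim_exact k E0 0 (Ek Y) n (Ek K) n 0 (col_mx 1%:M 0)).
- by move=> m; rewrite /= mul0mx.
- exact: (Ek_diff2 rho pi_ker).
- exact: (Ek_diff2 rho pi_ker).
- by move=> y _; rewrite mul0mx; apply: cobd0.
- move=> x xZ; rewrite mul_col_mx mul1mx mul0mx; apply/cone_cocycleP.
  by rewrite col_mxKu col_mxKd phi0 mul0mx mulmx0.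
- move=> x xZ /res_cobd; rewrite mul_col_mx mul1mx mul0mx col_mxKu => xB.
  exists 0; first by rewrite /cocyc mulmx0.
  by rewrite mulmx0 subr0.
Qed.

End Cone.

Lemma kills_shift C s : kills C s -> kills (lshift C) s.
Proof.
move=> Cs x xZ [|n]; first by exists 0; apply/matrixP => -[].
pose x' : coch C := fun n => x n.+1.
have := Cs x' (fun n => xZ n.+1) n.
suff -> : pact (op C) s x' = (fun n => pact (op (lshift C)) s x n.+1) by case=> w; rewrite pdiff_map => xw; exists w.
pose Phi (y : coch (lshift C)) : coch C := fun n => y n.+1.
rewrite -[x']/(Phi x) -(@Phi_pact_strict (lshift C) C Phi) //.
move=> i y; apply: functional_extensionality_dep => -[|[|m]] //=.
by rewrite /Phi /= map_mx0 mul0mx.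
Qed.

Lemma hdim_shift0 C : hdim (Ek (lshift C)) 0 = 0%N.
Proof. by apply: hdim_eq0 => x _; exists 0; apply/matrixP => -[]. Qed.

Lemma hdim_shiftS C n : hdim (Ek (lshift C)) n.+1 = hdim (Ek C) n.
Proof. by case: n => [|n] //; rewrite /hdim /= map_mx0. Qed.

End Killing.

(** * Comparison maps and cones *)

Section Homology.
Variable A : comUnitRingType.
Implicit Types (P S : precomplex A) (N : lmodType A).

(** An isomorphism of H_n(P) with N, unquotiented: e is a total function constrained only on cycles,
    which avoids a type of cycles. *)
Definition homology_map P n N (e : 'rV[A]_(crk P n) -> N) : Prop :=
  [/\ forall a x y, x *m pdiff P n = 0 -> y *m pdiff P n = 0 ->
        e (a *: x + y) = a *: e x + e y,
      forall v, exists2 x, x *m pdiff P n = 0 & e x = v &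
      forall x, x *m pdiff P n = 0 -> (e x = 0 <-> exists y, x = y *m cdiff P n)].

Definition has_homology P n N : Prop := exists e, @homology_map P n N e.

Definition resolves P j N : Prop :=
  [/\ forall n, (n < j)%N -> crk P n = 0%N, has_homology P j N &
      forall n, (j < n)%N -> exact_at P n].

Lemma mx_cols0 m n (M M' : 'M[A]_(m, n)) : n = 0%N -> M = M'.
Proof. by move=> n0; apply/matrixP => i [j lt_j]; exfalso; rewrite n0 in lt_j. Qed.

Lemma choose_rows m n p (L : 'M[A]_(m, n)) (F : 'M[A]_(p, n)) :
  (forall x : 'rV_m, exists y, x *m L = y *m F) -> exists X, X *m F = L.
Proof.
move=> h; have /choice[g gP] : forall i : 'I_m, exists y, row i L = y *m F.
  by move=> i; rewrite rowE; apply: h.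
by exists (\matrix_i g i); apply/row_matrixP => i; rewrite row_mul rowK gP.
Qed.

Lemma prev_crk0 P j n : (forall n, (n < j)%N -> crk P n = 0%N) -> (n <= j)%N ->
  prev (crk P) n = 0%N.
Proof. by move=> P0; case: n => // n; apply: P0. Qed.

Lemma homology_map0 P n N (e : 'rV_(crk P n) -> N) : homology_map e -> e 0 = 0.
Proof. by case=> _ _ ek; apply/ek; [rewrite mul0mx | exists 0; rewrite mul0mx]. Qed.

Lemma homology_map_sum P n N (e : 'rV_(crk P n) -> N) m (c : 'rV_m)
    (M : 'M_(m, crk P n)) : homology_map e -> M *m pdiff P n = 0 ->
  e (c *m M) = \sum_i c 0 i *: e (row i M).
Proof.
move=> he MD; have [eD _ _] := he.
have rD i : row i M *m pdiff P n = 0 by rewrite -row_mul MD row0.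
rewrite mulmx_sum_row.
suff [] : (\sum_i c 0 i *: row i M) *m pdiff P n = 0 /\
   e (\sum_i c 0 i *: row i M) = \sum_i c 0 i *: e (row i M) by [].
elim/big_rec2: _ => [|i y x _ [xD ex]].
  by rewrite mul0mx; split=> //; apply: homology_map0.
by rewrite eD // ex mulmxDl -scalemxAl rD scaler0 xD addr0.
Qed.

Definition shift_resolves P j N : resolves P j N -> resolves (shift P) j.+1 N.
Proof.
move=> [P0 [e [eD es ek]] Pex]; split.
- by case=> // n; apply: P0.
- by exists e; split.
- by case=> // n /Pex.
Qed.

Section Comparison.
Variables (S P : precomplex A) (j : nat) (N : lmodType A).
Hypothesis S_diff2 : forall n, cdiff S n *m pdiff S n = 0.
Hypothesis hS : resolves S j N.
Hypothesis hP : has_homology P j N.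
Hypothesis exP : forall n, (j < n)%N -> exact_at P n.

Definition compatible n (phi : 'M[A]_(crk S n, crk P n)) : Prop :=
  phi *m pdiff P n = 0 /\ exists eS eP, [/\ @homology_map S n N eS,
    @homology_map P n N eP & forall c, eP (c *m phi) = eS c].

Let good n (phi : 'M[A]_(crk S n, crk P n)) : Prop :=
  (forall c : 'rV_(crk S n.+1), exists y, c *m (cdiff S n *m phi) = y *m cdiff P n)
  /\ (n = j -> compatible phi).

Lemma compatible_exists : exists phi : 'M[A]_(crk S j, crk P j), compatible phi.
Proof.
have [S0 [eS heS] _] := hS; have [eP heP] := hP.
have [_ es _] := heP.
have /choice[g gP] : forall i : 'I_(crk S j), exists y,
    y *m pdiff P j = 0 /\ eP y = eS (row i 1%:M).
  by move=> i; have [y yD ey] := es (eS (row i 1%:M)); exists y.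
have gD : (\matrix_i g i) *m pdiff P j = 0.
  by apply/row_matrixP => i; rewrite row_mul rowK row0; have [] := gP i.
exists (\matrix_i g i); split=> //; exists eS, eP; split=> // c.
rewrite (homology_map_sum _ heP gD) -[c in RHS]mulmx1.
rewrite (homology_map_sum _ heS); last by apply: mx_cols0; apply: prev_crk0 S0 _.
by apply: eq_bigr => i _; rewrite rowK; have [_ ->] := gP i.
Qed.

Lemma compatible_good n (phi : 'M_(crk S n, crk P n)) : compatible phi -> good phi.
Proof.
move=> hphi; split=> // c; have [phiD [eS [eP [heS heP ePS]]]] := hphi.
have [_ _ kS] := heS; have [_ _ kP] := heP; rewrite mulmxA.
apply/kP; first by rewrite -mulmxA phiD mulmx0.
by rewrite ePS; apply/kS; [rewrite -mulmxA S_diff2 mulmx0 | exists c].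
Qed.

Lemma comparison : exists phi : forall n, 'M[A]_(crk S n, crk P n),
  (forall n, phi n.+1 *m cdiff P n = cdiff S n *m phi n) /\ compatible (phi j).
Proof.
have [S0 _ exS] := hS.
have [||phi phiP] := @dependent_choice (fun n => 'M[A]_(crk S n, crk P n)) good
  (fun n p q => q *m cdiff P n = cdiff S n *m p).
- have [j0|j_gt0] := posnP j.
    have [phi0 hphi0] := compatible_exists; move: phi0 hphi0; rewrite j0 => phi0 hphi0.
    by exists phi0; apply: compatible_good.
  exists 0; split=> [c|j0]; last by rewrite -j0 in j_gt0.
  by exists 0; rewrite !mulmx0 mul0mx.
- move=> n phi [lift_phi compat_phi].
  (* Degree j restarts the construction: all earlier maps have source 0, so the map that is right on
     homology is automatically compatible with them. *)
  have [eq_j|ne_j] := eqVneq n.+1 j.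
    have S0n : crk S n = 0%N by apply: S0; rewrite -eq_j.
    have [phi' hphi'] := compatible_exists.
    move: phi' hphi'; rewrite -eq_j => phi' hphi'; exists phi'.
      exact: compatible_good.
    by have [-> _] := hphi'; rewrite (mx_cols0 (cdiff S n) 0 S0n) mul0mx.
  have [phi' phi'E] := choose_rows lift_phi; exists phi' => //.
  split=> [c|eq_j]; last by rewrite eq_j eqxx in ne_j.
  have [lt_j|ge_j] := ltnP j n.+1; last first.
    have S0n : crk S n.+1 = 0%N by apply: S0; rewrite ltn_neqAle ne_j.
    by exists 0; rewrite (mx_cols0 (cdiff S n.+1) 0 S0n) !mul0mx mulmx0.
  apply: exP => //=; rewrite -!mulmxA phi'E [cdiff S n.+1 *m _]mulmxA.
  by have /= -> := S_diff2 n.+1; rewrite mul0mx mulmx0.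
exists phi; split=> [n|]; first by have [] := phiP n.
by have [[_ /(_ erefl)]] := phiP j.
Qed.

Variable phi : forall n, 'M[A]_(crk S n, crk P n).
Hypothesis phiE : forall n, phi n.+1 *m cdiff P n = cdiff S n *m phi n.
Hypothesis phi_j : compatible (phi j).
Local Notation K := (cone phi).

Lemma cone_has_homology n M : (n < j)%N -> has_homology P n M -> has_homology K n M.
Proof.
have [S0 _ _] := hS; move=> lt_nj [e [eD es ek]].
have p0 : prev (crk S) n = 0%N by apply: prev_crk0 S0 (ltnW lt_nj).
have S0n : crk S n = 0%N := S0 _ lt_nj.
have cyc (z : 'rV_(crk K n)) : z *m pdiff K n = 0 <-> lsubmx z *m pdiff P n = 0.
  case: n z p0 {lt_nj e eD es ek S0n} => [|n] z p0; first by rewrite !mulmx0.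
  rewrite /= -[z in z *m _]hsubmxK mul_row_block mulmx0 add0r.
  rewrite (mx_cols0 (rsubmx z) 0 p0) !mul0mx addr0.
  split=> [/eqP|->]; last by rewrite row_mx0.
  by rewrite row_mx_eq0 => /andP[/eqP].
exists (fun z => e (lsubmx z)); split.
- move=> a x y /cyc xD /cyc yD; rewrite -eD //; congr e.
  by apply/matrixP => i i'; rewrite !mxE.
- move=> v; have [x xD ex] := es v; exists (row_mx x 0); last by rewrite row_mxKl.
  by apply/cyc; rewrite row_mxKl.
- move=> z /cyc zD; rewrite ek //; split=> [[y zE]|[y ->]].
    exists (row_mx y 0); rewrite -[z]hsubmxK /= mul_row_block mul0mx addr0 zE.
    by congr row_mx; apply: mx_cols0.
  exists (lsubmx y); rewrite -[y in LHS]hsubmxK /= mul_row_block row_mxKl.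
  by rewrite (mx_cols0 (rsubmx y) 0 S0n) mul0mx addr0.
Qed.

(** Degree j uses that phi is surjective on H_j, degree j + 1 that it is injective on H_j, and
    higher degrees the exactness of S and P. *)
Lemma cone_exact n : (j <= n)%N -> exact_at K n.
Proof.
have [S0 _ exS] := hS; rewrite leq_eqVlt => /orP[/eqP<-|lt_jn] z.
  move=> zD; have p0 : prev (crk S) j = 0%N by apply: prev_crk0 S0 _.
  have [phiD [eS [eP [heS heP ePS]]]] := phi_j.
  have [_ sS _] := heS; have [eD _ kP] := heP.
  have xD : lsubmx z *m pdiff P j = 0.
    case: (j) z zD p0 => [|i] z; first by rewrite !mulmx0.
    rewrite /= -[z in z *m _]hsubmxK mul_row_block mulmx0 add0r => /eqP zD p0.
    move: zD; rewrite row_mx_eq0 => /andP[/eqP + _].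
    by rewrite (mx_cols0 (rsubmx z) 0 p0) !mul0mx addr0.
  have [c cD ec] := sS (eP (lsubmx z)).
  have yD : (- (c *m phi j) + lsubmx z) *m pdiff P j = 0.
    by rewrite mulmxDl mulNmx -mulmxA phiD mulmx0 oppr0 add0r.
  have [|y yE] := (kP _ yD).1.
    rewrite -scaleN1r eD //; last by rewrite -mulmxA phiD mulmx0.
    by rewrite ePS ec scaleN1r addNr.
  exists (row_mx y c); rewrite -[z]hsubmxK /= mul_row_block -yE addrC addrA subrr add0r.
  by congr row_mx; apply: mx_cols0.
case: n z lt_jn => // n z; rewrite ltnS => le_jn.
rewrite /= -[z in z *m _]hsubmxK mul_row_block mulmx0 add0r => /eqP.
rewrite row_mx_eq0 => /andP[/eqP xD /eqP bD].
have {bD}bD : rsubmx z *m pdiff S n = 0.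
  by apply/eqP; rewrite -oppr_eq0 -mulmxN bD.
have [c bE] : exists c, rsubmx z = c *m cdiff S n.
  move: le_jn; rewrite leq_eqVlt => /orP[/eqP eq_j|/exS]; last exact.
  have [_ [eS [eP [[_ _ kS] [_ _ kP] ePS]]]] : compatible (phi n) by rewrite -eq_j.
  apply/kS => //; rewrite -ePS; apply/kP.
    case: (n) z xD bD {ePS} phiE => //= [*|n' z xD bD phiE']; first by rewrite mulmx0.
    by rewrite -mulmxA phiE' mulmxA bD mul0mx.
  by exists (- lsubmx z); rewrite mulNmx; apply/eqP; rewrite -addr_eq0 addrC xD.
have [||y yE] := exP (n := n.+1) _ (x := lsubmx z + c *m phi n.+1).
- by rewrite ltnS.
- by rewrite /= mulmxDl -mulmxA phiE mulmxA -bE.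
exists (row_mx y (- c)); rewrite -[z in LHS]hsubmxK /= mul_row_block -yE mulmx0 add0r.
by rewrite mulNmx addrK mulNmx mulmxN opprK bE.
Qed.

End Comparison.

(** An exact complex of free modules that is bounded below is contractible. Unlike exactness, the
    splitting identity survives the passage to k. *)
Lemma exact_split P : (forall n, cdiff P n *m pdiff P n = 0) ->
  (forall n, exact_at P n) ->
  forall n, exists s t, 1%:M = pdiff P n *m s + t *m cdiff P n.
Proof.
move=> P2 exP.
have step n (s : 'M_(prev (crk P) n, crk P n)) :
    pdiff P n *m s *m pdiff P n = pdiff P n ->
    exists t, 1%:M - pdiff P n *m s = t *m cdiff P n.
  move=> sE; have [|t tE] := @choose_rows _ _ _ (1%:M - pdiff P n *m s) (cdiff P n).
    by move=> x; apply: exP; rewrite -mulmxA mulmxBl mul1mx sE subrr mulmx0.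
  by exists t.
suff gen n : exists s, pdiff P n *m s *m pdiff P n = pdiff P n.
  move=> n; have [s /step[t tE]] := gen n; exists s, t.
  by rewrite -tE addrC subrK.
elim: n => [|n [s /step[t tE]]]; first by exists 0; rewrite /= !mulmx0.
by exists t; rewrite /= -mulmxA -tE mulmxBr mulmx1 mulmxA P2 mul0mx subr0.
Qed.

End Homology.

(** * Killing the homology from the top degree down *)

Section Truncation.
Variables (Q A : comUnitRingType) (r : nat) (f : 'I_r -> Q).
Variables (pi : {rmorphism Q -> A}) (k : fieldType) (rho : {rmorphism A -> k}).
Hypothesis pi_surj : forall a, exists q, pi q = a.
Hypothesis pi_ker : forall q, pi q = 0 <-> @lin_span Q Q^o _ predT f q.
Hypothesis f_rel : forall a : 'I_r -> Q,
  \sum_i f i * a i = 0 -> forall i, pi (a i) = 0.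

Local Notation sigma := (rho \o pi).
Local Notation lifted := (lifted f).
Local Notation Ek C := (pmap sigma (lcx C)).
Local Notation EA C := (pmap pi (lcx C)).

Lemma EA_diff2 (C : lifted) n : cdiff (EA C) n *m pdiff (EA C) n = 0.
Proof. by rewrite pdiff_map /= -map_mxM pTE (pi_f_sum pi_ker). Qed.

Lemma pi_surj_mx m n (M : 'M[A]_(m, n)) : exists L : 'M[Q]_(m, n), map_mx pi L = M.
Proof.
have /choice[g gP] : forall ij : 'I_m * 'I_n, exists q, pi q = M ij.1 ij.2.
  by move=> ij; apply: pi_surj.
by exists (\matrix_(i, j) g (i, j)); apply/matrixP => i j; rewrite !mxE gP.
Qed.

Lemma lift_cone (C Y : lifted) (phi : forall n, 'M[A]_(crk C n, crk Y n)) :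
  (forall n, phi n.+1 *m cdiff (EA Y) n = cdiff (EA C) n *m phi n) ->
  exists (psi : forall n, 'M[Q]_(crk C n, crk Y n))
    (h : 'I_r -> forall n, 'M[Q]_(crk C n.+1, crk Y n)),
    (forall n, psi n.+1 *m cdiff Y n - cdiff C n *m psi n = \sum_i f i *: h i n) /\
    (forall n, map_mx pi (psi n) = phi n).
Proof.
move=> phiE; have psi n := cid (pi_surj_mx (phi n)).
have h n : { h : 'I_r -> 'M[Q]_(crk C n.+1, crk Y n) |
    sval (psi n.+1) *m cdiff Y n - cdiff C n *m sval (psi n) = \sum_i f i *: h i }.
  apply/cid/(pi_ker_mx pi_ker).
  by rewrite map_mxB !map_mxM (svalP (psi n)) (svalP (psi n.+1)) phiE subrr.
exists (fun n => sval (psi n)), (fun i n => sval (h n) i).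
by split=> n; [apply: (svalP (h n)) | apply: (svalP (psi n))].
Qed.

Lemma pmap_cone (C Y : precomplex Q) (psi : forall n, 'M[Q]_(crk C n, crk Y n))
    (phi : forall n, 'M[A]_(crk (pmap pi C) n, crk (pmap pi Y) n)) :
  (forall n, map_mx pi (psi n) = phi n) -> pmap pi (cone psi) = cone phi.
Proof.
move=> psiE; rewrite /pmap /cone; congr Precomplex.
apply: functional_extensionality_dep => n /=.
by rewrite map_block_mx map_mx0 psiE map_mxN pdiff_map.
Qed.

Lemma exact_cocycle_cobd (Y : lifted) : (forall n, exact_at (EA Y) n) ->
  forall n (x : 'cV_(crk Y n)), cocyc (E := Ek Y) x -> cobd (E := Ek Y) x.
Proof.
move=> exY n x xZ; have [s [t E]] := exact_split (EA_diff2 Y) exY n.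
exists (map_mx rho s *m x).
have {}xZ : map_mx sigma (cdiff Y n) *m x = 0 := xZ.
rewrite -[LHS]mul1mx -(map_mx1 rho) E map_mxD !map_mxM mulmxDl -!mulmxA.
by rewrite /= -sigma_mx xZ mulmx0 addr0 !pdiff_map sigma_mx.
Qed.

Variables (N : nat -> lmodType A) (S : nat -> lifted).
Hypothesis hS : forall j, resolves (EA (S j)) j (N j).

Lemma truncation_step j (Y : lifted) :
  (forall n, (n < j.+1)%N -> has_homology (EA Y) n (N n)) ->
  (forall n, (j < n)%N -> exact_at (EA Y) n) ->
  exists (psi : forall n, 'M[Q]_(crk (S j) n, crk Y n))
    (h : 'I_r -> forall n, 'M[Q]_(crk (S j) n.+1, crk Y n))
    (hE : forall n, psi n.+1 *m cdiff Y n - cdiff (S j) n *m psi n = \sum_i f i *: h i n),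
    (forall n, (n < j)%N -> has_homology (EA (lcone hE)) n (N n)) /\
    (forall n, (j <= n)%N -> exact_at (EA (lcone hE)) n).
Proof.
move=> hY exY.
have [phi [phiE phi_j]] := comparison (EA_diff2 (S j)) (hS j) (hY j (leqnn _)) exY.
have [psi [h [hE psiE]]] := lift_cone phiE.
exists psi, h, hE; rewrite (pmap_cone psiE); split=> n le_n.
  by apply: (cone_has_homology (hS j)) => //; apply: hY; apply: ltnW.
by apply: (cone_exact (hS j) exY phiE phi_j).
Qed.

Lemma truncation_kills (s : nat -> {mpoly k[r]}) j (Y : lifted) :
  (forall i, (i < j)%N -> kills pi rho (S i) (s i)) ->
  (forall n, (n < j)%N -> has_homology (EA Y) n (N n)) ->
  (forall n, (j <= n)%N -> exact_at (EA Y) n) ->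
  kills_seq pi rho Y (mkseq s j).
Proof.
elim: j Y => [|j IHj] Y sS hY exY.
  by move=> x xZ n; apply: exact_cocycle_cobd => // m; apply: exY.
have [psi [h [hE [hK exK]]]] := truncation_step hY exY.
rewrite mkseqS; apply: (kills_cone pi_ker f_rel (hE := hE)); last exact: sS.
by apply: IHj => // i lt_ij; apply: sS; apply: ltnW.
Qed.

Lemma truncation_hdim j (Y : lifted) n :
  (forall n, (n < j)%N -> has_homology (EA Y) n (N n)) ->
  (forall n, (j <= n)%N -> exact_at (EA Y) n) ->
  (hdim (Ek Y) n <= \sum_(i < j) hdim (Ek (S i)) n)%N.
Proof.
elim: j Y => [|j IHj] Y hY exY.
  by rewrite big_ord0 hdim_eq0 // => x; apply: exact_cocycle_cobd => m; apply: exY.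
have [psi [h [hE [hK exK]]]] := truncation_step hY exY.
rewrite big_ord_recr /=; apply: leq_trans (hdim_cone rho pi_ker hE n) _.
by rewrite leq_add2r; apply: IHj.
Qed.

End Truncation.

(** * The Koszul complex as an iterated cone *)

Section QuotientMap.
Variables (R : nzRingType) (V : lmodType R) (W : submodClosed V).

Definition quot_pi (x : V) : quot_mod W := (\pi_(Quotient.quot (zmod_of_submod W)) x)%qT.

Lemma quot_pi_linear a x y : quot_pi (a *: x + y) = a *: quot_pi x + quot_pi y.
Proof.
rewrite /quot_pi raddfD; congr (_ + _).
exact/esym/(quot_scaleE W a x).
Qed.

Lemma quot_pi_eq0 x : quot_pi x = 0 <-> x \in W.
Proof.
have := Quotient.idealrBE (zmod_of_submod W) x 0.
rewrite subr0 => E; rewrite -[x \in W]/(x \in zmod_of_submod W) E.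
have -> : (x == 0 %[mod Quotient.quot (zmod_of_submod W)])%qT = (quot_pi x == 0).
  by rewrite /quot_pi raddf0.
by split=> /eqP.
Qed.

Lemma quot_pi_surj v : exists x, quot_pi x = v.
Proof. by exists (repr (v : Quotient.quot (zmod_of_submod W)))%qT; apply: reprK. Qed.
End QuotientMap.

Section HomologyClass.
Variables (R : nzRingType) (V : lmodType R) (Z B : submodClosed V).

(** Total on V, with the default 0 outside Z, to fit the form of [homology_map]. *)
Definition subquot_class (x : V) : subquot Z B :=
  if insub x : option (submod Z) is Some z then quot_pi (@submod_pred _ _ Z B) z else 0.

Lemma subquot_classE x (Zx : x \in Z) :
  subquot_class x = quot_pi (@submod_pred _ _ Z B) (Sub x Zx : submod Z).
Proof. by rewrite /subquot_class insubT. Qed.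

Lemma subquot_class_linear a x y : x \in Z -> y \in Z ->
  subquot_class (a *: x + y) = a *: subquot_class x + subquot_class y.
Proof.
move=> Zx Zy; have Zxy : a *: x + y \in Z by rewrite rpredD ?rpredZ.
rewrite !subquot_classE -quot_pi_linear; congr quot_pi.
by apply: val_inj; rewrite linearP.
Qed.

Lemma subquot_class_eq0 x : x \in Z -> subquot_class x = 0 <-> x \in B.
Proof. by move=> Zx; rewrite subquot_classE; apply: quot_pi_eq0. Qed.

Lemma subquot_class_surj v : exists2 x, x \in Z & subquot_class x = v.
Proof.
have [x <-] := quot_pi_surj (v : quot_mod (@submod_pred _ _ Z B)).
have Zx : val x \in Z by apply: (valP x).
exists (val x) => //; rewrite subquot_classE; apply: (congr1 (quot_pi _)).
by apply: val_inj.
Qed.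
End HomologyClass.

Section KoszulCone.
Variables (A : comUnitRingType) (m : nat) (u : 'I_m -> A) (M : lmodType A).
Local Notation koszul := (koszul m M).
Local Notation d := (@koszul_diff A m u M).
Implicit Types (x y z w : koszul) (S T : {set 'I_m}).

Lemma koszul_diffP a x y : d (a *: x + y) = a *: d x + d y.
Proof. exact: koszul_diff_is_linear. Qed.

Lemma koszul_diff0 : d 0 = 0.
Proof. by have := koszul_diffP (-1) 0 0; rewrite !scaleN1r !addNr. Qed.

Lemma koszul_diffD x y : d (x + y) = d x + d y.
Proof. by rewrite -[x]scale1r koszul_diffP !scale1r. Qed.

Lemma koszul_diffZ a x : d (a *: x) = a *: d x.
Proof. by rewrite -[_ *: x]addr0 koszul_diffP koszul_diff0 addr0. Qed.

Lemma koszul_diffN x : d (- x) = - d x.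
Proof. by rewrite -scaleN1r koszul_diffZ scaleN1r. Qed.

(* The subcomplex K(u_(m-i), ..., u_(m-1); M) in degree n.  Adding the generators
   from the last one to the first makes the signs of koszul_diff those of a cone. *)
Definition tail_koszul i n z : Prop :=
  koszul_deg n z /\ forall S l, l \in S -> (l + i < m)%N -> z S = 0.

Definition prev_tail i n z : Prop := if n is n'.+1 then tail_koszul i n' z else z = 0.

Lemma tail_koszulP i n a x y :
  tail_koszul i n x -> tail_koszul i n y -> tail_koszul i n (a *: x + y).
Proof.
move=> [xn xi] [yn yi]; split.
  by move=> S hS; rewrite !ffunE xn // yn // scaler0 addr0.
by move=> S l lS li; rewrite !ffunE (xi _ _ lS) // (yi _ _ lS) // scaler0 addr0.
Qed.

Lemma tail_koszul0 i n : tail_koszul i n 0.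
Proof. by split=> S *; rewrite ffunE. Qed.

Lemma tail_koszulZ i n a x : tail_koszul i n x -> tail_koszul i n (a *: x).
Proof. by move=> hx; rewrite -[_ *: x]addr0; apply/tail_koszulP/tail_koszul0. Qed.

Lemma tail_koszulD i n x y :
  tail_koszul i n x -> tail_koszul i n y -> tail_koszul i n (x + y).
Proof. by rewrite -[x in _ -> _ -> _ i n (x + _)]scale1r; apply: tail_koszulP. Qed.

Lemma tail_koszulN i n x : tail_koszul i n x -> tail_koszul i n (- x).
Proof. by rewrite -scaleN1r; apply: tail_koszulZ. Qed.

Lemma tail_koszulW i n x : tail_koszul i n x -> tail_koszul i.+1 n x.
Proof.
by move=> [xn xi]; split=> // S l lS li; apply: xi lS _; rewrite ltnW // -addnS.
Qed.

Lemma tail_koszul_diff i n z : tail_koszul i n.+1 z -> tail_koszul i n (d z).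
Proof.
move=> [zn zi]; split=> [T hT|T l lT li]; rewrite ffunE big1 // => l' l'T.
  by rewrite zn ?scaler0 // cardsU1 l'T add1n eqSS.
by rewrite (zi _ l) ?scaler0 // inE lT orbT.
Qed.

Lemma tail_koszul_diff0 i z : tail_koszul i 0 z -> d z = 0.
Proof.
move=> [z0 _]; apply/ffunP => T; rewrite !ffunE big1 // => l lT.
by rewrite z0 ?scaler0 // cardsU1 lT add1n.
Qed.

(** The product e_l y without a sign, correct because y will be supported on indices larger than
    l. *)
Definition wedge (l : 'I_m) (y : koszul) : koszul :=
  [ffun S : {set 'I_m} => if l \in S then y (S :\ l) else 0].

Lemma wedgeP l a x y : wedge l (a *: x + y) = a *: wedge l x + wedge l y.
Proof. by apply/ffunP => S; rewrite !ffunE; case: ifP; rewrite ?ffunE ?scaler0 ?addr0. Qed.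

Lemma wedge0 l : wedge l 0 = 0.
Proof. by apply/ffunP => S; rewrite !ffunE; case: ifP; rewrite ?ffunE. Qed.

Lemma wedgeN l x : wedge l (- x) = - wedge l x.
Proof. by have := wedgeP l (-1) x 0; rewrite !scaleN1r wedge0 !addr0. Qed.

Lemma wedgeD l x y : wedge l (x + y) = wedge l x + wedge l y.
Proof. by have := wedgeP l 1 x y; rewrite !scale1r. Qed.

Section Step.
Variables (i : nat) (l : 'I_m).
Hypothesis l_i : (l + i.+1 = m)%N.

Lemma tail_ltP n z S l' : tail_koszul i n z -> l' \in S -> (l' <= l)%N -> z S = 0.
Proof.
move=> [_ zi] l'S le_l; apply: zi l'S _.
have : (l' + i < l + i.+1)%N by rewrite addnS ltnS leq_add2r.
by rewrite l_i.
Qed.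

Lemma wedge_tail n y : tail_koszul i n y -> tail_koszul i.+1 n.+1 (wedge l y).
Proof.
move=> [yn yi]; split=> [S hS|S l' l'S lt_l']; rewrite ffunE; case: ifP => // lS.
  apply: yn; apply: contra hS => /eqP <-.
  by rewrite (cardsD1 l S) lS.
have lt_l : (l' < l)%N.
  have : (l' + i.+1 < l + i.+1)%N by rewrite l_i.
  by rewrite ltn_add2r.
apply: (@tail_ltP n _ _ l'); [by []| | exact: ltnW].
by rewrite !inE l'S andbT; apply: contraTneq lt_l => ->; rewrite ltnn.
Qed.

Lemma wedge_diff n y : tail_koszul i n y ->
  d (wedge l y) = u l *: y - wedge l (d y).
Proof.
move=> hy; apply/ffunP => T; rewrite !ffunE.
have [lT|lT] := boolP (l \in T); last first.
  rewrite subr0 (bigD1 l) //= big1 ?addr0 => [|l' /andP[l'T ne_l]].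
    rewrite !ffunE setU11 setU1K //.
    have [y0|y0] := eqVneq (y T) 0; first by rewrite y0 !scaler0.
    rewrite (_ : [set _ in T | _] = finset.set0) ?cards0 ?mul1r //.
    apply/setP => l'; rewrite !inE; apply/negP => /andP[l'T lt_l'].
    by rewrite (tail_ltP hy l'T (ltnW lt_l')) eqxx in y0.
  by rewrite !ffunE !inE eq_sym (negbTE ne_l) (negbTE lT) scaler0.
rewrite (tail_ltP hy lT (leqnn _)) scaler0 add0r.
rewrite [in RHS](bigD1 l) ?inE ?eqxx //= (tail_ltP hy (setU11 _ _) (leqnn _)) scaler0 add0r.
rewrite -sumrN; apply: eq_big => l'.
  by rewrite !inE negb_and negbK; have [->|] := eqVneq l' l; rewrite ?lT ?andbF ?andbT.
move=> l'T; have ne_l : l' != l by apply: contraNneq l'T => ->.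
rewrite ffunE !inE lT orbT -scaleNr.
have -> : (l' |: T) :\ l = l' |: (T :\ l).
  by apply/setP => t; rewrite !inE; have [->|] := eqVneq t l; rewrite // eq_sym (negbTE ne_l).
have [lt_l|le_l] := ltnP l l'; last first.
  by rewrite (tail_ltP hy (setU11 _ _) le_l) !scaler0.
congr (_ *: _); rewrite -mulNr; congr (_ * _).
(* Since l < l', removing l from T lowers the position of l' by one; this is the minus sign of d
   (e_l y) = u_l y - e_l (d y). *)
rewrite (cardsD1 l) inE lT lt_l exprS mulN1r; congr (- _ ^+ #|pred_of_set _|).
by apply/setP => t; rewrite !inE andbA.
Qed.

Lemma tail_split n z : tail_koszul i.+1 n z ->
  exists z' z'', [/\ tail_koszul i n z', prev_tail i n z'' & z = z' + wedge l z''].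
Proof.
move=> [zn zi].
have supp S l' : l' \in S -> (l' + i < m)%N -> l \notin S -> z S = 0.
  move=> l'S lt_l' lS; apply: (zi _ l') => //.
  rewrite addnS ltn_neqAle lt_l' andbT; apply: contraNneq lS => E.
  suff -> : l = l' by [].
  by apply: val_inj; apply/eqP; rewrite -(eqn_add2r i.+1) l_i addnS E.
exists [ffun S : {set 'I_m} => if l \in S then 0 else z S].
exists [ffun S : {set 'I_m} => if l \in S then 0 else z (l |: S)]; split.
- split=> [S hS|S l' l'S lt_l']; rewrite ffunE; case: ifP => // lS.
    exact: zn.
  by apply: (supp _ _ l'S lt_l'); rewrite lS.
- case: n zn => [|n] zn.
    by apply/ffunP => S; rewrite !ffunE; case: ifP => // lS; rewrite zn // cardsU1 lS.
  split=> [S hS|S l' l'S lt_l']; rewrite ffunE; case: ifP => // lS.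
    by rewrite zn // cardsU1 lS.
  have ne_l : l' != l by apply: contraTneq l'S => ->; rewrite lS.
  apply: (zi _ l'); first by rewrite !inE l'S orbT.
  rewrite addnS ltn_neqAle lt_l' andbT; apply: contraNneq ne_l => E.
  by apply/eqP/val_inj/eqP; rewrite -(eqn_add2r i.+1) l_i addnS E.
- apply/ffunP => S; rewrite !ffunE; case: ifP => lS; last by rewrite addr0.
  by rewrite add0r !inE eqxx /= finset.setD1K.
Qed.

Lemma wedge_inj n n' a b : tail_koszul i n a -> tail_koszul i n' b ->
  a + wedge l b = 0 -> a = 0 /\ b = 0.
Proof.
move=> ha hb /ffunP E; split; apply/ffunP => S; rewrite ffunE; have [lS|lS] := boolP (l \in S).
- by rewrite (tail_ltP ha lS).
- by have := E S; rewrite !ffunE (negbTE lS) addr0.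
- by rewrite (tail_ltP hb lS).
have := E (l |: S); rewrite !ffunE setU11 setU1K // (tail_ltP ha (setU11 _ _) (leqnn _)).
by rewrite add0r.
Qed.

End Step.
End KoszulCone.

Section KoszulResolution.
Variables (A : comUnitRingType) (m : nat) (u : 'I_m -> A) (M : lmodType A).
Local Notation koszul := (koszul m M).
Local Notation d := (@koszul_diff A m u M).
Local Notation tail i n z := (@tail_koszul A m M i n z).

(** P plays the part of K(u_(m-i), ..., u_(m-1)) (x) FM, and alpha is a quasi-isomorphism to the
    Koszul complex with coefficients in M. The tensor product is never formed: P will be an iterated
    cone. *)
Record tail_quasi_iso (P : precomplex A) i
    (alpha : forall n, 'rV[A]_(crk P n) -> koszul) : Prop := TailQuasiIso {
  tqi_lin : forall n a x y, alpha n (a *: x + y) = a *: alpha n x + alpha n y;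
  tqi_tail : forall n x, tail i n (alpha n x);
  tqi_diff : forall n x, d (alpha n.+1 x) = alpha n (x *m cdiff P n);
  tqi_surj : forall n z, tail i n z -> d z = 0 ->
    exists x w, [/\ x *m pdiff P n = 0, tail i n.+1 w & z = alpha n x + d w];
  tqi_inj : forall n x w, x *m pdiff P n = 0 -> tail i n.+1 w ->
    alpha n x = d w -> exists y, x = y *m cdiff P n
}.

Lemma tail_diff_pred i n z : tail i n z -> tail i n.-1 (d z).
Proof.
case: n => [|n] hz; last exact: tail_koszul_diff.
by rewrite (tail_koszul_diff0 _ hz); apply: tail_koszul0.
Qed.

Lemma tail_quasi_iso0 (P : precomplex A) (aug : {linear 'rV[A]_(crk P 0) -> M}) :
  (forall v, exists x, aug x = v) ->
  (forall x, aug x = 0 <-> exists y, x = y *m cdiff P 0) ->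
  (forall n, (0 < n)%N -> exact_at P n) ->
  exists alpha, @tail_quasi_iso P 0 alpha.
Proof.
move=> aug_surj aug_ker exP.
have tail0 n z : tail 0 n z -> (0 < n)%N -> z = 0.
  move=> [zn zi] n_gt0; apply/ffunP => S; rewrite ffunE.
  have [->|[l lS]] := finset.set_0Vmem S; last by apply: zi lS _; rewrite addn0.
  by apply: zn; rewrite cards0 eq_sym -lt0n.
pose alpha n : 'rV[A]_(crk P n) -> koszul :=
  match n with
  | 0 => fun x => [ffun S : {set 'I_m} => if S == finset.set0 then aug x else 0]
  | _ => fun=> 0
  end.
have alpha_eq0 x : alpha 0%N x = 0 -> aug x = 0.
  by move=> /ffunP/(_ finset.set0); rewrite !ffunE eqxx.
have alphaD x : aug x = 0 -> alpha 0%N x = 0.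
  by move=> ax; apply/ffunP => S; rewrite !ffunE ax if_same.
exists alpha; split.
- case=> [|n] a x y; last by rewrite scaler0 addr0.
  by apply/ffunP => S; rewrite !ffunE; case: ifP; rewrite ?linearP ?scaler0 ?addr0.
- case=> [|n] x; last exact: tail_koszul0.
  split=> [S|S l lS _]; rewrite ffunE; first by rewrite cards_eq0 => /negbTE->.
  by case: eqP => // S0; rewrite S0 inE in lS.
- move=> [|n] x; rewrite /= koszul_diff0 //; apply/esym/alphaD/aug_ker.
  by exists x.
- case=> [|n] z hz dz; last first.
    by exists 0, 0; rewrite mul0mx koszul_diff0 addr0 (tail0 _ _ hz); split=> //;
       apply: tail_koszul0.
  have [x ax] := aug_surj (z finset.set0).
  exists x, 0; rewrite mulmx0 koszul_diff0 addr0; split=> //.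
    exact: tail_koszul0.
  apply/ffunP => S; rewrite ffunE; case: eqP => [->//|/eqP S0].
  by have [zn _] := hz; apply: zn; rewrite cards_eq0.
- move=> n x w xD /tail0 -> //; rewrite koszul_diff0.
  case: n x xD => [|n] x xD; first by move=> /alpha_eq0/aug_ker.
  by move=> _; apply: exP.
Qed.

(* Five lemma for the cone of u_l. *)
Lemma tail_quasi_isoS (P : precomplex A) i (l : 'I_m) alpha :
  (l + i.+1 = m)%N -> (forall n, cdiff P n *m pdiff P n = 0) ->
  @tail_quasi_iso P i alpha ->
  exists beta, @tail_quasi_iso (cone (C := P) (Y := P) (fun n => (u l)%:M)) i.+1 beta.
Proof.
move=> l_i P2 [a_lin a_tail a_diff a_surj a_inj].
set v := u l; set K := cone _.
have aD n x y : alpha n (x + y) = alpha n x + alpha n y.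
  by rewrite -[x]scale1r a_lin !scale1r.
have a0 n : alpha n 0 = 0.
  by apply: (addIr (alpha n 0)); rewrite -aD !add0r.
have aZ n c x : alpha n (c *: x) = c *: alpha n x.
  by rewrite -[_ *: x]addr0 a_lin a0 addr0.
have aN n x : alpha n (- x) = - alpha n x by rewrite -scaleN1r aZ scaleN1r.
pose palpha n : 'rV[A]_(prev (crk P) n) -> koszul :=
  match n with 0 => fun=> 0 | n'.+1 => alpha n' end.
have cross n (w w' : koszul) : tail i n.+1 w -> tail i n w' ->
    d (w + wedge l w') = (d w + v *: w') - wedge l (d w').
  by move=> hw hw'; rewrite koszul_diffD (wedge_diff u l_i hw') addrA.
have wedge_eq n n' (a b a' b' : koszul) : tail i n a -> tail i n' b ->
    tail i n a' -> tail i n' b' -> a + wedge l b = a' + wedge l b' -> a = a' /\ b = b'.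
  move=> ha hb ha' hb' E.
  have [|||/eqP + /eqP] := @wedge_inj _ _ _ _ _ l_i n n' (a - a') (b - b').
  - exact/tail_koszulD/tail_koszulN.
  - exact/tail_koszulD/tail_koszulN.
  - by rewrite wedgeD wedgeN addrACA E -opprD subrr.
  by rewrite !subr_eq0 => /eqP-> /eqP->.
pose beta n (z : 'rV[A]_(crk K n)) : koszul :=
  alpha n (lsubmx z) + wedge l (palpha n (rsubmx z)).
have betaE n x y : beta n (row_mx x y) = alpha n x + wedge l (palpha n y).
  by rewrite /beta row_mxKl row_mxKr.
have cycleS n (x : 'rV_(crk P n.+1)) (y : 'rV_(crk P n)) :
    (row_mx x y : 'rV_(crk K n.+1)) *m pdiff K n.+1 = 0 <->
    x *m cdiff P n + v *: y = 0 /\ y *m pdiff P n = 0.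
  rewrite /= mul_row_block mulmx0 add0r mul_mx_scalar.
  split=> [/eqP|[-> yD]]; last by rewrite mulmxN yD oppr0 row_mx0.
  by rewrite row_mx_eq0 mulmxN oppr_eq0 => /andP[/eqP-> /eqP].
exists beta; split.
- move=> n a x y; rewrite /beta.
  have -> : lsubmx (a *: x + y) = a *: lsubmx x + lsubmx y.
    by apply/matrixP => i' j'; rewrite !mxE.
  have -> : rsubmx (a *: x + y) = a *: rsubmx x + rsubmx y.
    by apply/matrixP => i' j'; rewrite !mxE.
  rewrite a_lin; have -> : palpha n (a *: rsubmx x + rsubmx y) =
     a *: palpha n (rsubmx x) + palpha n (rsubmx y).
    by case: n x y => [|n] x y /=; rewrite ?scaler0 ?addr0.
  by rewrite wedgeP scalerDr addrACA.
- move=> n z; rewrite /beta; apply: tail_koszulD; first exact: tail_koszulW.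
  case: n z => [|n] z /=; first by rewrite wedge0; apply: tail_koszul0.
  exact: wedge_tail.
- move=> n z; rewrite -[z]hsubmxK; move: (lsubmx z) (rsubmx z) => x y.
  rewrite betaE /= mul_row_block mulmx0 add0r mul_mx_scalar betaE.
  rewrite (cross n) // a_diff aD aZ; congr (_ + _).
  case: n {z} x y => [|n] x y /=; last by rewrite a_diff -wedgeN mulmxN aN.
  by rewrite (tail_koszul_diff0 _ (a_tail 0%N y)) wedge0 oppr0.
- move=> n z hz; have [z' [z'' [hz' hz'' ->]]] := tail_split l_i hz.
  case: n {z hz} hz' hz'' => [|n] hz' hz''.
    rewrite hz'' wedge0 addr0 => dz'.
    have [x [w [xD hw ->]]] := a_surj _ _ hz' dz'.
    exists (row_mx x 0), w; split; rewrite ?mulmx0 //; first exact: tail_koszulW.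
    by rewrite betaE /= wedge0 addr0.
  rewrite (cross n) // => E.
  have [|||E1 /eqP] := @wedge_inj _ _ _ _ _ l_i n n.-1 (d z' + v *: z'') (- d z'').
  - by apply: tail_koszulD; [apply: tail_koszul_diff | apply: tail_koszulZ].
  - exact/tail_koszulN/tail_diff_pred.
  - by rewrite wedgeN.
  rewrite oppr_eq0 => /eqP E2.
  (* The e_l-component is treated first: z'' is homologous to alpha y. As v z'' = - d z', the cycle
     v y is a boundary a d, and a then corrects z' to a cycle. *)
  have [y [w'' [yD hw'' z''E]]] := a_surj _ _ hz'' E2.
  have [|||a yE] := @a_inj n (v *: y) (- z' - v *: w'').
  - by rewrite -scalemxAl yD scaler0.
  - apply: tail_koszulD; first exact: tail_koszulN.
    exact/tail_koszulN/tail_koszulZ.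
  - rewrite koszul_diffD !koszul_diffN koszul_diffZ aZ.
    move: E1 => /eqP; rewrite addr_eq0 => /eqP->.
    by rewrite opprK z''E scalerDr addrK.
  have [||b [w' [bD hw' bE]]] := @a_surj n.+1 (z' + v *: w'' + alpha n.+1 a).
  - by do 2?[apply: tail_koszulD => //]; apply: tail_koszulZ.
  - rewrite !koszul_diffD koszul_diffZ a_diff -yE aZ -addrA -scalerDr.
    by rewrite [_ + alpha n y]addrC -z''E E1.
  exists (row_mx (b - a) y), (w' - wedge l w''); split.
  - apply/cycleS; split=> //.
    by rewrite mulmxBl [b *m _]bD sub0r yE addNr.
  - apply: tail_koszulD; first exact: tail_koszulW.
    exact/tail_koszulN/wedge_tail.
  - have -> : z' = alpha n.+1 b + d w' - v *: w'' - alpha n.+1 a.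
      by rewrite -bE addrAC addrK addrK.
    rewrite betaE /= -wedgeN (cross n.+1) //; last exact: tail_koszulN.
    rewrite koszul_diffN wedgeN opprK scalerN z''E wedgeD aD aN !addrA.
    by rewrite [LHS](ACl (1*4*5*2*3*6)).
- move=> n z; rewrite -[z]hsubmxK; move: (lsubmx z) (rsubmx z) => x y {z}.
  move=> W + hW; have [w' [w'' [hw' hw'' ->]]] := tail_split l_i hW.
  rewrite betaE (cross n) //.
  case: n x y W hW w' w'' hw' hw'' => [|n] x y W hW w' w'' hw' hw''.
    rewrite wedge0 addr0 (tail_koszul_diff0 _ hw'') wedge0 subr0 => _ E.
    have [||a [w3 [_ hw3 aE]]] := @a_surj 0%N w''.
    - by [].
    - exact: tail_koszul_diff0 hw''.
    have [|||c cE] := @a_inj 0%N (x - v *: a) (w' + v *: w3).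
    - exact: mulmx0.
    - exact/tail_koszulD/tail_koszulZ.
    - by rewrite aD aN aZ E {1}aE scalerDr addrA addrAC addrK koszul_diffD koszul_diffZ addrC.
    exists (row_mx c a); rewrite /= mul_row_block mul_mx_scalar -cE subrK.
    by congr row_mx; apply: mx_cols0.
  move=> /cycleS[xD yD] E.
  have [|||||E1 E2] := @wedge_eq n.+1 n (alpha n.+1 x) (alpha n y) (d w' + v *: w'') (- d w'').
  - exact: a_tail.
  - exact: a_tail.
  - by apply: tail_koszulD; [apply: tail_koszul_diff | apply: tail_koszulZ].
  - exact/tail_koszulN/tail_koszul_diff.
  - by rewrite wedgeN.
  have [|||a yE] := @a_inj n y (- w'').
  - exact: yD.
  - exact: tail_koszulN.
  - by rewrite koszul_diffN.
  have [||b [w3 [bD hw3 bE]]] := @a_surj n.+1 (alpha n.+1 a + w'').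
  - exact: tail_koszulD.
  - by rewrite koszul_diffD a_diff -yE E2 addNr.
  have w''E : w'' = alpha n.+1 (b - a) + d w3.
    by rewrite aD aN addrAC -bE addrC addrA addNr add0r.
  have [|||c cE] := @a_inj n.+1 (x - v *: (b - a)) (w' + v *: w3).
  - rewrite mulmxBl -scalemxAl mulmxBl /= bD sub0r scalerN opprK.
    by rewrite -yE.
  - exact/tail_koszulD/tail_koszulZ.
  - rewrite aD aN aZ E1 {1}w''E scalerDr addrA addrAC addrK.
    by rewrite koszul_diffD koszul_diffZ addrC.
  exists (row_mx c (b - a)); rewrite /= mul_row_block mul_mx_scalar -cE subrK.
  congr row_mx; rewrite mulmxN mulmxBl bD sub0r opprK mulmx0 add0r; exact: yE.
Qed.
End KoszulResolution.

Section KoszulTower.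
Variables (A : comUnitRingType) (m : nat) (u : 'I_m -> A) (M : lmodType A).

Lemma tail_quasi_iso_cycle (P : precomplex A) i alpha n x :
  @tail_quasi_iso A m u M P i alpha -> x *m pdiff P n = 0 ->
  koszul_diff u (alpha n x) = 0.
Proof.
move=> [a_lin a_tail a_diff _ _]; case: n x => [|n] x xD.
  exact: tail_koszul_diff0 (a_tail 0%N x).
rewrite a_diff /= in xD *; rewrite xD.
by have := a_lin n (-1) 0 0; rewrite !scaleN1r !addNr.
Qed.

Lemma koszul_has_homology (P : precomplex A) alpha n :
  @tail_quasi_iso A m u M P m alpha -> has_homology P n (koszul_homology u M n).
Proof.
move=> qi; have [a_lin a_tail a_diff a_surj a_inj] := qi.
have cyc x : x *m pdiff P n = 0 -> alpha n x \in @koszul_cycle A m u M n.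
  move=> xD; apply/asboolP; split; first by have [] := a_tail n x.
  exact: tail_quasi_iso_cycle xD.
have tailm j (w : koszul m M) : koszul_deg j w -> tail_koszul m j w.
  by move=> wj; split=> // S l _; rewrite ltnNge leq_addl.
exists (fun x => subquot_class (@koszul_cycle A m u M n) (@koszul_boundary A m u M n) (alpha n x)).
split.
- by move=> a x y /cyc xZ /cyc yZ; rewrite a_lin subquot_class_linear.
- move=> v; have [z zZ <-] := subquot_class_surj v.
  have /asboolP[zn dz] := zZ.
  have [x [w [xD [wn _] zE]]] := a_surj n z (tailm _ _ zn) dz.
  exists x => //; have aE : alpha n x = -1 *: koszul_diff u w + z.
    by rewrite zE scaleN1r addrC addrK.
  have dwB : koszul_diff u w \in @koszul_boundary A m u M n by apply/asboolP; exists w.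
  have dwZ : koszul_diff u w \in @koszul_cycle A m u M n.
    have -> : koszul_diff u w = -1 *: alpha n x + z by rewrite zE scaleN1r addKr.
    by rewrite rpredD ?rpredZ ?cyc.
  rewrite aE subquot_class_linear //.
  by have [_ ->] := subquot_class_eq0 (@koszul_boundary A m u M n) dwZ; rewrite ?scaler0 ?add0r.
- move=> x xD; rewrite subquot_class_eq0 ?cyc //; split=> [/asboolP[w wn aw]|[y xE]].
    by apply: (a_inj n x w xD _ aw); apply: tailm.
  apply/asboolP; exists (alpha n.+1 y); last by rewrite a_diff xE.
  by have [] := a_tail n.+1 y.
Qed.

Lemma koszul_exact_at (P : precomplex A) alpha n :
  @tail_quasi_iso A m u M P m alpha -> (m < n)%N -> exact_at P n.
Proof.
move=> [a_lin a_tail _ _ a_inj] lt_mn x xD.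
apply: (a_inj n x 0) => //; first exact: tail_koszul0.
rewrite koszul_diff0; apply/ffunP => S; rewrite ffunE.
have [an _] := a_tail n x; apply: an; rewrite neq_ltn.
by rewrite (leq_ltn_trans _ lt_mn) // (leq_trans (max_card _)) ?card_ord.
Qed.

Variables (Q : comUnitRingType) (r : nat) (f : 'I_r -> Q).
Variables (pi : {rmorphism Q -> A}) (k : fieldType) (rho : {rmorphism A -> k}).
Hypothesis pi_surj : forall a, exists q, pi q = a.
Hypothesis pi_ker : forall q, pi q = 0 <-> @lin_span Q Q^o _ predT f q.
Hypothesis f_rel : forall a : 'I_r -> Q,
  \sum_i f i * a i = 0 -> forall i, pi (a i) = 0.
Hypothesis rho_u : forall l, rho (u l) = 0.

Local Notation sigma := (rho \o pi).
Local Notation Ek C := (pmap sigma (lcx C)).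
Local Notation EA C := (pmap pi (lcx C)).

(** Each generator contributes the cone of a scalar that vanishes in k, so neither annihilators nor
    dimension bounds are lost on the way from X back to F. *)
Lemma koszul_tower (F : lifted f) i : (i <= m)%N ->
  (exists alpha, @tail_quasi_iso A m u M (EA F) 0 alpha) ->
  exists X : lifted f, [/\ exists alpha, @tail_quasi_iso A m u M (EA X) i alpha,
    forall ss, kills_seq pi rho X ss -> kills_seq pi rho F ss &
    forall n, (hdim (Ek F) n <= hdim (Ek X) n)%N].
Proof.
move=> + qiF; elim: i => [_|i IHi lt_im]; first by exists F.
have [X [[alpha qi] killX hX]] := IHi (ltnW lt_im).
pose l := rev_ord (Ordinal lt_im).
have l_i : (l + i.+1 = m)%N by rewrite /= subnK.
have [v vE] := pi_surj (u l).
(* Scalars commute with the lifted differential over Q itself, so the defect h is 0. *)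
have hE n : v%:M *m cdiff X n - cdiff X n *m v%:M =
    \sum_(j < r) f j *: (0 : 'M_(crk X n.+1, crk X n)).
  by rewrite mul_scalar_mx mul_mx_scalar subrr big1 // => j _; rewrite scaler0.
pose K := @lcone Q r f X X (fun n => v%:M) (fun j n => 0) hE.
have sv n : map_mx sigma (v%:M : 'M_(crk X n)) = 0.
  by apply/matrixP => a b; rewrite !mxE raddfMn /= vE rho_u mul0rn.
exists K; split.
- have -> : EA K = cone (C := EA X) (Y := EA X) (fun n => (u l)%:M).
    by apply: pmap_cone => n; rewrite map_scalar_mx /= vE.
  exact: tail_quasi_isoS l_i (EA_diff2 pi_ker X) qi.
- by move=> ss /(kills_cone_sigma0 sv)/killX.
- by move=> n; apply: leq_trans (hX n) _; apply: (hdim_cone_sigma0 pi_ker).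
Qed.

End KoszulTower.

Section Resolutions.
Variables (Q A : comUnitRingType) (r : nat) (f : 'I_r -> Q).
Variables (pi : {rmorphism Q -> A}) (N : lmodType A) (F : free_resolution N).
Variable E : eisenbud_lift f pi F.

Definition lifted_resolution : lifted f :=
  @Lifted Q r f (@Precomplex Q (rk F) (ldif E)) (lop E) (lopE E).

Definition resolution_precomplex : precomplex A := @Precomplex A (rk F) (dif F).

Lemma pmap_lifted_resolution : pmap pi (lcx lifted_resolution) = resolution_precomplex.
Proof.
rewrite /pmap /resolution_precomplex; congr Precomplex.
by apply: functional_extensionality_dep => n; apply: ldifE.
Qed.

Lemma resolution_exact n : (0 < n)%N -> exact_at resolution_precomplex n.
Proof. by case: n => // n _ x /dif_exact. Qed.

Lemma resolution_resolves : resolves resolution_precomplex 0 N.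
Proof.
split=> //; last exact: resolution_exact.
exists (aug F); split.
- by move=> a x y _ _; rewrite linearP.
- by move=> v; have [x xv] := aug_surj F v; exists x; rewrite ?mulmx0.
- by move=> x _; apply: aug_exact.
Qed.
End Resolutions.

(** * Support varieties *)

Section Rescaling.
Variables (k : fieldType) (r : nat) (c : k).
Hypothesis c_neq0 : c != 0.
Implicit Types (t : 'X_{1..r}) (s : {mpoly k[r]}).

(** The polynomial s(c t). It carries nonvanishing at c v, all that an inhomogeneous s may provide
    on the line of v, to nonvanishing at v. *)
Definition rescale s : {mpoly k[r]} :=
  \sum_(t <- msupp s) (s@_t * c ^+ mdeg t) *: 'X_[t].

Lemma meval_rescale s (v : 'I_r -> k) : (rescale s).@[v] = s.@[fun i => c * v i].
Proof.
rewrite raddf_sum /= [RHS]mevalE; apply: eq_bigr => t _.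
rewrite mevalZ mevalX -mulrA; congr (_ * _); rewrite mdegE -prodrXr -big_split.
by apply: eq_bigr => i _; rewrite exprMn.
Qed.

Variable rk : nat -> nat.
Local Notation coch := (forall n, 'cV[k]_(rk n)).

(* Conjugation by x_n |-> c^(-n/2) x_n multiplies the operators, of degree 2, by c. *)
Definition half_scale (j : nat) (x : coch) : coch := fun n => (c ^+ j / c ^+ n./2) *: x n.

Variable op : 'I_r -> coch -> coch.
Hypothesis op_half : forall i j x, op i (half_scale j x) = half_scale j.+1 (op i x).

Lemma mact_half_scale t x : mact op t (half_scale 0 x) = half_scale (mdeg t) (mact op t x).
Proof.
rewrite /mact mdegE -big_enum /=.
elim: (enum _) => [|i l IHl]; first by rewrite big_nil.
rewrite big_cons /= IHl; elim: (t i) => [|n IHn] //=.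
by rewrite IHn op_half.
Qed.

Lemma pact_half_scale s x n :
  pact op s (half_scale 0 x) n = (c ^+ n./2)^-1 *: pact op (rescale s) x n.
Proof.
rewrite pact_sumZX scaler_sumr; apply: eq_bigr => t _.
rewrite mact_half_scale /half_scale !scalerA; congr (_ *: _).
by rewrite mulrA mulrC.
Qed.
End Rescaling.

Section Variety.
Variables (Q A : comUnitRingType) (r : nat) (f : 'I_r -> Q).
Variables (pi : {rmorphism Q -> A}) (k : fieldType) (rho : {rmorphism A -> k}).
Local Notation sigma := (rho \o pi).
Local Notation Ek C := (pmap sigma (lcx C)).

(** [ext_annihilator] tests finitely supported cochains while [kills] tests all of them. Since
    operators only raise degrees, truncating above n does not affect degree n. *)
Lemma op_local (C : lifted f) i (x y : forall n, 'cV[k]_(crk C n)) n :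
  (forall n', (n' <= n)%N -> x n' = y n') ->
  forall n', (n' <= n)%N -> op pi rho i x n' = op pi rho i y n'.
Proof. by move=> xy [|[|n']] //= lt_n; rewrite xy // ltnW // ltnW. Qed.

Lemma mact_local (C : lifted f) t (x y : forall n, 'cV[k]_(crk C n)) n :
  (forall n', (n' <= n)%N -> x n' = y n') ->
  forall n', (n' <= n)%N -> mact (@op Q A r f pi k rho C) t x n' = mact (@op Q A r f pi k rho C) t y n'.
Proof.
move=> xy; rewrite /mact; elim: (enum _) => //= i l IHl.
by elim: (t i) => //= m IHm n' le_n; apply: op_local IHm _ le_n.
Qed.

Lemma kills_rescale (C : lifted f) c s : c != 0 ->
  kills pi rho C s -> kills pi rho C (rescale c s).
Proof.
move=> c0 Cs x xZ n; have op_half i j (y : forall n, 'cV[k]_(crk C n)) :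
    op pi rho i (half_scale c j y) = half_scale c j.+1 (op pi rho i y).
  apply: functional_extensionality_dep => -[|[|m]]; rewrite /half_scale /= ?scaler0 //.
  rewrite -scalemxAr; congr (_ *: _).
  by rewrite !exprS invfM mulrACA mulfV // mul1r.
have [|w wE] := Cs (half_scale c 0 x) _ n.
  by move=> m; rewrite /cocyc /half_scale -scalemxAr [cdiff _ _ *m _]xZ scaler0.
exists (c ^+ n./2 *: w); rewrite -scalemxAr -wE (pact_half_scale op_half).
by rewrite scalerA mulfV ?scale1r // expf_neq0.
Qed.

Section Resolution.
Variables (N : lmodType A) (F : free_resolution N) (E : eisenbud_lift f pi F).
Local Notation C := (lifted_resolution E).

Lemma op_actE : op_act rho E = @op Q A r f pi k rho C.
Proof.
apply: functional_extensionality_dep => i; apply: functional_extensionality_dep => x.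
by apply: functional_extensionality_dep => -[|[|n]] //=; rewrite sigma_mx.
Qed.

Lemma poly_actE s x n : poly_act rho E s x n = pact (@op Q A r f pi k rho C) s x n.
Proof. by rewrite -op_actE. Qed.

Lemma cdiffE n : cdiff (Ek C) n = map_mx rho (dif F n).
Proof. by rewrite /= sigma_mx ldifE. Qed.

Lemma ext_cocyclesP n (x : 'cV[k]_(rk F n)) :
  x \in ext_cocycles rho F n <-> cocyc (E := Ek C) x.
Proof.
rewrite /cocyc cdiffE; split; first by move/mem_cocyc.
by move=> xZ; apply/mem_cocyc.
Qed.

Lemma ext_coboundariesP n (x : 'cV[k]_(rk F n)) :
  x \in ext_coboundaries rho F n <-> cobd (E := Ek C) x.
Proof.
case: n x => [|n] x; rewrite /cobd /ext_coboundaries.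
  rewrite memv0; split=> [/eqP->|[w ->]]; last by rewrite /pdiff mul0mx.
  by exists 0; rewrite mulmx0.
rewrite [pdiff _ _]cdiffE.
by split=> [/mem_cobd|h]; last apply/mem_cobd.
Qed.

Lemma ext_annihilator_kills s : ext_annihilator rho E s -> kills pi rho C s.
Proof.
move=> hs x xZ n; pose x' : forall n, 'cV[k]_(rk F n) :=
  fun m => if (m <= n)%N then x m else 0.
have -> : pact (@op Q A r f pi k rho C) s x n = pact (@op Q A r f pi k rho C) s x' n.
  apply: eq_bigr => t _; congr (_ *: _); apply: (@mact_local C t x x' n) => //.
  by move=> m le_m; rewrite /x' le_m.
apply/ext_coboundariesP; rewrite -poly_actE; apply: hs => [|m].
  by exists n.+1 => m lt_m; rewrite /x' leqNgt lt_m.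
apply/ext_cocyclesP; rewrite /x'; case: ifP => _; first exact: xZ.
by rewrite /cocyc mulmx0.
Qed.

Lemma kills_ext_annihilator s : kills pi rho C s -> ext_annihilator rho E s.
Proof.
move=> hs x _ xZ n; apply/ext_coboundariesP; rewrite poly_actE; apply: hs.
by move=> m; apply/ext_cocyclesP.
Qed.

Lemma ext_dimE n : ext_dim rho F n = hdim (Ek C) n.
Proof.
rewrite /ext_dim; have -> : ext_coboundaries rho F n = limg (linfun (mulmx (pdiff (Ek C) n))).
  apply/vspaceP => x; apply/idP/idP => [/ext_coboundariesP xB|/mem_cobd xB].
    exact/mem_cobd.
  exact/ext_coboundariesP.
by rewrite /hdim cdiffE.
Qed.

End Resolution.
End Variety.

Lemma proj_point_vec (k : fieldType) r (L : proj_point k r) :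
  exists v : 'rV[k]_r, [/\ v \in val L, v != 0 &
    forall w : 'rV_r, w \in val L -> exists c, w = c *: v].
Proof.
case: L => L /= /eqP dL; exists (vpick L).
have v0 : vpick L != 0 by rewrite vpick0 -dimv_eq0 dL.
split=> [|//|w wL]; first exact: memv_pick.
suff : w \in <[vpick L]>%VS by move/vlineP.
suff -> : <[vpick L]>%VS = L by [].
by apply/eqP; rewrite eqEdim -memvE memv_pick dL dim_vline v0.
Qed.

(** * Grade sensitivity of Koszul homology *)

Section KoszulFacts.
Variables (A : comUnitRingType) (m : nat) (u : 'I_m -> A).

(** Induction on the number of generators by d (e_l y) = u_l y - e_l (d y), which avoids cancelling
    signed pairs of indices. *)
Lemma koszul_diff2 (M : lmodType A) (z : koszul m M) n : koszul_deg n z ->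
  koszul_diff u (koszul_diff u z) = 0.
Proof.
suff gen i : (i <= m)%N -> forall n (z : koszul m M), tail_koszul i n z ->
    koszul_diff u (koszul_diff u z) = 0.
  by move=> zn; apply: (gen m (leqnn m) n); split=> // S l _; rewrite ltnNge leq_addl.
elim: i {n z} => [_|i IHi lt_im] n z hz.
  have {}hz : koszul_diff u z = 0.
    apply/ffunP => T; rewrite !ffunE big1 // => l lT.
    have [_ zi] := hz; rewrite (zi _ l) ?scaler0 ?setU11 // addn0.
    exact: ltn_ord.
  by rewrite hz koszul_diff0.
pose l := rev_ord (Ordinal lt_im).
have l_i : (l + i.+1 = m)%N by rewrite /= subnK.
have [z' [z'' [hz' hz'' ->]]] := tail_split l_i hz.
case: n {z hz} hz' hz'' => [|n] hz' hz''.
  by rewrite hz'' wedge0 addr0 (IHi (ltnW lt_im) _ _ hz').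
rewrite koszul_diffD (wedge_diff u l_i hz'') !koszul_diffD koszul_diffZ koszul_diffN.
rewrite (IHi (ltnW lt_im) _ _ hz') (wedge_diff u l_i (tail_diff_pred u hz'')).
by rewrite (IHi (ltnW lt_im) _ _ hz'') wedge0 add0r subr0 subrr.
Qed.

Definition koszul_map (M M' : lmodType A) (phi : M -> M') (x : koszul m M) : koszul m M' :=
  [ffun S : {set 'I_m} => phi (x S)].

Lemma koszul_map_diff (M M' : lmodType A) (phi : M -> M') (x : koszul m M) :
  (forall a x y, phi (a *: x + y) = a *: phi x + phi y) ->
  koszul_diff u (koszul_map phi x) = koszul_map phi (koszul_diff u x).
Proof.
move=> phiP; have phi0 : phi 0 = 0.
  by have := phiP (-1) 0 0; rewrite !scaleN1r !addNr.
apply/ffunP => T; rewrite !ffunE.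
elim/big_rec2: _ => [|i y1 y2 _ ->]; first by rewrite phi0.
by rewrite phiP ffunE.
Qed.

Section Homotopy.
Variables (M : lmodType A) (l : 'I_m).
Local Notation below S i := #|[set t in S | (t < i)%N]|.

(** Multiplication by e_l with l in any position, hence with a sign: it is the homotopy showing that
    u_l acts as 0 on Koszul homology. *)
Definition homotopy (z : koszul m M) : koszul m M :=
  [ffun S : {set 'I_m} => if l \in S then (-1) ^+ below S l *: z (S :\ l) else 0].

Lemma below_setU1 (S : {set 'I_m}) (i t : 'I_m) : t \notin S ->
  below (t |: S) i = ((t < i)%N + below S i)%N.
Proof.
move=> tS; rewrite (cardsD1 t) !inE eqxx /=; congr (_ + #|pred_of_set _|)%N.
apply/setP => s; rewrite !inE; case: eqVneq => //= ->.
by rewrite (negbTE tS).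
Qed.

Lemma koszul_homotopy (z : koszul m M) :
  koszul_diff u (homotopy z) = u l *: z - homotopy (koszul_diff u z).
Proof.
apply/ffunP => T; rewrite !ffunE.
have sign2 n : ((-1) ^+ n * (-1) ^+ n = 1 :> A).
  by rewrite -exprD addnn -mul2n exprM sqrrN expr1n expr1n.
have [lT|lT] := boolP (l \in T); last first.
  rewrite subr0 (bigD1 l) //= big1 ?addr0 => [|i /andP[iT ne_l]].
    rewrite !ffunE setU11 setU1K // scalerA below_setU1 // ltnn.
    by rewrite mulrAC sign2 mul1r.
  by rewrite ffunE !inE eq_sym (negbTE ne_l) (negbTE lT) scaler0.
rewrite [in RHS](bigD1 l) ?inE ?eqxx //= finset.setD1K // scalerDr scalerA mulrA.
have lT' : l \notin T :\ l by rewrite !inE eqxx.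
have bl (i : 'I_m) : below T i = ((l < i)%N + below (T :\ l) i)%N.
  rewrite -[in LHS](finset.setD1K lT). exact: (below_setU1 i lT').
rewrite bl ltnn sign2 mul1r opprD addrA subrr add0r scaler_sumr -sumrN.
apply: eq_big => i.
  by rewrite !inE negb_and negbK; have [->|] := eqVneq i l; rewrite ?lT ?andbF ?andbT.
move=> iT; have ne_l : i != l by apply: contraNneq iT => ->.
rewrite ffunE !inE lT orbT.
have -> : (i |: T) :\ l = i |: (T :\ l).
  by apply/setP => t; rewrite !inE; have [->|] := eqVneq t l; rewrite // eq_sym (negbTE ne_l).
rewrite !scalerA -scaleNr below_setU1 // !bl ltnn.
congr (_ *: _); rewrite !exprD; move: (below (T :\ l) i) (below (T :\ l) l) => a b.
have [lt_l|gt_l|/val_inj E] := ltngtP l i; last by rewrite E eqxx in ne_l.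
  by rewrite expr1 expr0; ring.
by rewrite expr1 expr0; ring.
Qed.

Lemma homotopy_deg n z : koszul_deg n z -> koszul_deg n.+1 (homotopy z).
Proof.
move=> zn S hS; rewrite ffunE; case: ifP => // lS.
rewrite zn ?scaler0 //; apply: contra hS => /eqP <-.
by rewrite (cardsD1 l S) lS.
Qed.
End Homotopy.
End KoszulFacts.

Section Grade.
Variables (A : comUnitRingType) (m : nat) (u : 'I_m -> A) (I : submodClosed A^o).
Hypothesis gen_u : @generates A A^o [set` I] _ u.
Variable G : free_resolution (quot_mod I).

Lemma resolution_dif2 n : dif G n.+1 *m dif G n = 0.
Proof.
apply/row_matrixP => i; rewrite row_mul row0; apply/dif_exact.
by exists (row i 1%:M); rewrite -row_mul mul1mx.
Qed.

Section Embedding.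
Variable M : lmodType A.
Local Notation V := {ffun 'I_m -> M}.

(* The embedding z |-> (u_l z)_l of M into M^m is zero on H(u, -), so its cokernel
   allows dimension shifting without choosing a regular element. *)
Definition multiples (z : M) : V := [ffun l => u l *: z].

Lemma multiplesP a x y : multiples (a *: x + y) = a *: multiples x + multiples y.
Proof. by apply/ffunP => l; rewrite !ffunE scalerDr !scalerA mulrC. Qed.

Definition multiples_image : {pred V} := fun v => `[< exists z, v = multiples z >].

Lemma multiples_image_closed : submod_closed multiples_image.
Proof.
split=> [|a _ _ /asboolP[x ->] /asboolP[y ->]]; apply/asboolP.
  by exists 0; apply/ffunP => l; rewrite !ffunE scaler0.
by exists (a *: x + y); rewrite multiplesP.
Qed.

HB.instance Definition _ :=
  GRing.isSubmodClosed.Build A V multiples_image multiples_image_closed.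

Definition multiples_quot : lmodType A := quot_mod multiples_image.

Hypothesis ext0 : ~ ext_neq0 M G 0.

(** If all u_l kill z, then 1 |-> z is a homomorphism from A / I to M. Its cocycle is (a_j z)_j,
    with a_j a representative of the image of the j-th basis vector of G_0; so all a_j z vanish, and
    1 is a combination of the a_j modulo I. *)
Lemma multiples_inj z : multiples z = 0 -> z = 0.
Proof.
move=> /ffunP z0; have Iz a : (a : A^o) \in I -> a *: z = 0.
  move=> Ia; have : [set` I] (a : A^o) by [].
  rewrite gen_u => -[c ->]; rewrite scaler_suml big1 // => l _.
  by rewrite -scalerA; have := z0 l; rewrite !ffunE => ->; rewrite scaler0.
have /choice[a aP] : forall j, exists a : A^o, quot_pi I a = aug G (delta_mx 0 j).
  by move=> j; apply: quot_pi_surj.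
have pi_sum n (c : 'I_n -> A) (b : 'I_n -> A^o) :
    quot_pi I (\sum_j c j *: b j) = \sum_j c j *: quot_pi I (b j).
  elim/big_rec2: _ => [|j v w _ <-]; last exact: quot_pi_linear.
  by apply/quot_pi_eq0; apply: rpred0.
have aug_row (y : 'rV_(rk G 0)) : aug G y = quot_pi I (\sum_j y 0 j *: a j).
  rewrite pi_sum {1}[y]row_sum_delta linear_sum /=.
  by apply: eq_bigr => j _; rewrite linearZ aP.
have az j : a j *: z = 0.
  apply: contrapT => az; apply: ext0; exists (fun j => (a j : A) *: z).
  split=> [i|/(_ j)//].
  rewrite /hom_diff; under eq_bigr do rewrite scalerA.
  rewrite -scaler_suml; apply: Iz; apply/quot_pi_eq0.
  have := aug_row (row i (dif G 0)); under eq_bigr do rewrite mxE.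
  move=> <-; apply/aug_exact; exists (row i 1%:M).
  by rewrite -row_mul mul1mx.
have [y y1] := aug_surj G (quot_pi I 1).
have Iy : (1 - \sum_j y 0 j *: a j : A^o) \in I.
  apply/quot_pi_eq0; rewrite addrC -scaleN1r quot_pi_linear -aug_row y1.
  by rewrite scaleN1r addNr.
have := Iz _ Iy; rewrite scalerBl scale1r scaler_suml big1 ?subr0 // => j _.
by rewrite -scalerA az scaler0.
Qed.

(** In the long exact sequence of 0 -> M -> M^m -> M^m / M -> 0, Ext^i of the cokernel lies between
    Ext^i of M^m and Ext^(i+1) of M, both zero; the chase is done on cocycles. *)
Lemma multiples_quot_ext g :
  (forall i, (i < g.+1)%N -> ~ ext_neq0 M G i) ->
  forall i, (i < g)%N -> ~ ext_neq0 multiples_quot G i.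
Proof.
move=> extM i lt_ig [x [xD]]; apply.
have extMb j (y : 'I_(rk G j) -> M) : (j < g.+1)%N -> (forall b, hom_diff y b = 0) ->
    hom_boundary y.
  by move=> lt_jg yD; apply: contrapT => yB; apply: (extM j) => //; exists y.
pose qpi : V -> multiples_quot := quot_pi multiples_image.
have qpiP a v w : qpi (a *: v + w) = a *: qpi v + qpi w by apply: quot_pi_linear.
have qpi0 v : qpi v = 0 <-> exists z, v = multiples z.
  rewrite quot_pi_eq0; split; first by move/asboolP.
  by move=> h; apply/asboolP.
have qpi_sum n (c : 'I_n -> A) (b : 'I_n -> V) :
    qpi (\sum_j c j *: b j) = \sum_j c j *: qpi (b j).
  elim/big_rec2: _ => [|j v w _ <-]; last exact: qpiP.
  by apply/quot_pi_eq0; apply: rpred0.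
have mul_sum n (c : 'I_n -> A) (b : 'I_n -> M) :
    multiples (\sum_j c j *: b j) = \sum_j c j *: multiples (b j).
  elim/big_rec2: _ => [|j v w _ <-]; last exact: multiplesP.
  by apply/ffunP => l; rewrite !ffunE scaler0.
have /choice[xh xhP] : forall b, exists v, qpi v = x b.
  by move=> b; apply: quot_pi_surj.
(* The connecting map: y represents the image of the class of x in Ext^(i+1) of M. *)
have /choice[y yP] : forall b, exists z, hom_diff xh b = multiples z.
  move=> b; apply/qpi0; rewrite /hom_diff qpi_sum -[RHS](xD b).
  by apply: eq_bigr => j _; rewrite xhP.
have yD c : hom_diff y c = 0.
  apply: multiples_inj; rewrite /hom_diff mul_sum.
  under eq_bigr do rewrite -yP /hom_diff scaler_sumr.
  rewrite exchange_big big1 //= => j _.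
  under eq_bigr do rewrite scalerA.
  rewrite -scaler_suml; have /matrixP/(_ c j) := resolution_dif2 i.
  by rewrite !mxE => ->; rewrite scale0r.
have [y' y'E] := extMb i.+1 y lt_ig yD.
have cyc l b : hom_diff (fun j => xh j l - u l *: y' j) b = 0.
  rewrite /hom_diff; under eq_bigr do rewrite scalerBr.
  rewrite sumrB; have /ffunP/(_ l) := yP b; rewrite ffunE y'E => yl.
  have -> : \sum_j dif G i b j *: xh j l = u l *: hom_diff y' b.
    by rewrite -yl /hom_diff sum_ffunE; apply: eq_bigr => j _; rewrite ffunE.
  rewrite scaler_sumr; apply/eqP; rewrite subr_eq0; apply/eqP.
  by apply: eq_bigr => j _; rewrite !scalerA mulrC.
have {cyc}bd l := extMb i _ (ltnW lt_ig) (cyc l).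
case: i lt_ig x xD xh xhP y yP yD y' y'E bd => [|i] lt_ig x xD xh xhP y yP yD y' y'E bd.
  move=> b; rewrite -xhP; apply/qpi0; exists (y' b); apply/ffunP => l.
  by rewrite ffunE; apply/eqP; rewrite -subr_eq0; apply/eqP; apply: bd.
have /choice[w wP] := bd.
exists (fun a => qpi [ffun l => w l a]) => b.
rewrite /hom_diff -qpi_sum -xhP; apply/eqP; rewrite -subr_eq0 -scaleN1r addrC -qpiP.
apply/eqP/qpi0; exists (y' b); apply/ffunP => l.
rewrite !ffunE scaleN1r sum_ffunE; under eq_bigr do rewrite !ffunE.
by have := wP l b; rewrite /hom_diff => <-; rewrite opprB subrK.
Qed.

End Embedding.

(** Induction on g: H_j of M maps to zero in H_j of M^m, so it is an image of H_(j+1) of the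
    cokernel, which vanishes by induction. For g = 0 no set has more than m elements. *)
Lemma koszul_grade_vanishing g (M : lmodType A) :
  (forall i, (i < g)%N -> ~ ext_neq0 M G i) ->
  forall j (z : koszul m M), (m < j + g)%N -> koszul_deg j z -> koszul_diff u z = 0 ->
  exists2 y, koszul_deg j.+1 y & z = koszul_diff u y.
Proof.
elim: g M => [|g IHg] M extM j z.
  rewrite addn0 => lt_mj zj _; exists 0; first by move=> S _; rewrite ffunE.
  rewrite koszul_diff0; apply/ffunP => S; rewrite ffunE zj // neq_ltn.
  by rewrite (leq_ltn_trans _ lt_mj) // (leq_trans (max_card _)) ?card_ord.
move=> lt_m zj dz; have injM := multiples_inj (extM 0%N isT).
have IH := IHg _ (multiples_quot_ext (extM 0%N isT) extM).
pose qpi : {ffun 'I_m -> M} -> multiples_quot M := quot_pi (@multiples_image M).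
have qpiP a v w : qpi (a *: v + w) = a *: qpi v + qpi w by apply: quot_pi_linear.
have qpi0 v : qpi v = 0 <-> exists z, v = multiples z.
  rewrite quot_pi_eq0; split; first by move/asboolP.
  by move=> h; apply/asboolP.
have mulP a x y := multiplesP (M := M) a x y.
(* The homotopies for all l together: d w is the image of z in K(u, M^m), so w becomes a cycle in
   the cokernel. *)
pose w : koszul m {ffun 'I_m -> M} :=
  [ffun S : {set 'I_m} => [ffun l => homotopy l z S]].
have wj : koszul_deg j.+1 w.
  by move=> S hS; apply/ffunP => l; rewrite !ffunE -[RHS](homotopy_deg l zj hS) ffunE.
have dw : koszul_diff u w = koszul_map (@multiples M) z.
  apply/ffunP => S; apply/ffunP => l.
  have /ffunP/(_ S) := koszul_homotopy u l z; rewrite dz.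
  have -> : homotopy l (0 : koszul m M) = 0.
    by apply/ffunP => T; rewrite !ffunE scaler0 if_same.
  rewrite subr0 ![in X in X -> _]ffunE => E; rewrite !ffunE sum_ffunE -E.
  by apply: eq_bigr => i _; rewrite !ffunE.
have [|||v0 v0j wE] := IH j.+1 (koszul_map qpi w).
- by rewrite addSnnS.
- by move=> S hS; rewrite ffunE wj //; apply/quot_pi_eq0; apply: rpred0.
- rewrite koszul_map_diff // dw; apply/ffunP => S; rewrite !ffunE.
  by apply/qpi0; exists (z S).
have /choice[v1 v1P] : forall S, exists v, qpi v = v0 S /\ (#|S| != j.+2 -> v = 0).
  move=> S; have [S0|S0] := eqVneq #|S| j.+2.
    by have [v vE] := quot_pi_surj (v0 S : quot_mod (@multiples_image M)); exists v.
  by exists 0; rewrite v0j //; split=> //; apply/quot_pi_eq0; apply: rpred0.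
pose v : koszul m {ffun 'I_m -> M} := [ffun S => v1 S].
have vj : koszul_deg j.+2 v by move=> S hS; rewrite ffunE; apply: (v1P S).2.
have /choice[y yP] : forall S, exists y, w S - koszul_diff u v S = multiples y.
  move=> S; apply/qpi0; rewrite -scaleN1r addrC qpiP.
  have /ffunP/(_ S) := wE; rewrite ffunE => ->.
  have -> : v0 = koszul_map qpi v by apply/ffunP => T; rewrite !ffunE (v1P T).1.
  by rewrite koszul_map_diff // [X in _ + X]ffunE scaleN1r addNr.
have dvj : koszul_deg j.+1 (koszul_diff u v).
  have := @tail_koszul_diff A m u _ m j.+1 v; case=> //; split=> // S l _.
  by rewrite ltnNge leq_addl.
exists [ffun S : {set 'I_m} => y S].
  move=> S hS; rewrite ffunE; apply: injM.
  by rewrite -yP wj // dvj // subrr.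
have yE : koszul_map (@multiples M) [ffun S : {set 'I_m} => y S] = w - koszul_diff u v.
  by apply/ffunP => S; rewrite !ffunE -yP !ffunE.
have E : koszul_map (@multiples M) (koszul_diff u [ffun S : {set 'I_m} => y S]) =
    koszul_map (@multiples M) z.
  rewrite -koszul_map_diff // yE koszul_diffD koszul_diffN (koszul_diff2 u vj).
  by rewrite subr0.
apply/ffunP => S; apply/eqP; rewrite -subr_eq0; apply/eqP/injM.
have /ffunP/(_ S) := E; rewrite ffunE [RHS]ffunE => ES.
by rewrite addrC -scaleN1r mulP ES scaleN1r addNr.
Qed.

End Grade.

(** * Growth of Betti numbers *)

Lemma quotient_hom (Q : comUnitRingType) (J : set Q) : ideal J -> ~ J 1 ->
  exists (B : comNzRingType) (q : {rmorphism Q -> B}),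
    (forall b, exists t, q t = b) /\ (forall t, q t = 0 <-> J t).
Proof.
move=> [J0 JD JM] J1.
pose S : Q -> bool := fun t => `[< J t >].
have hS : idealr_closed S.
  split.
  - exact/asboolP.
  - by apply/negP => /asboolP.
  - by move=> a x y /asboolP Jx /asboolP Jy; apply/asboolP; apply: JD => //; apply: JM.
pose mS := isIdealr.Build Q S hS.
pose I : idealr Q := HB.pack S mS.
exists {ideal_quot I}, (\pi_({ideal_quot I})%qT : {rmorphism Q -> {ideal_quot I}}).
split.
  by move=> b; exists (repr b); apply: reprK.
move=> t; have := Quotient.idealrBE I t 0; rewrite subr0 => E.
have -> : J t <-> t \in I by split=> [Jt|/asboolP//]; apply/asboolP.
rewrite E -(rmorph0 (\pi_({ideal_quot I})%qT : {rmorphism Q -> {ideal_quot I}})).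
by split=> /eqP.
Qed.

(** * Complexes modulo an ideal and a regular element *)

Section ModuloIdeal.
Variable Q : comUnitRingType.
Implicit Types (J : set Q) (C : precomplex Q).

(** Matrices stay over Q and only the conditions are read modulo J, so one complex can be studied
    over successive quotients; quotient rings appear only inside proofs. *)
Definition mx_in J m n (M : 'M[Q]_(m, n)) : Prop := forall i j, J (M i j).

Definition complex_mod J C : Prop := forall n, mx_in J (cdiff C n *m pdiff C n).

Definition exact_mod J C n : Prop := forall x : 'rV[Q]_(crk C n),
  mx_in J (x *m pdiff C n) -> exists y, mx_in J (x - y *m cdiff C n).

Definition ideal_add J (x : Q) : set Q := [set t | exists a, J (t - x * a)].

Lemma mx_in_map J (B : comNzRingType) (q : {rmorphism Q -> B}) m n (M : 'M[Q]_(m, n)) :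
  (forall t, q t = 0 <-> J t) -> mx_in J M <-> map_mx q M = 0.
Proof.
move=> qJ; split=> [MJ|/matrixP M0 i j].
  by apply/matrixP => i j; rewrite !mxE; apply/qJ.
by apply/qJ; have := M0 i j; rewrite !mxE.
Qed.

Lemma mx_in_add J x m n (M : 'M[Q]_(m, n)) : mx_in (ideal_add J x) M ->
  exists N, mx_in J (M - x *: N).
Proof.
move=> MJ; have /choice[a aP] : forall ij : 'I_m * 'I_n, exists a, J (M ij.1 ij.2 - x * a).
  by move=> [i j]; apply: MJ.
exists (\matrix_(i, j) a (i, j)) => i j; rewrite !mxE; exact: (aP (i, j)).
Qed.

Lemma mx_lift (B : comNzRingType) (q : Q -> B) m n (M : 'M[B]_(m, n)) :
  (forall b, exists t, q t = b) -> exists L : 'M[Q]_(m, n), map_mx q L = M.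
Proof.
move=> q_surj; have /choice[g gP] : forall ij : 'I_m * 'I_n, exists t, q t = M ij.1 ij.2.
  by move=> ij; apply: q_surj.
by exists (\matrix_(i, j) g (i, j)); apply/matrixP => i j; rewrite !mxE gP.
Qed.

Section Regular.
Variables (J : set Q) (x : Q) (C : precomplex Q).
Hypotheses (hJ : ideal J) (J1 : ~ J 1) (x_reg : forall a, J (x * a) -> J a).

Lemma mx_regular (B : comNzRingType) (q : {rmorphism Q -> B}) m n (M : 'M[Q]_(m, n)) :
  (forall t, q t = 0 <-> J t) -> q x *: map_mx q M = 0 -> map_mx q M = 0.
Proof.
move=> qJ /matrixP E; apply/matrixP => i j; rewrite !mxE; apply/qJ/x_reg/qJ.
by have := E i j; rewrite !mxE rmorphM.
Qed.

Lemma reduce_complex : complex_mod J C -> complex_mod (ideal_add J x) C.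
Proof. by move=> CJ n i j; exists 0; rewrite mulr0 subr0; apply: CJ. Qed.

(** From 0 -> C -> C -> C / x C -> 0 over Q / J: the homology of C / x C in degree n + 1 lies
    between that of C in degrees n + 1 and n. *)
Lemma reduce_exact n : complex_mod J C -> exact_mod J C n -> exact_mod J C n.+1 ->
  exact_mod (ideal_add J x) C n.+1.
Proof.
move=> CJ exn exn1 z /mx_in_add[w zw].
have [B [q [q_surj qJ]]] := quotient_hom hJ J1.
have qin m' n' (M : 'M_(m', n')) := mx_in_map M qJ.
have zE : map_mx q (z *m cdiff C n) = q x *: map_mx q w.
  by apply/eqP; rewrite -subr_eq0 -map_mxZ -map_mxB; apply/eqP/qin.
have CD n' : map_mx q (cdiff C n' *m pdiff C n') = 0 by apply/qin.
have [|v /qin wv] := exn w.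
  apply/qin/(mx_regular qJ).
  rewrite map_mxM scalemxAl -zE -map_mxM -mulmxA.
  by rewrite map_mxM CD mulmx0.
have [|y /qin zy] := exn1 (z - x *: v).
  apply/qin; rewrite /= mulmxBl map_mxB zE -scalemxAl map_mxZ -scalerBr -map_mxB.
  by rewrite wv scaler0.
exists y => i j; exists (v i j).
have /matrixP/(_ i j) := zy; rewrite !mxE => /qJ.
by rewrite addrAC.
Qed.

(* With T the Eisenbud operator of x, the twisted cone computes over Q / J what C
   computes over Q / (J + x). *)
Variable T : forall n, 'M[Q]_(crk C n.+2, crk C n).
Hypothesis T_E : forall n, mx_in J (cdiff C n.+1 *m cdiff C n - x *: T n).

Definition ptwist n : 'M[Q]_(crk C n.+1, prev (crk C) n) :=
  match n with 0 => 0 | n'.+1 => T n' end.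

(** The cone of x, except that d d = x T is not zero modulo J; the corner - T compensates, both
    diagonal blocks of the square being d d - x T. *)
Definition twisted : precomplex Q :=
  @Precomplex Q (fun n => crk C n + prev (crk C) n)%N
    (fun n => block_mx (cdiff C n) (- ptwist n) x%:M (- pdiff C n)).

Section Hom.
Variables (B : comNzRingType) (q : {rmorphism Q -> B}).
Hypothesis qJ : forall t, q t = 0 <-> J t.
Local Notation "M ^q" := (map_mx q M) (at level 2).

Lemma T_diff n : (cdiff C n.+1)^q *m (cdiff C n)^q = q x *: (T n)^q.
Proof.
by apply/eqP; rewrite -subr_eq0 -map_mxM -map_mxZ -map_mxB; apply/eqP/mx_in_map.
Qed.

Lemma ptwist_diff n : (cdiff C n)^q *m (pdiff C n)^q = q x *: (ptwist n)^q.
Proof. by case: n => [|n]; [rewrite !map_mx0 mulmx0 scaler0 | exact: T_diff]. Qed.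

Lemma T_comm n : (cdiff C n.+2)^q *m (T n)^q = (T n.+1)^q *m (cdiff C n)^q.
Proof.
apply/eqP; rewrite -subr_eq0 -!map_mxM -map_mxB; apply/eqP/(mx_regular qJ).
rewrite map_mxB !map_mxM scalerBr scalemxAr scalemxAl -!T_diff.
by rewrite mulmxA subrr.
Qed.

Lemma ptwist_comm n : (cdiff C n.+1)^q *m (ptwist n)^q = (T n)^q *m (pdiff C n)^q.
Proof. by case: n => [|n]; [rewrite !map_mx0 !mulmx0 | exact: T_comm]. Qed.

End Hom.

Lemma twisted_complex : complex_mod J twisted.
Proof.
have [B [q [q_surj qJ]]] := quotient_hom hJ J1.
case=> [|n]; apply/(mx_in_map _ qJ); first by rewrite /= mulmx0 map_mx0.
rewrite map_mxM /= !map_block_mx mulmx_block.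
rewrite !map_mxN !mulmxN !mulNmx !map_scalar_mx !mul_scalar_mx !mul_mx_scalar.
by rewrite (T_diff qJ) (ptwist_comm qJ) (ptwist_diff qJ) !opprK !addNr !subrr block_mx0.
Qed.

Lemma twisted_exact n : exact_mod (ideal_add J x) C n.+1 -> exact_mod J twisted n.+1.
Proof.
have [B [q [q_surj qJ]]] := quotient_hom hJ J1.
move=> exC z /(mx_in_map _ qJ); rewrite -[z]hsubmxK; move: (lsubmx z) (rsubmx z) => a b {z}.
rewrite map_mxM /= map_row_mx map_block_mx mul_row_block => /eqP.
rewrite row_mx_eq0 => /andP[/eqP aD _].
rewrite map_scalar_mx mul_mx_scalar in aD.
have [|w /mx_in_add[c awc]] := exC a.
  move=> i j; exists (- b i j); apply/qJ.
  have /matrixP/(_ i j) := aD; rewrite -map_mxM -map_mxZ -map_mxD !mxE.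
  by rewrite mulrN opprK.
have aE : map_mx q a = map_mx q w *m map_mx q (cdiff C n.+1) + q x *: map_mx q c.
  apply/eqP; rewrite -subr_eq0 opprD addrA -map_mxM -map_mxZ -!map_mxB.
  exact/eqP/(mx_in_map _ qJ).
exists (row_mx w c); apply/(mx_in_map _ qJ).
rewrite map_mxB map_mxM /= !map_row_mx map_block_mx mul_row_block.
apply/eqP; rewrite subr_eq0; apply/eqP; congr row_mx.
  by rewrite map_scalar_mx mul_mx_scalar.
rewrite !map_mxN !mulmxN -opprD; apply/eqP; rewrite -addr_eq0.
(* The equation for the second component follows from the first one only after multiplication by x,
   which is then cancelled. *)
rewrite -!map_mxM -!map_mxD; apply/eqP/(mx_regular qJ).
rewrite !map_mxD !map_mxM !scalerDr scalemxAr -(T_diff qJ) mulmxA.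
rewrite scalemxAl -mulmxDl -aE addrC; exact: aD.
Qed.

Section Field.
Variables (k : fieldType) (sigma : {rmorphism Q -> k}).
Hypotheses (sigmaJ : forall t, J t -> sigma t = 0) (sigma_x : sigma x = 0).

Lemma complex_mod_diff2 C' : complex_mod J C' -> diff2_eq0 (pmap sigma C').
Proof.
move=> CJ n; rewrite pdiff_map /= -map_mxM; apply/matrixP => i j; rewrite !mxE.
have := sigmaJ (CJ n i j); by rewrite !mxE.
Qed.

Lemma T_comm_sigma n : map_mx sigma (cdiff C n.+2) *m map_mx sigma (T n) =
  map_mx sigma (T n.+1) *m map_mx sigma (cdiff C n).
Proof.
have [B [q [q_surj qJ]]] := quotient_hom hJ J1.
apply/eqP; rewrite -subr_eq0 -!map_mxM -map_mxB; apply/eqP/matrixP => i j.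
rewrite [LHS]mxE [RHS]mxE; apply: sigmaJ.
suff : mx_in J (cdiff C n.+2 *m T n - T n.+1 *m cdiff C n) by apply.
by apply/(mx_in_map _ qJ); rewrite map_mxB !map_mxM (T_comm qJ) subrr.
Qed.

(* Long exact sequence of the operator T on Ext. *)
Lemma hdim_twisted n : diff2_eq0 (pmap sigma C) ->
  (hdim (pmap sigma C) n.+2 <= hdim (pmap sigma C) n + hdim (pmap sigma twisted) n.+2)%N.
Proof.
move=> C2; apply: (@hdim_exact k (pmap sigma C) n (pmap sigma C) n.+2
  (pmap sigma twisted) n.+2 (map_mx sigma (T n)) (col_mx 1%:M 0)) => //.
- exact: complex_mod_diff2 twisted_complex.
- move=> y [w ->]; case: n w {y} => [|n] w.
    by exists 0; rewrite /= mul0mx !mulmx0.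
  by exists (map_mx sigma (T n) *m w); rewrite /= !mulmxA T_comm_sigma.
- move=> y yZ; have {}yZ : map_mx sigma (cdiff C n.+2) *m y = 0 := yZ.
  rewrite /cocyc mul_col_mx mul1mx mul0mx /= map_block_mx mul_block_col yZ.
  by rewrite !mulmx0 addr0 map_scalar_mx /= sigma_x mul_scalar_mx scale0r addr0 col_mx0.
- move=> y yZ [w]; rewrite mul_col_mx mul1mx mul0mx /= -[w]vsubmxK.
  move: (usubmx w) (dsubmx w) => w1 w2; rewrite map_block_mx mul_block_col.
  move=> /eq_col_mx[yE /esym].
  rewrite !map_mxN !mulNmx map_scalar_mx /= sigma_x mul_scalar_mx scale0r add0r.
  move=> /eqP; rewrite oppr_eq0 => /eqP w2Z.
  exists (- w2); first by rewrite /cocyc mulmxN [_ *m w2]w2Z oppr0.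
  by exists w1; rewrite yE map_mxN mulNmx mulmxN opprK subrK.
Qed.

End Field.
End Regular.
End ModuloIdeal.

Section Growth.
Variables (Q : comUnitRingType) (k : fieldType) (sigma : {rmorphism Q -> k}).
Hypothesis Q_local : local_ring Q.
Hypothesis sigma_surj : forall c, exists t, sigma t = c.
Hypothesis sigma_ker : forall t, sigma t = 0 <-> max_ideal (t : Q).
Implicit Types (C : precomplex Q).

Let m_prime : prime_ideal (@max_ideal Q).
Proof. by case: Q_local => _ /max_ideal_prime. Qed.

Let m_ideal : ideal (@max_ideal Q). Proof. by case: m_prime. Qed.

Lemma partial_span_ideal d (g : 'I_d -> Q) i : ideal (partial_span g i).
Proof. exact: lin_span_ideal. Qed.

Lemma partial_span_max d (g : 'I_d -> Q) i :
  (forall j, max_ideal (g j)) -> partial_span g i `<=` @max_ideal Q.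
Proof. by move=> gm; apply: (lin_span_min (R := Q)) => // j _; apply: gm. Qed.

Lemma partial_span_proper d (g : 'I_d -> Q) i :
  (forall j, max_ideal (g j)) -> ~ partial_span g i 1.
Proof. by move=> gm /(partial_span_max gm); case: m_prime. Qed.

Lemma partial_spanS d (g : 'I_d -> Q) (i : 'I_d) :
  partial_span g i.+1 = ideal_add (partial_span g i) (g i).
Proof.
have [p0 pD pM] := partial_span_ideal g i.
have [q0 qD qM] := partial_span_ideal g i.+1.
apply/seteqP; split.
  apply: (lin_span_min (R := Q)).
    split.
    - by exists 0; rewrite mulr0 subr0.
    - move=> x y [a xa] [b yb]; exists (a + b).
      by rewrite mulrDr opprD addrACA; apply: pD.
    - by move=> c x [a xa]; exists (c * a); rewrite mulrCA -mulrBr; apply: pM.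
  move=> j /=; rewrite ltnS leq_eqVlt => /orP[/eqP/val_inj->|lt_j].
    by exists 1; rewrite mulr1 subrr.
  by exists 0; rewrite mulr0 subr0; apply: (lin_span_gen (R := Q)).
move=> x [a xa]; rewrite -(subrK (g i * a) x); apply: qD; last first.
  by rewrite mulrC; apply: qM; apply: (lin_span_gen (R := Q)) => /=.
apply: (lin_span_min (R := Q)) xa; first exact: partial_span_ideal.
by move=> j /= lt_j; apply: (lin_span_gen (R := Q)); rewrite /= ltnW // ltnS.
Qed.

Lemma partial_span_full d (g : 'I_d -> Q) :
  partial_span g d = @lin_span Q Q^o _ predT g.
Proof.
apply/seteqP; split; apply: (lin_span_min (R := Q));
  try exact: lin_span_ideal; move=> j _; apply: (lin_span_gen (R := Q)) => //=.
Qed.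

Lemma partial_span0 d (g : 'I_d -> Q) x : partial_span g 0 x -> x = 0.
Proof. by move=> [c ->]; rewrite big_pred0. Qed.

(** Each division by a g_i costs one degree of exactness, so modulo m = (g_1, ..., g_d) exactness
    holds above degree d: the projective dimension over Q is at most d. *)
Lemma reduce_regular d (g : 'I_d -> Q) C :
  (forall j, max_ideal (g j)) ->
  (forall (i : 'I_d) a, partial_span g i (g i * a) -> partial_span g i a) ->
  complex_mod (partial_span g 0) C ->
  (forall n, (0 < n)%N -> exact_mod (partial_span g 0) C n) ->
  forall i, (i <= d)%N -> complex_mod (partial_span g i) C /\
    forall n, (i < n)%N -> exact_mod (partial_span g i) C n.
Proof.
move=> gm greg C0 ex0; elim=> [//|i IHi lt_id].
have [Ci exi] := IHi (ltnW lt_id).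
have -> : partial_span g i.+1 = ideal_add (partial_span g i) (g (Ordinal lt_id)).
  exact: (partial_spanS g (Ordinal lt_id)).
have hJ := partial_span_ideal g i.
split; first exact: reduce_complex.
case=> // n lt_in; apply: reduce_exact => //.
- exact: partial_span_proper.
- by move=> a; apply: (greg (Ordinal lt_id)).
- exact: exi.
- by apply: exi; apply: ltnW.
Qed.

(** Over k a pseudo-inverse splits the complex at n, and the splitting turns exactness for row
    vectors into exactness for columns. *)
Lemma exact_mod_max_hdim0 C n : exact_mod (@max_ideal Q) C n ->
  hdim (pmap sigma C) n = 0%N.
Proof.
move=> exC; apply: hdim_eq0 => x xZ.
set D := pdiff (pmap sigma C) n; pose s := pinvmx D.
have DsD : D *m s *m D = D by apply: mulmxKpV.
have [t tE] : exists t, t *m cdiff (pmap sigma C) n = 1%:M - D *m s.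
  have ex (z : 'rV[k]_(crk C n)) : z *m D = 0 -> exists y, z = y *m cdiff (pmap sigma C) n.
    have [z' <-] := mx_lift z sigma_surj; rewrite /D pdiff_map -map_mxM.
    move=> /(mx_in_map _ sigma_ker)/exC[y /(mx_in_map _ sigma_ker)].
    rewrite map_mxB map_mxM => /eqP; rewrite subr_eq0 => /eqP->.
    by exists (map_mx sigma y).
  have /choice[g gP] : forall i, exists y,
      row i (1%:M - D *m s) = y *m cdiff (pmap sigma C) n.
    by move=> i; apply: ex; rewrite -row_mul mulmxBl mul1mx DsD subrr row0.
  by exists (\matrix_i g i); apply/row_matrixP => i; rewrite row_mul rowK gP.
exists (s *m x); rewrite mulmxA -/D.
apply/eqP; rewrite -subr_eq0 -{1}[x]mul1mx -mulmxBl -tE -mulmxA.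
by rewrite [_ *m x]xZ mulmx0.
Qed.

Variables (d : nat) (g : 'I_d -> Q).
Hypothesis g_gen : @generates Q Q^o (@max_ideal Q) _ g.
Hypothesis g_reg : forall (i : 'I_d) a, partial_span g i (g i * a) -> partial_span g i a.

Variables (r : nat) (f : 'I_r -> Q).
Hypothesis f_max : forall i, max_ideal (f i).
Hypothesis f_reg : forall (i : 'I_r) a, partial_span f i (f i * a) -> partial_span f i a.

Lemma hdim_growth i C : (i <= r)%N -> complex_mod (partial_span f i) C ->
  (forall n, (0 < n)%N -> exact_mod (partial_span f i) C n) ->
  exists c, forall n, (hdim (pmap sigma C) n <= c * n.+1 ^ i)%N.
Proof.
have gm j : max_ideal (g j).
  by have : max_ideal (g j) by rewrite g_gen; apply: (lin_span_gen (R := Q)).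
elim: i C => [|i IHi] C le_ir Ci exi.
  have eq0 : partial_span f 0 = partial_span g 0.
    apply/seteqP; split=> x /partial_span0->.
      by case: (partial_span_ideal g 0).
    by case: (partial_span_ideal f 0).
  rewrite eq0 in Ci exi.
  have [_ exd] := reduce_regular gm g_reg Ci exi (leqnn d).
  rewrite partial_span_full -g_gen in exd.
  (* The numbers vanish above d, so the sum of the remaining ones bounds each of them. *)
  exists (\sum_(j < d.+1) hdim (pmap sigma C) j)%N => n; rewrite expn0 muln1.
  have [lt_dn|le_nd] := ltnP d n; first by rewrite exact_mod_max_hdim0 //; apply: exd.
  by rewrite (bigD1 (Ordinal (le_nd : (n < d.+1)%N))) //= leq_addr.
pose J := partial_span f i; pose x := f (Ordinal le_ir).
have hJ : ideal J by apply: partial_span_ideal.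
have J1 : ~ J 1 by apply: partial_span_proper f_max.
have x_reg a : J (x * a) -> J a by apply: (f_reg (i := Ordinal le_ir)).
have JS : partial_span f i.+1 = ideal_add J x by apply: (partial_spanS f (Ordinal le_ir)).
rewrite JS in Ci exi.
have T n := cid (mx_in_add (Ci n.+1)).
pose C' := twisted x (fun n => sval (T n)).
have T_E n : mx_in J (cdiff C n.+1 *m cdiff C n - x *: sval (T n)) by apply: (svalP (T n)).
have [||c' hc'] := IHi C' (ltnW le_ir).
- exact: (twisted_complex hJ J1 x_reg T_E).
- by case=> // n _; apply: (twisted_exact hJ J1 x_reg T_E); apply: exi.
have sx : sigma x = 0 by apply/sigma_ker/f_max.
have sJ t : J t -> sigma t = 0.
  by move=> /(partial_span_max f_max) tm; apply/sigma_ker.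
have C2 : diff2_eq0 (pmap sigma C).
  apply: (complex_mod_diff2 (J := ideal_add J x)) Ci => t [a /sJ].
  by rewrite rmorphB rmorphM /= sx mul0r subr0.
pose h := hdim (pmap sigma C).
(* The recursion has step two, so h 0 and h 1 cover its two starting values; c' absorbs the
   contribution of the twisted complex. *)
exists (c' + h 0 + h 1)%N.
have step n := hdim_twisted hJ J1 x_reg T_E sJ sx n C2.
elim/ltn_ind=> -[|[|n]] IHn.
- by rewrite exp1n muln1 -/(h 0) addnAC leq_addl.
- by apply: (@leq_trans (c' + h 0 + h 1)%N); rewrite ?leq_addl // leq_pmulr // expn_gt0.
apply: leq_trans (step n) _.
apply: leq_trans (leq_add (IHn n _) (hc' n.+2)) _; first by rewrite ltnS leqW.
set a := (c' + h 0 + h 1)%N.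
have le_c : (c' <= a)%N by rewrite /a -addnA leq_addr.
apply: (@leq_trans (a * n.+3 ^ i * n.+1 + a * n.+3 ^ i)%N); last first.
  by rewrite addnC -mulnS expnSr mulnA leq_mul2l leqnSn orbT.
apply: leq_add; last by rewrite leq_mul2r le_c orbT.
have le_exp : (n.+1 ^ i <= n.+3 ^ i)%N.
  by case: (i) => // e; rewrite leq_exp2r // ltnS leqW.
by rewrite expnSr mulnA leq_mul2r leq_mul2l le_exp !orbT.
Qed.

End Growth.

(** * The theorem *)

Section Complexity.
Import Num.Theory Order.TTheory.

(** The condition minimised in [cx], convertible to it; for b = 0 the exponent is -1. *)
Definition poly_bounded (h : nat -> nat) (b : nat) : Prop :=
  exists (a : rat) (n0 : nat), forall n, (n0 <= n)%N ->
    ((h n)%:R <= a * n%:R ^ (b%:Z - 1))%R.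

Lemma exprz_pred (x : rat) c : x ^ (c.+1%:Z - 1) = x ^+ c.
Proof. by rewrite intS addrC addKr. Qed.

Lemma poly_bounded_eq0 h b : (forall n, h n = 0%N) -> poly_bounded h b.
Proof. by move=> h0; exists 0, 0%N => n _; rewrite h0 mul0r. Qed.

Lemma poly_bounded_growth h c r : (forall n, (h n <= c * n.+1 ^ r)%N) ->
  poly_bounded h r.+1.
Proof.
move=> hc; exists (c * 2 ^ r)%:R, 1%N => n n_gt0; rewrite exprz_pred.
rewrite -natrX -natrM ler_nat -mulnA -expnMn.
apply: leq_trans (hc n) _; rewrite leq_mul2l; apply/orP; right.
have le_n : (n.+1 <= 2 * n)%N by rewrite mul2n -addnn -addn1 leq_add2l.
by case: r {hc} => // r; rewrite leq_exp2r.
Qed.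

Lemma poly_bounded_shift h b b' j : (b' <= b)%N -> poly_bounded h b' ->
  poly_bounded (fun n => if (j <= n)%N then h (n - j)%N else 0%N) b.
Proof.
(* For b' = 0 the bound reads h(n) n <= a, so h vanishes eventually and the constant 0 works for
   every b. For b' > 0 the power is increasing in n and absorbs the shift. *)
move=> le_b [a [n0 ha]]; case: b' => [|c] in le_b ha *.
  have [n1 lt_n1] : exists n1 : nat, a < n1%:R.
    by exists (Num.bound `|a|); apply: le_lt_trans (ler_norm a) (archi_boundP (normr_ge0 a)).
  exists 0, (n0 + n1.+1 + j)%N => n le_n; rewrite mul0r.
  have le_nj : (n0 + n1.+1 <= n - j)%N by rewrite leq_subRL ?(leq_trans (leq_addl _ _) le_n) // addnC.
  rewrite (leq_trans (leq_addl _ _) le_n).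
  have := ha _ (leq_trans (leq_addr _ _) le_nj); rewrite sub0r exprN1.
  set l := (n - j)%N in le_nj *; have l_gt0 : (0 < l)%N.
    by apply: leq_trans le_nj; rewrite addnS.
  rewrite ler_pdivlMr ?ltr0n // -natrM => hl.
  have : ((h l * l)%N%:R < l%:R :> rat).
    apply: le_lt_trans hl (lt_le_trans lt_n1 _); rewrite ler_nat.
    by apply: leq_trans le_nj; rewrite addnS ltnW // ltnS leq_addl.
  rewrite ltr_nat -[X in (_ < X)%N]mul1n ltn_mul2r l_gt0 ltnS leqn0 => /eqP->.
  by [].
case: b le_b => // b le_b.
exists `|a|, (n0 + j + 1)%N => n le_n; rewrite exprz_pred.
have le_jn : (j <= n)%N by apply: leq_trans le_n; rewrite -addnA addnCA leq_addr.
have n_gt0 : (0 < n)%N by apply: leq_trans le_n; rewrite addn1.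
rewrite le_jn; apply: le_trans (ha _ _) _.
  rewrite leq_subRL // addnC; apply: leq_trans le_n; exact: leq_addr.
rewrite exprz_pred; apply: (@le_trans _ _ (`|a| * (n - j)%:R ^+ c)).
  by rewrite ler_wpM2r ?ler_norm // exprn_ge0.
rewrite ler_wpM2l // -!natrX ler_nat.
apply: (@leq_trans (n ^ c)); last by rewrite leq_pexp2l.
by case: (c) => // e; rewrite leq_exp2r // leq_subr.
Qed.

Lemma poly_bounded_sum (h : nat -> nat) (m b : nat) (hj : nat -> nat -> nat) :
  (forall n, (h n <= \sum_(j < m) hj j n)%N) ->
  (forall j, (j < m)%N -> poly_bounded (hj j) b) -> poly_bounded h b.
Proof.
move=> hle hb.
suff [a [n0 ha]] : poly_bounded (fun n => \sum_(j < m) hj j n)%N b.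
  by exists a, n0 => n /ha; apply: le_trans; rewrite ler_nat.
elim: m {hle} hb => [_|m IHm hb].
  by apply: poly_bounded_eq0 => n; rewrite big_ord0.
have [a [n0 ha]] := IHm (fun j lt_j => hb j (ltnW lt_j)).
have [a' [n0' ha']] := hb m (leqnn _).
exists (a + a'), (maxn n0 n0') => n; rewrite geq_max => /andP[le_n le_n'].
by rewrite big_ord_recr /= natrD mulrDl lerD ?ha ?ha'.
Qed.

End Complexity.

Lemma max_ideal_pow2_max (Q : comUnitRingType) (x : Q) : local_ring Q ->
  max_ideal_pow 2 x -> max_ideal x.
Proof.
move=> [_ Q_local] [N [c [y [ym ->]]]].
have [hm _ _] := max_ideal_prime Q_local; apply: ideal_sum => // l _.
by rewrite big_ord_recl; have [_ _ mM] := hm; apply: mM; apply: ideal_mulr.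
Qed.

(** Regularity writes the last coefficient as a_l = sum c_j f_j. Moving it into the other terms
    leaves a shorter relation with coefficients a_j + c_j f_l, which agree with a_j in A. *)
Lemma regular_sequence_relations (Q A : comUnitRingType) r (f : 'I_r -> Q)
    (pi : {rmorphism Q -> A}) :
  (forall q, pi q = 0 <-> @lin_span Q Q^o _ predT f q) -> regular_sequence f ->
  forall a : 'I_r -> Q, \sum_i f i * a i = 0 -> forall i, pi (a i) = 0.
Proof.
move=> pi_ker [f_reg _].
have pi_partial i x : partial_span f i x -> pi x = 0.
  move=> xi; apply/pi_ker; apply: (lin_span_min (R := Q)) xi; first exact: lin_span_ideal.
  by move=> j _; apply: (lin_span_gen (R := Q)).
suff gen i : (i <= r)%N -> forall a : 'I_r -> Q,
    \sum_(j < r | (j < i)%N) f j * a j = 0 -> forall j : 'I_r, (j < i)%N -> pi (a j) = 0.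
  move=> a a0 j; apply: (gen r (leqnn r) a _ j (ltn_ord j)); rewrite -[RHS]a0.
  by apply: eq_bigl => i; rewrite ltn_ord.
elim: i => // i IHi lt_ir a; pose l := Ordinal lt_ir.
rewrite (bigD1 l) /= ?ltnS // (eq_bigl (fun j : 'I_r => (j < i)%N)); last first.
  by move=> j; rewrite ltnS [RHS]ltn_neqAle andbC.
move=> a0; have [c al] : partial_span f i (a l).
  apply: (f_reg l); exists (fun j => - a j).
  move/eqP: a0; rewrite addr_eq0 => /eqP->; rewrite -sumrN.
  by apply: eq_bigr => j _; rewrite -[RHS]/(- a j * f j) mulNr mulrC.
have al0 : pi (a l) = 0 by apply: (pi_partial i); exists c.
have {}al : a l = \sum_(j < r | (j < i)%N) c j * f j := al.

have {}a0 : \sum_(j < r | (j < i)%N) f j * (a j + c j * f l) = 0.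
  rewrite -[RHS]a0 al mulr_sumr -big_split; apply: eq_bigr => j _.
  by rewrite /=; ring.
move=> j; rewrite ltnS leq_eqVlt => /orP[/eqP eq_j|lt_j].
  by have -> : j = l by apply: val_inj.
have := IHi (ltnW lt_ir) _ a0 j lt_j.
have fl0 : pi (f l) = 0 by apply/pi_ker; apply: (lin_span_gen (R := Q)).
by rewrite rmorphD rmorphM fl0 mulr0 addr0.
Qed.

Section Shifts.
Variables (Q A : comUnitRingType) (r : nat) (f : 'I_r -> Q).
Variables (pi : {rmorphism Q -> A}) (k : fieldType) (rho : {rmorphism A -> k}).
Local Notation Ek C := (pmap (rho \o pi) (lcx C)).
Local Notation EA C := (pmap pi (lcx C)).
Implicit Type C : lifted f.

Definition lshifts j C : lifted f := iter j (@lshift Q r f) C.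

Lemma pmap_shift C : EA (lshift C) = shift (EA C).
Proof.
rewrite /pmap /shift; congr Precomplex.
by apply: functional_extensionality_dep => n /=; rewrite pdiff_map.
Qed.

Lemma lshifts_resolves C j N : resolves (EA C) 0 N -> resolves (EA (lshifts j C)) j N.
Proof. by move=> hC; elim: j => //= j IHj; rewrite pmap_shift; apply: shift_resolves. Qed.

Lemma kills_lshifts C j s : kills pi rho C s -> kills pi rho (lshifts j C) s.
Proof. by move=> hC; elim: j => //= j; apply: kills_shift. Qed.

Lemma hdim_lshifts C j n :
  hdim (Ek (lshifts j C)) n = if (j <= n)%N then hdim (Ek C) (n - j) else 0%N.
Proof.
elim: j n => [|j IHj] [|n] //=; first exact: hdim_shift0.
by rewrite hdim_shiftS IHj.
Qed.
End Shifts.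

Section KoszulHomologyBounds.
Variables (Q A : comUnitRingType) (r : nat) (f : 'I_r -> Q).
Variable pi : {rmorphism Q -> A}.
Hypothesis hA : ci_presentation f pi.
Variables (k : closedFieldType) (rho : {rmorphism A -> k}).
Hypothesis hk : residue_map rho.
Variables (m : nat) (u : 'I_m -> A).
Hypothesis u_max : forall l, rho (u l) = 0.
Variables (M : lmodType A) (FM : free_resolution M) (EM : eisenbud_lift f pi FM).
Variable FH : forall j, free_resolution (koszul_homology u M j).
Variable EH : forall j, eisenbud_lift f pi (FH j).

Let pi_surj := ci_surj hA.
Let pi_ker := ci_ker hA.
Let f_rel := regular_sequence_relations (ci_ker hA) (ci_regseq hA).

(** X is the lift of K(u) (x) FM, reduced to the four properties that both halves of the theorem
    use. *)
Lemma koszul_filtration :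
  exists X : lifted f, [/\
    forall n, (n < m.+1)%N -> has_homology (pmap pi (lcx X)) n (koszul_homology u M n),
    forall n, (m < n)%N -> exact_at (pmap pi (lcx X)) n,
    forall ss, kills_seq pi rho X ss -> kills_seq pi rho (lifted_resolution EM) ss &
    forall n, (ext_dim rho FM n <= hdim (pmap (rho \o pi) (lcx X)) n)%N].
Proof.
have [|X [[alpha qi] killX hX]] :=
  @koszul_tower A m u M Q r f pi k rho pi_surj pi_ker u_max (lifted_resolution EM) m (leqnn m).
  rewrite pmap_lifted_resolution.
  apply: (@tail_quasi_iso0 A m u M (resolution_precomplex FM) (aug FM)).
  - exact: aug_surj.
  - exact: aug_exact.
  - exact: resolution_exact.
exists X; split=> //.
- by move=> n _; apply: koszul_has_homology qi.
- by move=> n; apply: koszul_exact_at qi.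
- by move=> n; rewrite (ext_dimE rho EM).
Qed.

Let S j : lifted f := lshifts j (lifted_resolution (EH j)).

Let S_resolves j : resolves (pmap pi (lcx (S j))) j (koszul_homology u M j).
Proof.
apply: lshifts_resolves; rewrite pmap_lifted_resolution; exact: resolution_resolves.
Qed.

Lemma support_variety_koszul :
  support_variety rho EM `<=` \bigcup_i support_variety rho (EH i).
Proof.
move=> L LM; apply: contrapT => nL.
have [v [vinL v0 vL]] := proj_point_vec L.
(* All s_j have to be nonzero at the same vector v. The hypothesis gives for each j only some w = c
   v, which [rescale] moves to v. *)
have /choice[s sP] : forall j, exists s, kills pi rho (lifted_resolution (EH j)) s /\
    s.@[v 0] != 0.
  move=> j; have [s [sH [w [wL w0 sw]]]] : exists s, ext_annihilator rho (EH j) s /\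
      exists w, [/\ w \in val L, w != 0 & s.@[(w : 'rV_r) 0] != 0].
    apply: contrapT => no; apply: nL; exists j => // s hs w wL w0.
    by apply/eqP; apply: contrapT => /negP sw; apply: no; exists s; split=> //; exists w.
  have [c wc] := vL w wL; have c0 : c != 0.
    by apply: contraNneq w0 => c0; rewrite wc c0 scale0r.
  exists (rescale c s); split; first exact/kills_rescale/ext_annihilator_kills.
  rewrite meval_rescale; suff -> : (fun i => c * v 0 i) = w 0 by [].
  by apply: funext => i; rewrite wc mxE.
have [X [hX exX killX _]] := koszul_filtration.
have sS i : (i < m.+1)%N -> kills pi rho (S i) (s i).
  by move=> _; apply: kills_lshifts; have [] := sP i.
have /killX := truncation_kills pi_surj pi_ker f_rel S_resolves sS hX exX.
move=> /(kills_seqP pi_ker f_rel)/kills_ext_annihilator annM.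
have := LM _ annM v vinL v0; apply/eqP.
rewrite rmorph_prod /= big_map prodf_seq_neq0; apply/allP => j _.
by have [] := sP j.
Qed.

Lemma ext_dim_koszul_sum n : (ext_dim rho FM n <=
  \sum_(j < m.+1) if (j <= n)%N then ext_dim rho (FH j) (n - j) else 0)%N.
Proof.
have [X [hX exX _ hdX]] := koszul_filtration.
apply: leq_trans (hdX n) _.
apply: leq_trans (truncation_hdim rho pi_surj pi_ker S_resolves n hX exX) _.
by apply: leq_sum => j _; rewrite hdim_lshifts (ext_dimE rho (EH j)).
Qed.

Lemma ext_dim_trivial N (F : free_resolution N) (E : eisenbud_lift f pi F) n :
  (forall v : N, v = 0) -> ext_dim rho F n = 0%N.
Proof.
move=> N0; rewrite (ext_dimE rho E); apply: hdim_eq0 => x.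
apply: (exact_cocycle_cobd pi_ker); rewrite pmap_lifted_resolution => -[|i].
  by move=> y _; apply/aug_exact; apply: N0.
exact: resolution_exact.
Qed.

Lemma sigma_ker t : rho (pi t) = 0 <-> max_ideal (t : Q).
Proof.
have Q_local : local_ring Q by have [] := ci_regular hA.
have [_ Q_add] := Q_local; have [hm m1 _] := max_ideal_prime Q_add.
have [_ _ mM] := hm; have [_ rho_ker] := hk.
rewrite rho_ker; split=> [|tm]; rewrite /max_ideal /=.
  by apply: contra; apply: rmorph_unit.
apply/negP => /mulVr; have [q <-] := pi_surj (pi t)^-1 => /eqP.
rewrite -rmorphM -subr_eq0 -[1](rmorph1 pi) -rmorphB => /eqP/pi_ker qt; apply: m1.
rewrite -(subKr (q * t) 1); apply: idealB => //; first exact: mM.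
apply: (lin_span_min (R := Q)) qt => // j _.
by apply: max_ideal_pow2_max (ci_max2 hA j).
Qed.

Lemma ext_dim_growth N (F : free_resolution N) (E : eisenbud_lift f pi F) :
  exists c, forall n, (ext_dim rho F n <= c * n.+1 ^ r)%N.
Proof.
have [Q_local _] := ci_regular hA.
have [d [g [g_gen g_reg]]] := regular_local_generators (ci_regular hA).
have f_max i : max_ideal (f i) by apply: max_ideal_pow2_max (ci_max2 hA i).
have [f_reg _] := ci_regseq hA.
have sigma_surj c : exists t, (rho \o pi) t = c.
  have [a <-] := hk.1 c; have [t <-] := pi_surj a; by exists t.
pose C := lifted_resolution E.
have ker_in p q (P : 'M[Q]_(p, q)) : map_mx pi P = 0 <-> mx_in (partial_span f r) P.
  rewrite partial_span_full; apply: iff_sym; apply: mx_in_map; exact: pi_ker.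
have [|n n_gt0|c hc] := @hdim_growth Q k (rho \o pi) Q_local sigma_surj sigma_ker d g g_gen
    g_reg r f f_max f_reg r C (leqnn r).
- by move=> n; apply/ker_in; rewrite pTE (pi_f_sum pi_ker).
- move=> x /ker_in; rewrite map_mxM -pdiff_map => xD.
  have : exact_at (pmap pi (lcx C)) n.
    by rewrite pmap_lifted_resolution; apply: resolution_exact.
  move=> /(_ _ xD)[y' xE]; have [y yE] := pi_surj_mx pi_surj y'.
  by exists y; apply/ker_in; rewrite map_mxB map_mxM yE xE subrr.
by exists c => n; rewrite (ext_dimE rho E).
Qed.

(** Polynomial growth shows that the set of admissible exponents is nonempty, so [cx] is attained
    and not the default value of [least]. *)
Lemma cx_poly_bounded N (F : free_resolution N) (E : eisenbud_lift f pi F) :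
  poly_bounded (ext_dim rho F) (cx rho F).
Proof.
have [c hc] := ext_dim_growth E.
by have [] := @leastP [set b | poly_bounded (ext_dim rho F) b]
  (ex_intro _ r.+1 (poly_bounded_growth hc)).
Qed.

Variables (I : submodClosed A^o) (G : free_resolution (quot_mod I)).
Hypothesis gen_u : @generates A A^o [set` I] _ u.

Lemma koszul_homology_trivial g j : (forall i, (i < g)%N -> ~ ext_neq0 M G i) ->
  (m < j + g)%N -> forall v : koszul_homology u M j, v = 0.
Proof.
move=> hg lt_m v; have [z zZ <-] := subquot_class_surj v.
apply/(subquot_class_eq0 _ zZ)/asboolP; have /asboolP[zj dz] := zZ.
exact: (koszul_grade_vanishing gen_u hg lt_m zj dz).
Qed.

Lemma cx_koszul_bound g : (forall i, (i < g)%N -> ~ ext_neq0 M G i) ->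
  (cx rho FM <= \max_(j < m.+1 - g) cx rho (FH j))%N.
Proof.
move=> hg; set b := (\max_(_ < _) _)%N.
suff hb : poly_bounded (ext_dim rho FM) b.
  by have [_] := @leastP [set b | poly_bounded (ext_dim rho FM) b] (ex_intro _ b hb); apply.
apply: (poly_bounded_sum (m := m.+1)) ext_dim_koszul_sum _ => j lt_jm.
have [lt_jg|le_gj] := ltnP j (m.+1 - g)%N.
  apply: (@poly_bounded_shift _ b _ j) (cx_poly_bounded (EH j)).
  exact: (leq_bigmax (Ordinal lt_jg)).
(* From j = m + 1 - g on the Koszul homology is zero and contributes nothing. *)
apply: poly_bounded_eq0 => n; case: ifP => // _.
apply: (ext_dim_trivial (EH j)); apply: koszul_homology_trivial hg _.
by rewrite leq_subLR addnC in le_gj.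
Qed.

End KoszulHomologyBounds.

(** Resolutions and lifts are arbitrary data, so the result holds for every choice. The indices
    below mu(I) + 1 - g are 0, ..., mu(I) - g, and infinite grade gives the empty maximum 0. *)
Theorem theorem1p7 (Q A : comUnitRingType) (r : nat) (f : 'I_r -> Q)
  (pi : {rmorphism Q -> A}) (hA : ci_presentation f pi)
  (k : closedFieldType) (rho : {rmorphism A -> k}) (hk : residue_map rho)
  (I : submodClosed A^o) (hI : (1 : A^o) \notin I)
  (u : 'I_(mu [set` I]) -> A) (hu : @generates A A^o [set` I] _ u)
  (M : lmodType A) (hM : fin_gen [set: M])
  (FM : free_resolution M) (EM : eisenbud_lift f pi FM)
  (FH : forall j, free_resolution (koszul_homology u M j))
  (EH : forall j, eisenbud_lift f pi (FH j))
  (G : free_resolution (quot_mod I)) :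
  support_variety rho EM `<=` \bigcup_i support_variety rho (EH i) /\
  (cx rho FM <=
     if grade M G is Some g
     then \max_(j < (mu [set` I]).+1 - g) cx rho (FH j) else 0)%N.
Proof.
(* A generator of the proper ideal I is not a unit. *)
have u_max l : rho (u l) = 0.
  apply/hk.2; apply/negP => /mulVr ul; case/negP: hI.
  have Iul : (u l : A^o) \in I.
    suff : [set` I] (u l : A^o) by [].
    by rewrite hu; apply: (lin_span_gen (R := A)).
  by rewrite -[1 : A^o]ul; apply: (rpredZ (u l)^-1 Iul).
split; first exact: (support_variety_koszul hA u_max EH).
rewrite /grade /ext_inf; case: asboolP => [ex|noex].
  have [_ min] := leastP ex.
  apply: (cx_koszul_bound hA hk u_max EM EH hu) => i lt_i /min.
  by rewrite leqNgt lt_i.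
(* When all Ext vanish, any g is admissible; mu(I) + 1 makes the range of the maximum empty. *)
have := cx_koszul_bound hA hk u_max EM EH (g := (mu [set` I]).+1) hu (G := G).
rewrite subnn big_ord0; apply => i _ hi; apply: noex; by exists i.
Qed.
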